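(* Fix $p\in[1,2]$. For all $n,d,\Delta\in\mathbb{N}$ there is a two-pass turnstile streaming algorithm using $\mathrm{polylog}(n,d,\Delta)$ bits of space which, given two multisets $A,B\subset[\Delta]^d$ of size $n$, outputs $\hat\eta\in\mathbb{R}$ satisfying \[\mathsf{EMD}_{\ell_p}(A,B)\le\hat\eta\le\tilde O(\log n)\cdot\mathsf{EMD}_{\ell_p}(A,B)\] with high probability.
   Context: $[\Delta]=\{1,\dots,\Delta\}$. For multisets $A,B$ of equal size $n$, $\mathsf{EMD}_{\ell_p}(A,B)=\min_{M}\sum_{(a,b)\in M}\|a-b\|_p$ over perfect matchings $M\subset A\times B$. In the turnstile geometric streaming model the algorithm receives an arbitrarily ordered sequence of insertions and deletions of points of $[\Delta]^d$, each update specifying whether it applies to $A$ or to $B$; $A,B$ are the resulting multisets at the end of the stream. A two-pass algorithm reads the same stream twice. Space is measured in the random-oracle model (random bits are free and do not count against space; space is the number of bits stored between updates). $\tilde O(\log n)$ denotes a quantity at most $\log n\cdot\mathrm{poly}(\log\log n)$ up to absolute constants, independent of $d,\Delta$. *)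

(* Defs.v *)
From HB Require Import structures.
From mathcomp Require Import all_boot all_order all_algebra.
From mathcomp Require Import finmap multiset.
From mathcomp Require Import all_classical all_reals all_analysis.

Set Implicit Arguments.
Unset Strict Implicit.
Unset Printing Implicit Defensive.

Import Order.TTheory GRing.Theory Num.Theory.

Local Open Scope mset_scope.
Local Open Scope ring_scope.

Section EarthMoverDistance.
Variables (R : realType) (d Delta : nat).

(* [Delta]^d: the ordinal i : 'I_Delta stands for the integer i + 1. *)
Definition grid := {ffun 'I_d -> 'I_Delta}.

Definition coord (x : grid) (i : 'I_d) : R := (x i).+1%:R.

Definition lp_dist (p : R) (x y : grid) : R :=
  (\sum_(i < d) `|coord x i - coord y i| `^ p) `^ p^-1.

(* A perfect matching between A and B is a multiset of pairs with marginals A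
   and B.  Sorted by its first components it reads zip A s, where s is an
   ordering of the elements of B. *)
Definition perfect_matchings (A B : {mset grid}) : seq (seq (grid * grid)) :=
  [seq zip A s | s <- permutations B].

Definition matching_cost (p : R) (M : seq (grid * grid)) : R :=
  \sum_(ab <- M) lp_dist p ab.1 ab.2.

(* The default value of the minimum is itself the cost of a perfect matching
   when A and B have the same size. *)
Definition EMD (p : R) (A B : {mset grid}) : R :=
  \big[Num.min/matching_cost p (zip A B)]_(M <- perfect_matchings A B)
    matching_cost p M.

Definition is_perfect_matching (A B : {mset grid}) (M : seq (grid * grid)) :=
  perm_eq (unzip1 M) A && perm_eq (unzip2 M) B.

Lemma EMD_attained (p : R) (A B : {mset grid}) : size A = size B ->
  exists2 M, is_perfect_matching A B M & EMD p A B = matching_cost p M.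
Proof.
move=> AB; rewrite /EMD big_seq.
elim/big_ind: _ => [|x y [M HM ->] [N HN ->]|M /mapP[s]].
- exists (zip A B) => //.
  by rewrite /is_perfect_matching unzip1_zip ?unzip2_zip ?AB // !perm_refl.
- by case: (leP (matching_cost p M) (matching_cost p N)) => _; [exists M|exists N].
rewrite mem_permutations => sB ->; exists (zip A s) => //.
have sz := perm_size sB.
by rewrite /is_perfect_matching unzip1_zip ?unzip2_zip ?AB ?sz // perm_refl.
Qed.

Lemma EMD_le (p : R) (A B : {mset grid}) (M : seq (grid * grid)) :
  is_perfect_matching A B M -> EMD p A B <= matching_cost p M.
Proof.
case/andP=> M1 M2.
have [N NM NA] : exists2 N, perm_eq N M & unzip1 N = A.
  case: M {M2} M1 => [|m0 M] M1.
    by move/perm_size: M1 => /= /esym/size0nil ->; exists [::].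
  move: M1; rewrite perm_sym => /(perm_iotaP m0.1)[r rP ->].
  rewrite size_map in rP.
  exists [seq nth m0 (m0 :: M) i | i <- r].
    by apply/(perm_iotaP m0); exists r.
  rewrite /unzip1 -map_comp; apply/eq_in_map => i.
  rewrite (perm_mem rP) mem_iota /= add0n => iM.
  by rewrite (nth_map m0 _ fst (s := m0 :: M)).
have -> : matching_cost p M = matching_cost p (zip A (unzip2 N)).
  by rewrite -NA zip_unzip /matching_cost (perm_big _ NM).
apply: ge_bigmin_seq => //; apply: map_f.
rewrite mem_permutations; apply: perm_trans M2; exact: perm_map.
Qed.

End EarthMoverDistance.

Arguments EMD {R d Delta} p A B.

Record update (T : Type) := Update {
  to_B : bool;
  is_insertion : bool;
  upd_point : T }.

Definition net_count (T : eqType) (side : bool) (s : seq (update T)) (x : T) : int :=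
  \sum_(u <- s | (to_B u == side) && (upd_point u == x))
    (if is_insertion u then 1 else -1).

(* Only the final multiplicities are constrained: deletions may precede the
   matching insertions, and the stream may be arbitrarily long. *)
Definition stream_yields (T : choiceType) (s : seq (update T)) (A B : {mset T}) :=
  forall x, net_count false s x = (A x)%:Z /\ net_count true s x = (B x)%:Z.

(* Random-oracle model: every component may consult the whole random string,
   which is not part of the memory; only [mem_bits] bits survive between two
   updates, and the computation performed within an update is unrestricted.
   [rewind] is applied between the two passes. *)
Record two_pass_algorithm (U V : Type) := TwoPassAlgorithm {
  random_bits : nat;
  mem_bits : nat;
  oracle := random_bits.-tuple bool;
  memory := mem_bits.-tuple bool;
  start : oracle -> memory;
  first_pass : oracle -> memory -> U -> memory;
  rewind : oracle -> memory -> memory;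
  second_pass : oracle -> memory -> U -> memory;
  output : oracle -> memory -> V }.

Definition run (U V : Type) (alg : two_pass_algorithm U V) (s : seq U)
    (w : oracle alg) : V :=
  let m := foldl (first_pass w) (start w) s in
  output w (foldl (second_pass w) (rewind w m) s).

Arguments run {U V} alg s w.

Definition coin_prob (R : realType) (m : nat) (E : pred (m.-tuple bool)) : R :=
  #|[pred w | E w]|%:R / (2 ^ m)%:R.

(* log n, shifted to be at least 1 for every n (including 0 and 1). *)
Definition log1 (R : realType) (n : nat) : R := 1 + ln n.+1%:R.

Definition Otilde_log (R : realType) (C : R) (k n : nat) : R :=
  C * log1 R n * (1 + ln (log1 R n)) ^+ k.

Definition polylog3 (R : realType) (K : R) (l n d Delta : nat) : R :=
  K * (log1 R n + log1 R d + log1 R Delta) ^+ l.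

(* Main.v *)
Require Import Defs.
From HB Require Import structures.
From mathcomp Require Import all_boot all_order all_algebra.
From mathcomp Require Import finmap multiset.
From mathcomp Require Import all_classical all_reals all_analysis.
From mathcomp Require Import ring lra.
From mathcomp Require Import zify.

Set Implicit Arguments.
Unset Strict Implicit.
Unset Printing Implicit Defensive.

Import Order.TTheory GRing.Theory Num.Theory.

Local Open Scope mset_scope.
Local Open Scope ring_scope.

(** Embed ([Delta]^d, lp) with constant distortion into a finite cut metric
    D(x, y) = sum of wt k over the cuts k separating x and y: an lp distance,
    1 <= p <= 2, is comparable to the mean absolute value of a randomly signed sum
    of the coordinates scaled by independent heavy-tailed powers of two.  Build a
    random tree for D whose level j keeps cut k with probability
    1 - exp (- wt k / r_j), r_j = r_0 / 2^j, and charge the edge above a bucket v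
    the D-average W_v between the points of v and the points of its parent outside
    v.  By Kantorovich duality along root paths, the sum of W_v times the imbalance
    |A_v - B_v| always dominates the matching cost of some perfect matching.
    In the other direction an entropy argument telescopes: for a fixed point, let
    M_j be its mean D-distance to its level-j bucket and N_j the size of that
    bucket; then E M_(j+1) / r_j = O(E ln N_j - E ln N_(j+1)), so the total over
    all levels is O(log n), with no loss in the number of levels, and the expected
    tree cost of an optimal matching is O(log n) times its length.

    For each level, the first pass samples a bucket with probability roughly
    proportional to its imbalance: buckets get random dyadic scales, and a scaled
    sum of imbalances that is large is typically dominated by one bucket, whose
    hashed name is read off from bitwise counters.  The second pass measures
    W_v for the sampled bucket by counting its points, and those of its parent, in
    the two classes of a random parity of cuts.  All counters are linear, hence can
    be kept modulo a power of two; the failure probability is reduced by taking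
    the median of independent copies. *)

(** * Finite probability spaces *)

Section FiniteDistributions.
Variable R : realType.

(** Cuts make both random objects tractable: the tree and the parity treat cuts independently, so
    their separation probabilities are exact exponential functions of [D]. The set of cuts is
    enormous, but it is only consulted through the random string and never stored. A second pass is
    needed because [W_v] is not linear in the data: it is a ratio of counts around [v], and there
    are far too many buckets to keep such counts before the sampled ones are known. The delicate
    point is the factor. A loss proportional to the number of levels would bring in log (d Delta).
    So the multiplicative losses of sampling are kept constant, and the rest (several labels hidden
    in one large counter, sampling noise) is additive: a small multiple of [r_j] times the total
    imbalance of level j. A pair at distance D is separated by level j with probability O(D / r_j),
    hence pays O(D) per level, and a multiple of order 1 / L suffices; this costs only memory.
    Within a bucket, distances over [r_j] are bounded only by a logarithmic [tau], off a rare event;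
    [tau] enters these additive terms alone. *)

Record fdist (T : finType) := Fdist {
  fd :> T -> R;
  fd_ge0 : forall t, 0 <= fd t;
  fd_sum1 : \sum_t fd t = 1 }.

Definition Ex (T : finType) (mu : fdist T) (X : T -> R) : R := \sum_t mu t * X t.
Definition Pr (T : finType) (mu : fdist T) (E : pred T) : R :=
  Ex mu (fun t => (E t)%:R).

Section Expectation.
Variables (T : finType) (mu : fdist T).
Implicit Types (X Y : T -> R) (E F : pred T).

Lemma eq_Ex X Y : X =1 Y -> Ex mu X = Ex mu Y.
Proof. by move=> XY; apply: eq_bigr => t _; rewrite XY. Qed.

Lemma Ex_cst (a : R) : Ex mu (fun=> a) = a.
Proof. by rewrite /Ex -mulr_suml fd_sum1 mul1r. Qed.

Lemma ExD X Y : Ex mu (fun t => X t + Y t) = Ex mu X + Ex mu Y.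
Proof. by rewrite /Ex -big_split; apply: eq_bigr => t _; rewrite mulrDr. Qed.

Lemma ExZl (a : R) X : Ex mu (fun t => a * X t) = a * Ex mu X.
Proof. by rewrite /Ex mulr_sumr; apply: eq_bigr => t _; rewrite mulrCA. Qed.

Lemma ExZr X (a : R) : Ex mu (fun t => X t * a) = Ex mu X * a.
Proof. by rewrite mulrC -ExZl; apply: eq_Ex => t; rewrite mulrC. Qed.

Lemma ExN X : Ex mu (fun t => - X t) = - Ex mu X.
Proof. by rewrite -mulN1r -ExZl; apply: eq_Ex => t; rewrite mulN1r. Qed.

Lemma ExB X Y : Ex mu (fun t => X t - Y t) = Ex mu X - Ex mu Y.
Proof. by rewrite -ExN -ExD. Qed.

Lemma Ex_sum (I : Type) (r : seq I) (P : pred I) (F : I -> T -> R) :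
  Ex mu (fun t => \sum_(i <- r | P i) F i t) = \sum_(i <- r | P i) Ex mu (F i).
Proof. by rewrite /Ex exchange_big; apply: eq_bigr => t _; rewrite mulr_sumr. Qed.

Lemma ler_Ex X Y : (forall t, X t <= Y t) -> Ex mu X <= Ex mu Y.
Proof. by move=> XY; apply: ler_sum => t _; rewrite ler_wpM2l ?fd_ge0. Qed.

Lemma Ex_ge0 X : (forall t, 0 <= X t) -> 0 <= Ex mu X.
Proof. by move=> X0; rewrite -[leLHS](Ex_cst 0); apply: ler_Ex. Qed.

Lemma Ex_le X (a : R) : (forall t, X t <= a) -> Ex mu X <= a.
Proof. by move=> Xa; rewrite -[leRHS]Ex_cst; apply: ler_Ex. Qed.

Lemma Pr_ge0 E : 0 <= Pr mu E.
Proof. by apply: Ex_ge0 => t. Qed.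

Lemma ler_Pr E F : (forall t, E t -> F t) -> Pr mu E <= Pr mu F.
Proof. by move=> EF; apply: ler_Ex => t; rewrite ler_nat; case: (E t) (EF t) => // ->. Qed.

Lemma PrC E : Pr mu E = 1 - Pr mu (fun t => ~~ E t).
Proof.
rewrite -[X in X - _](Ex_cst 1) -ExB; apply: eq_Ex => t.
by case: (E t); rewrite /= ?subr0 ?subrr.
Qed.

Lemma Pr_or E F : Pr mu (fun t => E t || F t) <= Pr mu E + Pr mu F.
Proof.
rewrite -ExD; apply: ler_Ex => t.
by case: (E t); case: (F t); rewrite ?addr0 ?add0r ?lerDl ?ler01.
Qed.

Lemma Pr_exists (I : finType) (F : I -> pred T) :
  Pr mu (fun t => [exists i, F i t]) <= \sum_i Pr mu (F i).
Proof.
rewrite -Ex_sum; apply: ler_Ex => t.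
case: existsP => [[i Fi]|_]; last by apply: sumr_ge0.
by rewrite (bigD1 i) //= Fi lerDl; apply: sumr_ge0.
Qed.

Lemma markov_fin X (a : R) : (forall t, 0 <= X t) -> 0 < a ->
  Pr mu (fun t => a <= X t) <= Ex mu X / a.
Proof.
move=> X0 a0; rewrite -ExZr; apply: ler_Ex => t.
case aX: (a <= X t) => /=; last by rewrite mulr_ge0 ?invr_ge0 ?(ltW a0).
by rewrite ler_pdivlMr // mul1r.
Qed.

End Expectation.

Section Constructions.

Definition fprod_fun (S T : finType) (mu : fdist S) (nu : fdist T) (u : S * T) :=
  mu u.1 * nu u.2.

Lemma fprod_ge0 (S T : finType) (mu : fdist S) (nu : fdist T) u :
  0 <= fprod_fun mu nu u.
Proof. by rewrite mulr_ge0 ?fd_ge0. Qed.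

Lemma fprod_sum1 (S T : finType) (mu : fdist S) (nu : fdist T) :
  \sum_u fprod_fun mu nu u = 1.
Proof.
rewrite -(fd_sum1 mu) -(pair_bigA _ (fun s t => mu s * nu t)) /=.
by apply: eq_bigr => s _; rewrite -mulr_sumr fd_sum1 mulr1.
Qed.

Definition fprod (S T : finType) (mu : fdist S) (nu : fdist T) : fdist (S * T)%type :=
  Fdist (fprod_ge0 mu nu) (fprod_sum1 mu nu).

Lemma Ex_prod (S T : finType) (mu : fdist S) (nu : fdist T) (X : S * T -> R) :
  Ex (fprod mu nu) X = Ex mu (fun s => Ex nu (fun t => X (s, t))).
Proof.
transitivity (\sum_s \sum_t mu s * nu t * X (s, t)).
  by rewrite pair_bigA; apply: eq_bigr => -[].
by apply: eq_bigr => s _; rewrite mulr_sumr; apply: eq_bigr => t _; rewrite mulrA.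
Qed.

Definition unif_fun (T : finType) (t : T) : R := #|T|%:R^-1.

Lemma unif_ge0 (T : finType) (t : T) : 0 <= unif_fun t.
Proof. by rewrite invr_ge0. Qed.

Lemma unif_sum1 (T : finType) (T0 : (0 < #|T|)%N) : \sum_t @unif_fun T t = 1.
Proof. by rewrite /unif_fun sumr_const -(mulr_natl (#|T|%:R^-1)) mulfV // pnatr_eq0 -lt0n. Qed.

Definition unif (T : finType) (T0 : (0 < #|T|)%N) : fdist T :=
  Fdist (@unif_ge0 T) (unif_sum1 T0).

Definition bern_fun (q : R) (b : bool) := if b then q else 1 - q.

Lemma bern_ge0 q : 0 <= q <= 1 -> forall b, 0 <= bern_fun q b.
Proof. by move=> /andP[? ?] []; rewrite /= ?subr_ge0. Qed.

Lemma bern_sum1 q : \sum_b bern_fun q b = 1.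
Proof. by rewrite big_bool /= addrC subrK. Qed.

Definition bern q (q01 : 0 <= q <= 1) : fdist bool :=
  Fdist (bern_ge0 q01) (bern_sum1 q).

Lemma Ex_bern q (q01 : 0 <= q <= 1) (X : bool -> R) :
  Ex (bern q01) X = q * X true + (1 - q) * X false.
Proof. by rewrite /Ex big_bool. Qed.

End Constructions.

(** * Independent families of random variables *)

Section Powers.
Variables (I T : finType) (mu : I -> fdist T).

Definition fpow_fun (w : {ffun I -> T}) := \prod_i mu i (w i).

Lemma fpow_ge0 w : 0 <= fpow_fun w.
Proof. by apply: prodr_ge0 => i _; apply: fd_ge0. Qed.

Lemma sum_fpow (h : I -> T -> R) :
  \sum_(w : {ffun I -> T}) fpow_fun w * \prod_i h i (w i) = \prod_i Ex (mu i) (h i).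
Proof.
rewrite /Ex bigA_distr_bigA /=; apply: eq_bigr => w _.
by rewrite -big_split.
Qed.

Lemma fpow_sum1 : \sum_w fpow_fun w = 1.
Proof.
transitivity (\prod_(i : I) (1 : R)); last exact: big1_eq.
transitivity (\sum_w fpow_fun w * \prod_(i : I) (fun _ _ => 1) i (w i) : R).
  by apply: eq_bigr => w _; rewrite big1 ?mulr1.
by rewrite (sum_fpow (fun _ _ => 1)); apply: eq_bigr => i _; rewrite Ex_cst.
Qed.

Definition fpow : fdist {ffun I -> T} := Fdist fpow_ge0 fpow_sum1.

Lemma Ex_fpow_prod (h : I -> T -> R) :
  Ex fpow (fun w => \prod_i h i (w i)) = \prod_i Ex (mu i) (h i).
Proof. exact: sum_fpow. Qed.

Lemma Ex_fpow_proj (i : I) (X : T -> R) : Ex fpow (fun w => X (w i)) = Ex (mu i) X.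
Proof.
transitivity (Ex fpow (fun w => \prod_j (if j == i then X (w j) else 1))).
  by apply: eq_Ex => w; rewrite -big_mkcond big_pred1_eq.
rewrite (Ex_fpow_prod (fun j t => if j == i then X t else 1)).
rewrite (bigD1 i) //= eqxx big1 ?mulr1 // => j /negPf->; exact: Ex_cst.
Qed.

Definition mixf (S : pred I) (w w' : {ffun I -> T}) : {ffun I -> T} :=
  [ffun i => if S i then w i else w' i].

(* The swap (w, w') |-> (mixf S w w', mixf S w' w) is an involution preserving
   the product weight. *)
Lemma Ex_resample (S : pred I) (X : {ffun I -> T} -> R) :
  Ex fpow X = Ex fpow (fun w => Ex fpow (fun w' => X (mixf S w w'))).
Proof.
transitivity (Ex (fprod fpow fpow) (fun u => X u.1)).
  by rewrite Ex_prod; apply: eq_Ex => w /=; rewrite Ex_cst.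
transitivity (Ex (fprod fpow fpow) (fun u => X (mixf S u.1 u.2)));
  last by rewrite Ex_prod.
pose sw (u : {ffun I -> T} * {ffun I -> T}) := (mixf S u.1 u.2, mixf S u.2 u.1).
have swK : involutive sw.
  by move=> [u v]; congr pair; apply/ffunP => i; rewrite !ffunE /=; case: (S i).
rewrite /Ex (reindex_inj (inv_inj swK)); apply: eq_bigr => -[u v] _ /=.
congr (_ * _); rewrite /fprod_fun /= /fpow_fun -!big_split /=.
by apply: eq_bigr => i _; rewrite !ffunE; case: (S i) => //; rewrite mulrC.
Qed.

Definition depends_on (S : pred I) (X : {ffun I -> T} -> R) :=
  forall w w' : {ffun I -> T}, (forall i, S i -> w i = w' i) -> X w = X w'.

Lemma Ex_indep (S : pred I) (X Y : {ffun I -> T} -> R) :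
  depends_on S X -> depends_on (predC S) Y ->
  Ex fpow (fun w => X w * Y w) = Ex fpow X * Ex fpow Y.
Proof.
move=> XS YS; rewrite (Ex_resample S) -ExZr; apply: eq_Ex => w.
rewrite -ExZl; apply: eq_Ex => w'.
by congr (_ * _); [apply: XS => i Si|apply: YS => i /negPf Si]; rewrite ffunE Si.
Qed.

Lemma Ex_fpow_indep2 (i j : I) (F G : T -> R) : i != j ->
  Ex fpow (fun w => F (w i) * G (w j)) = Ex (mu i) F * Ex (mu j) G.
Proof.
move=> ij; rewrite -(Ex_fpow_proj i) -(Ex_fpow_proj j).
apply: (@Ex_indep (pred1 i)) => w w' ww'; first by rewrite ww' //= eqxx.
by rewrite ww' //= eq_sym.
Qed.

(** Distinct trials are uncorrelated and each has variance at most 1. The injection [q] selects the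
    trials of one level inside a family indexed by levels and trials, whose laws vary with the
    level. *)
Lemma chebyshev_mean (m : nat) (q : 'I_m -> I) (X : T -> R) (e dl : R) :
  injective q -> (forall t, 0 <= X t <= 1) ->
  (forall s, Ex (mu (q s)) X = e) -> 0 < dl -> (0 < m)%N ->
  Pr fpow (fun w => dl <= `|m%:R^-1 * (\sum_(s < m) X (w (q s))) - e|)
    <= (m%:R * dl ^+ 2)^-1.
Proof.
move=> qinj X01 Xe dl0 m0.
have m0R : 0 < m%:R :> R by rewrite ltr0n.
pose Z w : R := \sum_(s < m) (X (w (q s)) - e).
have EZ2 : Ex fpow (fun w => Z w ^+ 2) <= m%:R.
  have -> : Ex fpow (fun w => Z w ^+ 2) =
      \sum_(s < m) \sum_(t < m) Ex fpow (fun w => (X (w (q s)) - e) * (X (w (q t)) - e)).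
    rewrite -(eq_bigr _ (fun s _ => Ex_sum _ _ _ _)) -Ex_sum; apply: eq_Ex => w.
    by rewrite expr2 /Z mulr_suml; apply: eq_bigr => s _; rewrite mulr_sumr.
  have -> : m%:R = \sum_(s < m) 1 :> R by rewrite sumr_const card_ord.
  apply: ler_sum => s _; rewrite (bigD1 s) //= big1 ?addr0; last first.
    move=> t ts; rewrite (@Ex_fpow_indep2 (q s) (q t) (fun x => X x - e) (fun x => X x - e));
      last by rewrite (inj_eq qinj) eq_sym.
    by rewrite ExB Xe Ex_cst subrr mul0r.
  rewrite (@Ex_fpow_proj (q s) (fun x => (X x - e) * (X x - e))).
  have e01 : 0 <= e <= 1.
    rewrite -(Xe s) Ex_ge0 => [|t]; last by case/andP: (X01 t).
    by rewrite Ex_le // => t; case/andP: (X01 t).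
  by apply: Ex_le => t; move: (X01 t) e01; nra.
apply: le_trans (_ : Ex fpow (fun w => Z w ^+ 2) / (m%:R * dl) ^+ 2 <= _).
  apply: le_trans (markov_fin fpow (X := fun w => Z w ^+ 2) _ _); first last.
  - by rewrite exprn_gt0 // mulr_gt0.
  - by move=> w; apply: sqr_ge0.
  apply: ler_Pr => w dlw; rewrite -[Z w ^+ 2]real_normK ?num_real //.
  rewrite ler_pXn2r ?nnegrE ?mulr_ge0 ?(ltW dl0) //.
  have -> : Z w = m%:R * (m%:R^-1 * (\sum_(s < m) X (w (q s))) - e).
    rewrite mulrBr mulrA divff ?gt_eqF // mul1r /Z sumrB sumr_const card_ord.
    by rewrite mulr_natl.
  by rewrite normrM (ger0_norm (ltW m0R)) ler_pM2l.
rewrite ler_pdivrMr; last by rewrite exprn_gt0 // mulr_gt0.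
apply: le_trans EZ2 _; rewrite exprMn expr2 -!mulrA invfM.
suff -> : m%:R^-1 * (dl ^+ 2)^-1 * (m%:R * (m%:R * dl ^+ 2)) = m%:R :> R by [].
by field; rewrite !gt_eqF.
Qed.

End Powers.

(** * Amplification by medians and simulation by fair coins *)

(** Exponential moment: each bad coordinate contributes a factor 16, so the product has mean at most
    [(1 + 15 / 16) ^ m <= 2 ^ m], whereas a half of bad coordinates makes it at least [4 ^ m]. *)
Lemma majority_bad (I T : finType) (mu : fdist T) (bad : pred T) :
  Pr mu bad <= 16^-1 ->
  Pr (fpow (fun _ : I => mu)) (fun w => (#|I| <= #|[pred i | bad (w i)]| * 2)%N)
    <= (2 ^+ #|I|)^-1.
Proof.
move=> hp; set m := #|I|.
pose X (w : {ffun I -> T}) : R := \prod_i (if bad (w i) then 16 else 1).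
have EX : Ex (fpow (fun _ : I => mu)) X <= 2 ^+ m.
  rewrite (Ex_fpow_prod (fun _ => mu) (fun _ t => if bad t then 16 else 1)).
  rewrite prodr_const; apply: lerXn2r; rewrite ?nnegrE //.
    by apply: Ex_ge0 => t; case: ifP.
  have -> : Ex mu (fun t => if bad t then 16 else 1) = 1 + 15 * Pr mu bad.
    rewrite -(ExZl mu 15) -[X in X + _](Ex_cst mu) -ExD.
    by apply: eq_Ex => t; case: ifP => _ /=; ring.
  lra.
apply: le_trans (_ : Ex (fpow (fun _ : I => mu)) X / 4 ^+ m <= _).
  apply: le_trans (markov_fin (fpow (fun _ : I => mu)) (X := X) _ _); first last.
  - by rewrite exprn_gt0.
  - by move=> w; apply: prodr_ge0 => i _; case: ifP.
  apply: ler_Pr => w h; rewrite /X -big_mkcond prodr_const.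
  have -> : 4 ^+ m = 2 ^+ (m * 2) :> R by rewrite mulnC exprM; congr (_ ^+ _); ring.
  set k := (X in _ <= _ ^+ X); have -> : 16 ^+ k = 2 ^+ (k * 4) :> R.
    by rewrite mulnC exprM; congr (_ ^+ _); ring.
  rewrite ler_weXn2l ?ler1n // (_ : 4 = 2 * 2)%N // mulnA leq_mul2r /=.
  by apply: leq_trans h _; rewrite leq_mul2r /= /k.
rewrite ler_pdivrMr ?exprn_gt0 //; apply: le_trans EX _.
rewrite -exprVn -exprMn (_ : 2^-1 * 4 = 2) //; lra.
Qed.

(** [med] must not depend on the window. It is the least value with a strict majority of values at
    or below it: the largest value in the window qualifies, so [med f <= hi], and [med f < lo] would
    give two disjoint strict majorities. *)
Lemma robust_median (I : finType) : exists med : (I -> R) -> R,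
  forall (f : I -> R) lo hi,
    (#|I| < #|[pred i | (lo <= f i <= hi)%R]| * 2)%N -> lo <= med f <= hi.
Proof.
pose up (f : I -> R) i := (#|I| < #|[pred j | (f j <= f i)%R]| * 2)%N.
pose med f := match [pick i | up f i] with
  | Some i0 => f [arg min_(i < i0 | up f i) f i]%O
  | None => 0 end.
exists med => f lo hi maj.
have [i1 i1P] : exists i, lo <= f i <= hi.
  apply/existsP; apply: contraLR maj => /existsPn h.
  by rewrite -leqNgt (eq_card0 (A := [pred i | lo <= f i <= hi])) // => i; apply/negbTE/h.
pose i2 := [arg max_(i > i1 | lo <= f i <= hi) f i]%O.
have [i2P i2max] : (lo <= f i2 <= hi) /\ (forall j, lo <= f j <= hi -> f j <= f i2).
  by rewrite /i2; case: arg_maxP.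
have up2 : up f i2.
  apply: leq_trans maj _; rewrite leq_mul2r /=; apply: subset_leq_card.
  by apply/fintype.subsetP => j; rewrite !inE; apply: i2max.
rewrite /med; case: pickP => [i0 up0|/(_ i2)]; last by rewrite up2.
case: arg_minP => // i3 up3 min3; apply/andP; split; last first.
  by apply: le_trans (min3 _ up2) _; case/andP: i2P.
rewrite leNgt; apply/negP => lo3.
have : (#|[pred j | (f j <= f i3)%R]| + #|[pred i | (lo <= f i <= hi)%R]| <= #|I|)%N.
  rewrite -cardUI; set D := #|[predI _ & _]|.
  have -> : D = 0%N.
    apply: eq_card0 => j; rewrite !inE; apply/negP => /and3P[j3 loj _].
    by move: lo3; rewrite ltNge (le_trans loj j3).
  by rewrite addn0; apply: max_card.
move: maj up3; rewrite /up; lia.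
Qed.

Lemma fdist_inhabited (T : finType) (mu : fdist T) : (0 < #|T|)%N.
Proof.
rewrite lt0n; apply/eqP => T0; have := fd_sum1 mu.
by rewrite big1 => [/eqP|t _]; [rewrite eq_sym oner_eq0|have := fintype0 t; rewrite T0].
Qed.

(** Outcome [t] receives [mu t * 2 ^ m] strings, rounded down. Rounding loses at most [#|T|] strings
    in all, a fraction at most [eps]; the unassigned strings fall on the default [t0], which can
    only help a lower bound. *)
Lemma simulate_by_coins (T : finType) (mu : fdist T) (eps : R) : 0 < eps ->
  exists (m : nat) (f : m.-tuple bool -> T),
    forall E : pred T, Pr mu E - eps <= coin_prob R (fun w => E (f w)).
Proof.
move=> eps0; have T0 := fdist_inhabited mu.
pose t0 : T := enum_val (Ordinal T0).
have [m hm] : exists m : nat, #|T|%:R / eps <= 2 ^+ m.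
  have [k hk] : exists k : nat, #|T|%:R / eps <= k%:R.
    exists (Num.truncn (#|T|%:R / eps)).+1; exact/ltW/truncnS_gt.
  exists k; apply: le_trans hk _; rewrite -natrX ler_nat; exact/ltnW/ltn_expl.
pose N : R := 2 ^+ m; have N0 : 0 < N by rewrite exprn_gt0.
pose n t := Num.truncn (mu t * N).
have nle t : (n t)%:R <= mu t * N by rewrite truncn_le // mulr_ge0 ?fd_ge0 ?(ltW N0).
have nge t : mu t * N <= (n t)%:R + 1.
  by rewrite natr1; apply/ltW/truncnS_gt.
pose s := flatten [seq nseq (n t) t | t <- enum T].
have szs (E : pred T) : count E s = \sum_(t | E t) n t.
  rewrite count_flatten -map_comp sumnE big_map big_enum [RHS]big_mkcond.
  by apply: eq_bigr => t _ /=; rewrite count_nseq; case: (E t); rewrite ?mul1n ?mul0n.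
have sz : (size s <= 2 ^ m)%N.
  rewrite -(ler_nat R) natrX -(count_predT s) szs natr_sum.
  apply: le_trans (ler_sum _ (fun t _ => nle t)) _.
  by rewrite -mulr_suml fd_sum1 mul1r.
have cT : #|{: m.-tuple bool}| = (2 ^ m)%N by rewrite card_tuple card_bool.
exists m, (fun w => nth t0 s (enum_rank w)) => E.
rewrite /coin_prob.
have cE : (count E s <= #|[pred w : m.-tuple bool | E (nth t0 s (enum_rank w))]|)%N.
  pose g (i : 'I_(size s)) : m.-tuple bool :=
    enum_val (cast_ord (esym cT) (widen_ord sz i)).
  have -> : count E s = #|[set g i | i : 'I_(size s) & E (nth t0 s i)]|.
    rewrite card_imset; last first.
      by move=> i j /enum_val_inj /(congr1 val) /= ij; apply: val_inj.
    rewrite -sum1_card -[in LHS](mkseq_nth t0 s) count_map -sum1_count.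
    rewrite [RHS](eq_bigl (fun i : 'I_(size s) => E (nth t0 s i))); last first.
      by move=> i; rewrite !inE.
    by rewrite -(big_mkord (fun i => E (nth t0 s i)) (fun=> 1%N)) /index_iota subn0.
  apply: subset_leq_card; apply/fintype.subsetP => w /imsetP[i iE ->].
  by rewrite !inE /g enum_valK in iE *.
rewrite natrX ler_pdivlMr // mulrBl.
apply: le_trans (_ : (count E s)%:R <= _); last by rewrite ler_nat.
rewrite szs natr_sum lerBlDr.
have -> : Pr mu E * N = \sum_(t | E t) mu t * N.
  rewrite /Pr /Ex mulr_suml [RHS]big_mkcond; apply: eq_bigr => t _.
  by case: (E t); rewrite ?mulr1 // mulr0 mul0r.
apply: le_trans (ler_sum _ (fun t _ => nge t)) _.
rewrite big_split lerD2l sumr_const.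
apply: le_trans (_ : #|T|%:R <= _); first by rewrite ler_nat max_card.
by rewrite mulrC -ler_pdivrMr.
Qed.

End FiniteDistributions.

(** * Random trees of a cut metric *)

Lemma sum_shift_le (R : realType) (M : nat) (v : nat -> R) : (forall j, 0 <= v j) ->
  \sum_(j < M) v j <= v 0%N + \sum_(j < M) v j.+1.
Proof.
case: M => [|M] v0; first by rewrite !big_ord0 addr0.
rewrite big_ord_recl lerD2l big_ord_recr /= lerDl //.
Qed.

Section CutMetric.
Variables (R : realType) (P K : finType) (phi : K -> P -> bool) (wt : K -> R).
Hypothesis wt_ge0 : forall k, 0 <= wt k.

Definition cutd (x y : P) : R := \sum_(k | phi k x != phi k y) wt k.

Lemma cutd_ge0 x y : 0 <= cutd x y.
Proof. by apply: sumr_ge0. Qed.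

Lemma cutdxx x : cutd x x = 0.
Proof. by rewrite /cutd big_pred0 // => k; rewrite eqxx. Qed.

Lemma cutdC x y : cutd x y = cutd y x.
Proof. by apply: eq_bigl => k; rewrite eq_sym. Qed.

Lemma cutd_triangle x y z : cutd x z <= cutd x y + cutd y z.
Proof.
rewrite /cutd big_mkcond [X in _ <= X + _]big_mkcond [X in _ <= _ + X]big_mkcond.
rewrite -big_split; apply: ler_sum => k _ /=; have := wt_ge0 k.
by case: (phi k x); case: (phi k y); case: (phi k z) => /=; lra.
Qed.

Variables (L : nat) (r0 : R).
Hypothesis r0_gt0 : 0 < r0.

Definition radius (j : nat) : R := r0 / 2 ^+ j.

Lemma radius_gt0 j : 0 < radius j.
Proof. by rewrite divr_gt0 // exprn_gt0. Qed.

Lemma radiusS j : radius j = 2 * radius j.+1.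
Proof. by rewrite /radius exprS; field; rewrite expf_neq0. Qed.

(** With this form the chance that no cut separating two points is kept multiplies out to exactly
    [expR (- (D / r_j))], however unequal the weights are. *)
Definition keep_prob (j : nat) (k : K) : R := 1 - expR (- (wt k / radius j)).

Lemma keep_prob01 j k : 0 <= keep_prob j k <= 1.
Proof.
rewrite /keep_prob subr_ge0 -{1}expR0 ler_expR oppr_le0 divr_ge0 ?(ltW (radius_gt0 _)) //=.
Qed.

Lemma keep_prob_le j k : keep_prob j k <= wt k / radius j.
Proof. have := expR_ge1Dx (- (wt k / radius j)); rewrite /keep_prob; lra. Qed.

Definition keep_dist (jk : 'I_L * K) : fdist R bool := bern (keep_prob01 jk.1 jk.2).

Definition cuts := {ffun 'I_L * K -> bool}.

Definition tree_dist : fdist R cuts := fpow keep_dist.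

(** Only levels strictly below [i] count: depth 0 is the root, containing everything, and the cuts
    of level [j] split depth [j] into depth [j.+1]. *)
Definition sb (i : nat) (x y : P) (w : cuts) :=
  [forall jk : 'I_L * K, (jk.1 < i)%N && w jk ==> (phi jk.2 x == phi jk.2 y)].

Lemma sbP i x y (w : cuts) : reflect
  (forall (j : 'I_L) k, (j < i)%N -> w (j, k) -> phi k x = phi k y) (sb i x y w).
Proof.
apply: (iffP forallP) => [h j k ji wjk|h [j k] /=].
  by have /implyP := h (j, k); rewrite /= ji wjk => /(_ isT)/eqP.
by apply/implyP => /andP[ji wjk]; rewrite (h j).
Qed.

Lemma sb0 x y w : sb 0 x y w.
Proof. by apply/sbP. Qed.

Lemma sbxx i x w : sb i x x w.
Proof. by apply/sbP. Qed.

Lemma sbC i x y w : sb i x y w = sb i y x w.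
Proof. by apply/sbP/sbP => h j k ji wjk; rewrite (h j k). Qed.

Lemma sb_trans i x y z w : sb i x y w -> sb i y z w -> sb i x z w.
Proof. by move=> /sbP h1 /sbP h2; apply/sbP => j k ji wjk; rewrite (h1 j k) ?(h2 j k). Qed.

Lemma sb_le i i' x y w : (i <= i')%N -> sb i' x y w -> sb i x y w.
Proof. by move=> ii' /sbP h; apply/sbP => j k ji; apply: h; apply: leq_trans ii'. Qed.

Definition level_sb (j : 'I_L) x y (w : cuts) :=
  [forall k, w (j, k) ==> (phi k x == phi k y)].

Lemma sbS (j : 'I_L) x y w : sb j.+1 x y w = sb j x y w && level_sb j x y w.
Proof.
apply/sbP/andP => [h|[/sbP h /forallP h'] i k].
  split; first by apply/sbP => i k ij; apply: h; apply: ltnW.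
  by apply/forallP => k; apply/implyP => wk; rewrite (h j k).
rewrite ltnS leq_eqVlt => /predU1P[/val_inj-> wk|]; last exact: h.
by have := h' k; rewrite wk => /eqP.
Qed.

Lemma Ex_level_sb (j : 'I_L) x y :
  Ex tree_dist (fun w => (level_sb j x y w)%:R) = expR (- (cutd x y / radius j)).
Proof.
pose h (jk : 'I_L * K) (b : bool) : R :=
  if (jk.1 == j) && (phi jk.2 x != phi jk.2 y) then (~~ b)%:R else 1.
transitivity (Ex tree_dist (fun w => \prod_jk h jk (w jk))).
  apply: eq_Ex => w; case: (boolP (level_sb j x y w)) => [/forallP hw|].
    rewrite big1 // => -[i k] _; rewrite /h /=; case: eqP => //= ->.
    by case: eqP => //= xy; have := hw k; case: (w (j, k)) => // /eqP.
  rewrite negb_forall => /existsP[k]; rewrite negb_imply => /andP[wk xy].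
  by rewrite (bigD1 (j, k)) //= {1}/h /= eqxx xy wk mul0r.
rewrite /tree_dist Ex_fpow_prod.
transitivity (\prod_(jk : 'I_L * K) if (jk.1 == j) && (phi jk.2 x != phi jk.2 y)
   then expR (- (wt jk.2 / radius jk.1)) else 1).
  apply: eq_bigr => jk _; rewrite Ex_bern /h; case: ifP => _; rewrite /keep_prob /=; ring.
rewrite -big_mkcond /= /cutd mulr_suml -sumrN.
rewrite -(pair_big (pred1 j) (fun k => phi k x != phi k y)
  (fun i k => expR (- (wt k / radius i)))) /= big_pred1_eq.
by rewrite -expR_sum.
Qed.

Lemma Pr_sb_le (i : nat) x y : (0 < i <= L)%N ->
  Pr tree_dist (sb i x y) <= expR (- (cutd x y / radius i.-1)).
Proof.
case: i => // j /= jL; rewrite -(Ex_level_sb (Ordinal jL)); apply: ler_Pr => w.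
by rewrite (sbS (Ordinal jL)) => /andP[].
Qed.

Definition offlevel (j : 'I_L) : pred ('I_L * K) := fun jk => jk.1 != j.

Lemma sb_mix (j : 'I_L) x y w w' : sb j x y (mixf (offlevel j) w w') = sb j x y w.
Proof.
by apply/sbP/sbP => h i k ij; have := h i k ij; rewrite !ffunE /offlevel /= neq_ltn ij.
Qed.

Lemma level_sb_mix (j : 'I_L) x y w w' :
  level_sb j x y (mixf (offlevel j) w w') = level_sb j x y w'.
Proof. by apply: eq_forallb => k; rewrite ffunE /offlevel /= eqxx. Qed.

Definition sep i x y w := ~~ sb i x y w.

(** * Entropy bound for the mean distance to one's bucket *)

Section Bucket.
Implicit Types (c : P -> R) (a b : P).

Definition mass c i a w : R := \sum_z c z * (sb i a z w)%:R.
Definition avgd c i a w : R := (\sum_z c z * (sb i a z w)%:R * cutd a z) / mass c i a w.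

Variables (c : P -> R) (a : P).
Hypotheses (c_ge0 : forall z, 0 <= c z) (ca : 1 <= c a).

Lemma mass_ge1 i w : 1 <= mass c i a w.
Proof.
rewrite /mass (bigD1 a) //= sbxx mulr1 -[leLHS]addr0 lerD //.
by apply: sumr_ge0 => z _; rewrite mulr_ge0.
Qed.

Lemma mass_gt0 i w : 0 < mass c i a w.
Proof. exact: lt_le_trans (mass_ge1 i w). Qed.

Lemma mass0 w : mass c 0 a w = \sum_z c z.
Proof. by apply: eq_bigr => z _; rewrite sb0 mulr1. Qed.

Lemma mass_le i j w : (i <= j)%N -> mass c j a w <= mass c i a w.
Proof.
move=> ij; apply: ler_sum => z _; rewrite ler_wpM2l // ler_nat.
by case h : (sb j a z w); rewrite // (sb_le ij h).
Qed.

Lemma avgd_ge0 i w : 0 <= avgd c i a w.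
Proof.
rewrite divr_ge0 ?(ltW (mass_gt0 _ _)) //; apply: sumr_ge0 => z _.
by rewrite !mulr_ge0 ?cutd_ge0.
Qed.

Let X (j : 'I_L) w : R :=
  (\sum_z c z * (sb j.+1 a z w)%:R * (expR (cutd a z / radius j / 2) - 1)) / mass c j a w.

Let X_ge0 j w : 0 <= X j w.
Proof.
rewrite divr_ge0 ?(ltW (mass_gt0 _ _)) //; apply: sumr_ge0 => z _.
rewrite !mulr_ge0 // subr_ge0 -expR0 ler_expR.
by rewrite !mulr_ge0 ?invr_ge0 ?cutd_ge0 ?(ltW (radius_gt0 _)).
Qed.

(* Jensen: exp (m / 2) is at most the bucket average of exp (t / 2). *)
Let avgd_le (j : 'I_L) w : avgd c j.+1 a w / radius j <=
  2 * (ln (mass c j a w) - ln (mass c j.+1 a w) + X j w).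
Proof.
set N := mass c j a w; set N' := mass c j.+1 a w; set m := avgd c j.+1 a w / radius j.
have N0 : 0 < N := mass_gt0 _ _; have N'0 : 0 < N' := mass_gt0 _ _.
have N'N : N' <= N by apply: mass_le.
have Xj := X_ge0 j w; set x := X j w in Xj *.
have J : expR (m / 2) * N' <= N' + N * x.
  have -> : N' + N * x = \sum_z c z * (sb j.+1 a z w)%:R * expR (cutd a z / radius j / 2).
    rewrite /x /X mulrC divfK ?gt_eqF // /N' /mass -big_split /=.
    by apply: eq_bigr => z _; ring.
  have -> : expR (m / 2) * N' = \sum_z c z * (sb j.+1 a z w)%:R *
      (expR (m / 2) * (1 + (cutd a z / radius j / 2 - m / 2))).
    transitivity (expR (m / 2) * (N' * (1 - m / 2) +
        (\sum_z c z * (sb j.+1 a z w)%:R * cutd a z) / radius j / 2)).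
      have -> : \sum_z c z * (sb j.+1 a z w)%:R * cutd a z = N' * (m * radius j).
        by rewrite /m /avgd -/N' divfK ?gt_eqF ?radius_gt0 // mulrC divfK ?gt_eqF.
      by field; rewrite gt_eqF ?radius_gt0.
    rewrite /N' /mass !mulr_suml -big_split mulr_sumr /=.
    by apply: eq_bigr => z _; ring.
  apply: ler_sum => z _; rewrite ler_wpM2l ?mulr_ge0 //.
  set t := cutd a z / radius j / 2.
  have := expR_ge1Dx (t - m / 2) ; rewrite expRB ler_pdivlMr ?expR_gt0 //; nra.
have J2 : m / 2 <= ln (N * (1 + x) / N').
  rewrite -ler_expR lnK; last by rewrite posrE divr_gt0 // mulr_gt0 //; lra.
  by rewrite ler_pdivlMr //; nra.
move: J2; rewrite ln_div ?lnM ?posrE ?mulr_gt0 //; try lra.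
have : ln (1 + x) <= x by apply: le_ln1Dx; lra.
lra.
Qed.

(** Freeze all levels but [j], hence the parent bucket. A point at distance [t * r_j] stays with
    probability [exp (- t)], so its indicator times [exp (t / 2)] has mean [exp (- t / 2) <= 1].
    Halving the exponent is what lets the mass lost pay for the gain [X]. *)
Let Ex_X (j : 'I_L) :
  Ex tree_dist (X j) <= Ex tree_dist (fun w => 1 - mass c j.+1 a w / mass c j a w).
Proof.
rewrite -subr_ge0 -ExB /tree_dist (Ex_resample _ (offlevel j)).
apply: Ex_ge0 => w.
have massE w' : mass c j a (mixf (offlevel j) w w') = mass c j a w.
  by apply: eq_bigr => z _; rewrite sb_mix.
set N := mass c j a w; have N0 : 0 < N := mass_gt0 _ _.
pose e z := expR (cutd a z / radius j / 2).
have e1 z : 1 <= e z.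
  rewrite -expR0 ler_expR.
  by rewrite !mulr_ge0 ?invr_ge0 ?cutd_ge0 ?(ltW (radius_gt0 _)).
have -> : Ex (fpow keep_dist) (fun w' =>
     1 - mass c j.+1 a (mixf (offlevel j) w w') / mass c j a (mixf (offlevel j) w w')
     - X j (mixf (offlevel j) w w'))
  = Ex (fpow keep_dist) (fun w' => N^-1 * \sum_z c z * (sb j a z w)%:R *
      (1 - (level_sb j a z w')%:R * e z)).
  apply: eq_Ex => w'; rewrite /X massE -/N.
  transitivity (N^-1 * (N - mass c j.+1 a (mixf (offlevel j) w w') -
    \sum_z c z * (sb j.+1 a z (mixf (offlevel j) w w'))%:R * (e z - 1))).
    by field; rewrite gt_eqF.
  congr (_ * _); rewrite {1}/N /mass -!sumrB.
  apply: eq_bigr => z _; rewrite sbS sb_mix level_sb_mix.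
  by case: (sb j a z w); case: (level_sb j a z w'); rewrite /=; ring.
rewrite ExZl Ex_sum mulr_ge0 ?invr_ge0 ?(ltW N0) //.
apply: sumr_ge0 => z _; rewrite ExZl mulr_ge0 ?mulr_ge0 //.
rewrite ExB Ex_cst ExZr (Ex_level_sb j) subr_ge0.
have -> : expR (- (cutd a z / radius j)) = (e z * e z)^-1.
  by rewrite /e -expRD -expRN; congr expR; field; rewrite gt_eqF ?radius_gt0.
by rewrite invfM -mulrA mulVf ?mulr1 ?invf_le1 ?gt_eqF ?(lt_le_trans _ (e1 z)).
Qed.

(** The fraction of mass lost is at most the drop of [ln mass], by [ln y <= y - 1]. Both terms of
    the Jensen bound are thus at most one expected drop, whence 4 = 2 + 2. *)
Lemma avgd_telescope (j : 'I_L) : Ex tree_dist (avgd c j.+1 a) / radius j <=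
  4 * (Ex tree_dist (fun w => ln (mass c j a w)) -
       Ex tree_dist (fun w => ln (mass c j.+1 a w))).
Proof.
rewrite -ExB; set D := Ex _ (fun w => _ - _).
have XD : Ex tree_dist (X j) <= D.
  apply: le_trans (Ex_X j) _; apply: ler_Ex => w.
  have N0 := mass_gt0 j w; have N'0 := mass_gt0 j.+1 w.
  have : ln (mass c j.+1 a w / mass c j a w) <= mass c j.+1 a w / mass c j a w - 1.
    rewrite -[X in ln X](subrK 1) addrC; apply: le_ln1Dx.
    by rewrite ltrBrDr addrC subrr divr_gt0.
  by rewrite ln_div ?posrE //; lra.
rewrite -ExZr.
apply: le_trans (_ : Ex tree_dist (fun w =>
    2 * (ln (mass c j a w) - ln (mass c j.+1 a w) + X j w)) <= _).
  by apply: ler_Ex => w; apply: avgd_le.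
rewrite ExZl ExD -/D; lra.
Qed.

Lemma sum_avgd : \sum_(j < L) Ex tree_dist (avgd c j.+1 a) / radius j <=
  4 * ln (\sum_z c z).
Proof.
apply: le_trans (ler_sum _ (fun j _ => avgd_telescope j)) _.
rewrite -mulr_sumr ler_pM2l //.
pose f j := - Ex tree_dist (fun w => ln (mass c j a w)).
rewrite (eq_bigr (fun j : 'I_L => f j.+1 - f j)); last by move=> j _; rewrite /f; ring.
rewrite -(big_mkord predT (fun j => f j.+1 - f j)) telescope_sumr // /f opprK.
rewrite (eq_Ex _ (fun w => congr1 (@ln R) (mass0 w))) Ex_cst addrC gerDl oppr_le0.
by apply: Ex_ge0 => w; rewrite ln_ge0 // mass_ge1.
Qed.

End Bucket.

Lemma sum_inv_radius j : \sum_(i < j.+1) (radius i)^-1 <= 2 / radius j.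
Proof.
elim: j => [|j IH].
  by rewrite big_ord1 ler_peMl ?invr_ge0 ?(ltW (radius_gt0 _)) // ler1n.
rewrite big_ord_recr /=; apply: le_trans (lerD IH (lexx _)) _.
rewrite (radiusS j) le_eqVlt; apply/orP; left; apply/eqP.
by field; rewrite gt_eqF ?radius_gt0.
Qed.

(** * Expected tree cost of one matched pair *)

Definition same_side (k : K) (a : P) (c : P -> R) (z : P) := c z * (phi k z == phi k a)%:R.

Lemma sep_le i a b w : (i <= L)%N ->
  (sep i a b w)%:R <= \sum_(jk : 'I_L * K | (jk.1 < i)%N && (phi jk.2 a != phi jk.2 b))
     (w jk)%:R :> R.
Proof.
move=> iL; case: (boolP (sep i a b w)) => [|_]; last by apply: sumr_ge0.
rewrite /sep negb_forall => /existsP[jk]; rewrite negb_imply => /andP[/andP[ji wjk] d].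
by rewrite (bigD1 jk) ?ji //= wjk lerDl; apply: sumr_ge0.
Qed.

Lemma Ex_keep (jk : 'I_L * K) :
  Ex tree_dist (fun w => (w jk)%:R) <= wt jk.2 / radius jk.1.
Proof.
rewrite (Ex_fpow_proj _ _ (fun b : bool => b%:R)) Ex_bern mulr1 mulr0 addr0.
exact: keep_prob_le.
Qed.

Section Pair.
Variables (c : P -> R) (a b : P).
Hypotheses (c_ge0 : forall z, 0 <= c z) (ca : 1 <= c a).

Let cs k : P -> R := same_side k a c.

Let cs_ge0 k z : 0 <= cs k z.
Proof. by rewrite mulr_ge0. Qed.

Let csa k : 1 <= cs k a.
Proof. by rewrite /cs /same_side eqxx mulr1. Qed.

(** A kept cut confines the bucket of [a] to its own side, so restricting the mass to that side
    changes nothing. *)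
Lemma avgd_same_side i (jk : 'I_L * K) (w : cuts) : (jk.1 < i)%N -> w jk ->
  avgd c i a w = avgd (cs jk.2) i a w.
Proof.
case: jk => j k /= ji wjk.
have E z : c z * (sb i a z w)%:R = cs k z * (sb i a z w)%:R.
  rewrite /cs /same_side; case: (boolP (sb i a z w)) => [/sbP h|]; last by rewrite !mulr0.
  by rewrite -(h j k) // eqxx !mulr1.
by rewrite /avgd /mass; congr (_ / _); apply: eq_bigr => z _; rewrite E.
Qed.

(** The cut [jk.2] separates from [a] no point of the restricted mass, so its coin cannot influence
    the restricted average. *)
Lemma avgd_same_side_indep i (jk : 'I_L * K) :
  depends_on (predC (pred1 jk)) (avgd (cs jk.2) i a).
Proof.
move=> w w' ww'.
have E z : cs jk.2 z * (sb i a z w)%:R = cs jk.2 z * (sb i a z w')%:R.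
  rewrite /cs /same_side; case: eqP => [za|]; last by rewrite mulr0 !mul0r.
  congr (_ * _%:R); congr nat_of_bool; apply: eq_forallb => jk' .
  case: (eqVneq jk' jk) => [->|ne]; last by rewrite ww' //= ne.
  by rewrite za eqxx !implybT.
by rewrite /avgd /mass; congr (_ / _); apply: eq_bigr => z _; rewrite E.
Qed.

Let G k j := Ex tree_dist (avgd (cs k) j a).

Let G_ge0 k j : 0 <= G k j.
Proof. by apply: Ex_ge0 => w; apply: avgd_ge0. Qed.

(* A cut that separates a and b is resampled freely once the mass is restricted
   to its side of the cut. *)
Lemma Ex_sep_avgd (j : 'I_L) :
  Ex tree_dist (fun w => (sep j.+1 a b w)%:R * avgd c j.+1 a w) <=
  \sum_(k | phi k a != phi k b) 2 * wt k * (G k j.+1 / radius j).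
Proof.
apply: le_trans (_ : Ex tree_dist (fun w =>
  \sum_(jk : 'I_L * K | (jk.1 < j.+1)%N && (phi jk.2 a != phi jk.2 b))
     (w jk)%:R * avgd (cs jk.2) j.+1 a w) <= _).
  apply: ler_Ex => w.
  apply: le_trans (ler_wpM2r (avgd_ge0 c_ge0 ca _ _) (sep_le a b w (ltn_ord j))) _.
  rewrite mulr_suml; apply: ler_sum => jk /andP[ji _].
  by case wjk : (w jk); rewrite ?mul0r // !mul1r (avgd_same_side ji).
rewrite Ex_sum.
apply: le_trans (_ : \sum_(jk : 'I_L * K | (jk.1 < j.+1)%N && (phi jk.2 a != phi jk.2 b))
   wt jk.2 / radius jk.1 * G jk.2 j.+1 <= _).
  apply: ler_sum => jk _.
  rewrite (@Ex_indep _ _ _ keep_dist (pred1 jk) (fun w => (w jk)%:R)); first last.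
  - exact: avgd_same_side_indep.
  - by move=> w w' ->; rewrite //= eqxx.
  by apply: ler_wpM2r; [apply: G_ge0|apply: Ex_keep].
rewrite -(pair_big (fun i : 'I_L => (i < j.+1)%N) (fun k => phi k a != phi k b)
  (fun i k => wt k / radius i * G k j.+1)) /= exchange_big /=.
apply: ler_sum => k _; rewrite -mulr_suml -mulr_sumr -!mulrA [G _ _ / _]mulrC.
have -> : 2 * (wt k * ((radius j)^-1 * G k j.+1)) = wt k * (2 / radius j * G k j.+1) by ring.
rewrite ler_wpM2l // ler_wpM2r //; apply: le_trans (sum_inv_radius j).
by rewrite (big_ord_widen_cond L predT (fun i => (radius i)^-1)).
Qed.

(** For each cut [k] separating [a] from [b] the entropy bound is applied to the masses [cs k],
    whose total does not exceed that of [c]; summing with the weights [wt k] restores [cutd a b]. *)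
Lemma sum_sep_avgd :
  \sum_(j < L) Ex tree_dist (fun w => (sep j.+1 a b w)%:R * avgd c j.+1 a w) <=
  8 * ln (\sum_z c z) * cutd a b.
Proof.
apply: le_trans (ler_sum _ (fun j _ => Ex_sep_avgd j)) _.
rewrite exchange_big /= /cutd mulr_sumr; apply: ler_sum => k _.
rewrite -mulr_sumr [leRHS]mulrC.
have -> : 2 * wt k * \sum_(i < L) G k i.+1 / radius i =
  wt k * (2 * \sum_(i < L) G k i.+1 / radius i) by ring.
rewrite ler_wpM2l //.
have := sum_avgd (cs_ge0 k) (csa k).
have : ln (\sum_z cs k z) <= ln (\sum_z c z).
  rewrite ler_ln ?posrE.
  - apply: ler_sum => z _; rewrite /cs /same_side ler_piMr //.
    by rewrite lern1 leq_b1.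
  - rewrite (bigD1 a) //=; apply: lt_le_trans ltr01 _.
    by apply: le_trans (csa k) _; rewrite lerDl; apply: sumr_ge0.
  - rewrite (bigD1 a) //=; apply: lt_le_trans ltr01 _.
    by apply: le_trans ca _; rewrite lerDl; apply: sumr_ge0.
rewrite /G; lra.
Qed.

Hypothesis r0_diam : forall x y, cutd x y <= r0.

Lemma avgd0_le w : avgd c 0 a w <= radius 0.
Proof.
rewrite /avgd ler_pdivrMr ?(mass_gt0 c_ge0 ca) // /mass mulr_sumr.
apply: ler_sum => z _; rewrite [leRHS]mulrC ler_wpM2l ?mulr_ge0 //.
by rewrite /radius expr0 divr1.
Qed.

Lemma sum_avgd_parent :
  \sum_(j < L) Ex tree_dist (avgd c j a) / radius j <= 1 + 8 * ln (\sum_z c z).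
Proof.
have lnc0 : 0 <= ln (\sum_z c z).
  rewrite ln_ge0 // (bigD1 a) //=; apply: le_trans ca _.
  by rewrite lerDl; apply: sumr_ge0.
have v0 i : 0 <= Ex tree_dist (avgd c i a) by apply: Ex_ge0 => w; apply: avgd_ge0.
have v00 : Ex tree_dist (avgd c 0 a) / radius 0 <= 1.
  by rewrite ler_pdivrMr ?radius_gt0 // mul1r; apply: Ex_le => w; apply: avgd0_le.
have := sum_avgd c_ge0 ca.
have := sum_shift_le L (v := fun j => Ex tree_dist (avgd c j a) / radius j).
have -> : \sum_(j < L) Ex tree_dist (avgd c j.+1 a) / radius j.+1 =
    2 * \sum_(j < L) Ex tree_dist (avgd c j.+1 a) / radius j.
  rewrite mulr_sumr; apply: eq_bigr => j _; rewrite (radiusS j).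
  by field; rewrite gt_eqF ?radius_gt0.
have v1 j : 0 <= Ex tree_dist (avgd c j a) / radius j by rewrite divr_ge0 ?(ltW (radius_gt0 _)).
move=> /(_ v1); lra.
Qed.

(** [sum_sep_avgd] covers the child averages. For the parent average, either [a] and [b] were
    separated already at depth [j], which is the same sum shifted by one, or a cut of level [j]
    separates them; that level is independent of the depth-[j] bucket, so [sum_avgd_parent] applies.
    Each of the three sums contributes 8 to the 24. *)
Lemma tree_cost_pair :
  Ex tree_dist (fun w => \sum_(j < L) (sep j.+1 a b w)%:R *
      (avgd c j a w + avgd c j.+1 a w)) <=
  (24 * ln (\sum_z c z) + 1) * cutd a b.
Proof.
rewrite Ex_sum.
pose s j := Ex tree_dist (fun w => (sep j a b w)%:R * avgd c j a w).
have s0 j : 0 <= s j by apply: Ex_ge0 => w; rewrite mulr_ge0 ?avgd_ge0.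
have E (j : 'I_L) : Ex tree_dist (fun w => (sep j.+1 a b w)%:R *
      (avgd c j a w + avgd c j.+1 a w)) <=
    s j + cutd a b * (Ex tree_dist (avgd c j a) / radius j) + s j.+1.
  under eq_Ex do rewrite mulrDr.
  rewrite ExD lerD2r.
  apply: le_trans (_ : Ex tree_dist (fun w => (sep j a b w)%:R * avgd c j a w +
    \sum_(k | phi k a != phi k b) (w (j, k))%:R * avgd c j a w) <= _).
    apply: ler_Ex => w; rewrite -mulr_suml -mulrDl ler_wpM2r ?avgd_ge0 //.
    rewrite {1}/sep sbS negb_and; case: (boolP (sb j a b w)) => sbj /=; last first.
      by rewrite /sep sbj lerDl; apply: sumr_ge0.
    case: (boolP (level_sb j a b w)) => [_|]; rewrite /= ?addr_ge0 ?sumr_ge0 //.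
    rewrite negb_forall => /existsP[k]; rewrite negb_imply => /andP[wk ab].
    by rewrite (bigD1 k) //= wk addrCA lerDl addr_ge0 ?sumr_ge0.
  rewrite ExD lerD2l Ex_sum /cutd mulr_suml; apply: ler_sum => k _.
  rewrite (@Ex_indep _ _ _ keep_dist (pred1 (j, k)) (fun w => (w (j, k))%:R)); first last.
  - move=> w w' ww'; rewrite /avgd /mass.
    have E z : sb j a z w = sb j a z w'.
      apply: eq_forallb => jk; case: ltnP => //= jkj; rewrite ww' //=.
      by apply: contraTneq jkj => ->; rewrite ltnn.
    by congr (_ / _); apply: eq_bigr => z _; rewrite E.
  - by move=> w w' ->; rewrite //= eqxx.
  have -> : wt k * (Ex tree_dist (avgd c j a) / radius j) =
    wt k / radius j * Ex tree_dist (avgd c j a) by ring.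
  apply: ler_wpM2r; last exact: (Ex_keep (j, k)).
  by apply: Ex_ge0 => w; apply: avgd_ge0.
apply: le_trans (ler_sum _ (fun j _ => E j)) _.
rewrite !big_split /= -mulr_sumr.
have sum1 : \sum_(j < L) s j.+1 <= 8 * ln (\sum_z c z) * cutd a b := sum_sep_avgd.
have sum2 : \sum_(j < L) s j <= \sum_(j < L) s j.+1.
  have := sum_shift_le L s0; suff -> : s 0 = 0 by rewrite add0r.
  by rewrite /s (eq_Ex _ (Y := fun=> 0)) ?Ex_cst // => w; rewrite /sep sb0 mul0r.
have := ler_wpM2l (cutd_ge0 a b) sum_avgd_parent.
move: sum1 sum2; set S := \sum_(j < L) s j.+1; lra.
Qed.

(** This is the price of an additive error of order [r_j] on every edge: at most [2 * cutd a b] per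
    level. The factor [L] is affordable because the samplers make that error smaller by a factor
    [L]. *)
Lemma sum_radius_sep :
  Ex tree_dist (fun w => \sum_(j < L) radius j * (sep j.+1 a b w)%:R) <=
  2 * L%:R * cutd a b.
Proof.
have -> : 2 * L%:R * cutd a b = \sum_(j < L) 2 * cutd a b.
  by rewrite sumr_const card_ord -mulr_natl; ring.
rewrite Ex_sum.
apply: ler_sum => j _; rewrite ExZl.
apply: le_trans (_ : radius j * (2 / radius j * cutd a b) <= _); last first.
  by rewrite le_eqVlt; apply/orP; left; apply/eqP; field; rewrite gt_eqF ?radius_gt0.
rewrite ler_wpM2l ?(ltW (radius_gt0 _)) //.
apply: le_trans (ler_Ex _ (fun w => sep_le a b w (ltn_ord j))) _.
rewrite Ex_sum; apply: le_trans (ler_sum _ (fun jk _ => Ex_keep jk)) _.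
rewrite -(pair_big (fun i : 'I_L => (i < j.+1)%N) (fun k => phi k a != phi k b)
  (fun i k => wt k / radius i)) /= exchange_big /= /cutd mulr_sumr.
apply: ler_sum => k _; rewrite -mulr_sumr mulrC ler_wpM2r //.
apply: le_trans (sum_inv_radius j).
by rewrite (big_ord_widen_cond L predT (fun i => (radius i)^-1)).
Qed.

End Pair.
End CutMetric.

(** * Matchings and tree costs *)

Section LabelledTree.
Variables (R : realType) (P V : finType) (D : P -> P -> R) (c : P -> R).
Hypotheses (D_ge0 : forall x y, 0 <= D x y) (Dxx : forall x, D x x = 0)
  (DC : forall x y, D x y = D y x) (D_tri : forall x y z, D x z <= D x y + D y z).
Hypothesis c_ge0 : forall x, 0 <= c x.
Variables (L : nat) (id : nat -> P -> V).

(* A tree edge is named by the level-j.+1 bucket and its level-j parent. *)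
Definition lab (j : nat) (x : P) : V * V := (id j.+1 x, id j x).

Definition inw j (v : V * V) x : R := c x * (lab j x == v)%:R.
Definition outw j (v : V * V) x : R := c x * ((id j x == v.2) && (lab j x != v))%:R.
Definition inN j v : R := \sum_x inw j v x.
Definition outN j v : R := \sum_x outw j v x.

(** The denominator involves the whole parent: this is the average of [D] between [v] and the rest
    of its parent, times the fraction of the parent lying outside [v]. With that factor it bounds
    the change of the average of a 1-Lipschitz function from the parent to [v]. *)
Definition edge_weight j v : R :=
  (\sum_x \sum_y inw j v x * outw j v y * D x y) / (inN j v * (inN j v + outN j v)).

Lemma inw_ge0 j v x : 0 <= inw j v x. Proof. by rewrite mulr_ge0. Qed.
Lemma outw_ge0 j v x : 0 <= outw j v x. Proof. by rewrite mulr_ge0. Qed.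
Lemma inN_ge0 j v : 0 <= inN j v. Proof. by apply: sumr_ge0 => x _; apply: inw_ge0. Qed.
Lemma outN_ge0 j v : 0 <= outN j v. Proof. by apply: sumr_ge0 => x _; apply: outw_ge0. Qed.

Lemma edge_weight_ge0 j v : 0 <= edge_weight j v.
Proof.
rewrite divr_ge0 ?mulr_ge0 ?addr_ge0 ?inN_ge0 ?outN_ge0 //.
by apply: sumr_ge0 => x _; apply: sumr_ge0 => y _; rewrite !mulr_ge0 ?inw_ge0 ?outw_ge0.
Qed.

Definition imbalance j (A B : seq P) v : R :=
  (count (fun x => lab j x == v) A)%:R - (count (fun x => lab j x == v) B)%:R.

Definition tree_cost (g : nat -> V * V -> R) (A B : seq P) : R :=
  \sum_(j < L) \sum_v `|imbalance j A B v| * g j v.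

Lemma sum_label (h : V * V -> R) u : \sum_v (u == v)%:R * h v = h u.
Proof.
rewrite (bigD1 u) //= eqxx mul1r big1 ?addr0 // => v; rewrite eq_sym => /negPf->.
by rewrite mul0r.
Qed.

Lemma tree_cost_le_matching (g : nat -> V * V -> R) (A B : seq P) (M : seq (P * P)) :
  (forall j v, 0 <= g j v) -> perm_eq (unzip1 M) A -> perm_eq (unzip2 M) B ->
  tree_cost g A B <= \sum_(ab <- M) \sum_(j < L)
    (lab j ab.1 != lab j ab.2)%:R * (g j (lab j ab.1) + g j (lab j ab.2)).
Proof.
move=> g0 MA MB; rewrite exchange_big; apply: ler_sum => j _ /=.
apply: le_trans (_ : \sum_v \sum_(ab <- M) (lab j ab.1 != lab j ab.2)%:R *
    ((lab j ab.1 == v)%:R * g j v + (lab j ab.2 == v)%:R * g j v) <= _).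
  apply: ler_sum => v _.
  have -> : imbalance j A B v =
      \sum_(ab <- M) ((lab j ab.1 == v)%:R - (lab j ab.2 == v)%:R).
    rewrite /imbalance -(permP MA) -(permP MB) !count_map -!sum1_count !natr_sum.
    by rewrite big_mkcond [X in _ - X]big_mkcond -sumrB; apply: eq_bigr => ab _ /=;
      do 2 case: (_ == v).
  apply: le_trans (ler_wpM2r (g0 j v) (ler_norm_sum _ _ _)) _.
  rewrite mulr_suml; apply: ler_sum => ab _.
  rewrite -mulrDl mulrA ler_wpM2r //.
  case: (eqVneq (lab j ab.1) (lab j ab.2)) => [->|ne]; first by rewrite subrr normr0 mul0r.
  rewrite mul1r; apply: le_trans (ler_normB _ _) _.
  by rewrite !normr_nat.
rewrite exchange_big; apply: ler_sum => ab _ /=.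
by rewrite -mulr_sumr big_split /= !sum_label.
Qed.

(** Names will be hashes, so nesting and separation can be asked only on the support of [c]. *)
Variable S : pred P.
Hypotheses (cS : forall x, S x -> 0 < c x) (cNS : forall x, ~~ S x -> c x = 0).
Hypotheses (id0 : forall x y, S x -> S y -> id 0 x = id 0 y)
  (id_nest : forall j x y, (j < L)%N -> S x -> S y -> id j.+1 x = id j.+1 y -> id j x = id j y)
  (idL : forall x y, S x -> S y -> id L x = id L y -> x = y).

Definition clsw i a x : R := c x * (id i x == id i a)%:R.
Definition cls_avg i a (h : P -> R) : R := (\sum_x clsw i a x * h x) / \sum_x clsw i a x.

Lemma clsw_child j a x : (j < L)%N -> S a -> clsw j.+1 a x = inw j (lab j a) x.
Proof.
move=> jL Sa; rewrite /clsw /inw; case: (boolP (S x)) => Sx; last by rewrite cNS // !mul0r.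
rewrite /lab xpair_eqE; case: eqP => //= e.
by rewrite (id_nest jL Sx Sa e) eqxx.
Qed.

Lemma clsw_parent j a x : (j < L)%N -> S a ->
  clsw j a x = inw j (lab j a) x + outw j (lab j a) x.
Proof.
move=> jL Sa; rewrite /clsw /inw /outw -mulrDr; congr (_ * _).
rewrite /lab !xpair_eqE /=; case: (id j x == id j a); case: (id j.+1 x == id j.+1 a) => /=;
  by rewrite ?addr0 ?add0r.
Qed.

Lemma inN_gt0 j a : S a -> 0 < inN j (lab j a).
Proof.
move=> Sa; rewrite /inN (bigD1 a) //= ltr_pwDl //.
  by rewrite /inw eqxx mulr1 cS.
by apply: sumr_ge0 => x _; apply: inw_ge0.
Qed.

Lemma cls_avg_step j a (h : P -> R) : (j < L)%N -> S a ->
  (forall x y, h x - h y <= D x y) ->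
  `|cls_avg j.+1 a h - cls_avg j a h| <= edge_weight j (lab j a).
Proof.
move=> jL Sa hlip; set v := lab j a.
have N0 : 0 < inN j v := inN_gt0 _ Sa; have M0 := outN_ge0 j v.
set N := inN j v in N0 *; set M := outN j v in M0 *.
have -> : cls_avg j.+1 a h - cls_avg j a h =
    (\sum_x \sum_y inw j v x * outw j v y * (h x - h y)) / (N * (N + M)).
  rewrite /cls_avg (eq_bigr _ (fun x _ => congr1 (fun t => t * h x) (clsw_child x jL Sa))).
  rewrite (eq_bigr _ (fun x _ => clsw_child x jL Sa)).
  rewrite [in X in _ - X](eq_bigr _ (fun x _ => congr1 (fun t => t * h x) (clsw_parent x jL Sa))).
  rewrite [in X in _ - X](eq_bigr _ (fun x _ => clsw_parent x jL Sa)).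
  rewrite big_split /= -/v -/(inN j v) -/(outN j v) -/N -/M.
  have -> : \sum_x \sum_y inw j v x * outw j v y * (h x - h y) =
      (\sum_x inw j v x * h x) * M - N * (\sum_x outw j v x * h x).
    transitivity (\sum_x (inw j v x * h x * M - inw j v x * \sum_x outw j v x * h x)).
      apply: eq_bigr => x _; rewrite /M /outN !mulr_sumr -sumrB.
      by apply: eq_bigr => y _; ring.
    by rewrite sumrB -!mulr_suml.
  under [in X in _ - X]eq_bigr do rewrite mulrDl.
  by rewrite big_split /=; field; rewrite !gt_eqF //; lra.
rewrite normrM normfV (@ger0_norm _ (N * _)) ?mulr_ge0 ?(ltW N0) //; last by lra.
rewrite /edge_weight ler_wpM2r ?invr_ge0 ?mulr_ge0 ?(ltW N0) //; first by lra.
apply: le_trans (ler_norm_sum _ _ _) _; apply: ler_sum => x _.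
apply: le_trans (ler_norm_sum _ _ _) _; apply: ler_sum => y _.
rewrite normrM ger0_norm ?mulr_ge0 ?inw_ge0 ?outw_ge0 //.
rewrite ler_wpM2l ?mulr_ge0 ?inw_ge0 ?outw_ge0 // ler_norml hlip andbT.
by rewrite lerNl opprB DC.
Qed.

Lemma cls_avgL a h : S a -> cls_avg L a h = h a.
Proof.
move=> Sa.
have E x : x != a -> clsw L a x = 0.
  move=> xa; rewrite /clsw; case: (boolP (S x)) => [Sx|Sx]; last by rewrite cNS // mul0r.
  by case: eqP => [/(idL Sx Sa) /eqP|]; [rewrite (negPf xa)|rewrite mulr0].
rewrite /cls_avg (bigD1 a) //= big1 ?addr0 => [|x xa]; last by rewrite E ?mul0r.
rewrite (bigD1 a) //= big1 ?addr0 => [|x xa]; last by rewrite E.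
by rewrite mulrAC divff ?mul1r // /clsw eqxx mulr1 gt_eqF ?cS.
Qed.

(* Kantorovich duality with the potential D(., b), averaged over the buckets on
   the tree paths from a and from b to their common bucket. *)
Lemma path_dominates i a b : (i <= L)%N -> S a -> S b -> id i a = id i b ->
  D a b <= \sum_(i <= j < L) (edge_weight j (lab j a) + edge_weight j (lab j b)).
Proof.
move=> iL Sa Sb ab; pose h x := D x b.
have hlip x y : h x - h y <= D x y by rewrite /h lerBlDr.
have tel u : cls_avg L u h - cls_avg i u h = \sum_(i <= j < L) (cls_avg j.+1 u h - cls_avg j u h).
  by rewrite telescope_sumr.
have -> : D a b = (cls_avg L a h - cls_avg i a h) - (cls_avg L b h - cls_avg i b h).
  rewrite !cls_avgL // /h Dxx sub0r opprK.
  have -> : cls_avg i a (D^~ b) = cls_avg i b (D^~ b) by rewrite /cls_avg /clsw ab.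
  by rewrite subrK.
rewrite !tel -sumrB big_nat [leRHS]big_nat; apply: ler_sum => j /andP[_ jL].
apply: lerD.
  exact: le_trans (ler_norm _) (cls_avg_step jL Sa hlip).
by apply: le_trans (cls_avg_step jL Sb hlip); rewrite -normrN ler_norm.
Qed.

Lemma imbalance_rem j (A B : seq P) a b v : a \in A -> b \in B ->
  imbalance j A B v =
  imbalance j (rem a A) (rem b B) v + (lab j a == v)%:R - (lab j b == v)%:R.
Proof.
move=> aA bB; rewrite /imbalance (permP (perm_to_rem aA)) (permP (perm_to_rem bB)) /=.
by rewrite !natrD; ring.
Qed.

(* Remove a pair (a, b) whose common bucket is as fine as possible: below that
   bucket no point of B shares a's bucket and no point of A shares b's, so every
   imbalance on the two paths drops by exactly one. *)
Lemma tree_cost_ge_matching (A B : seq P) : size A = size B ->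
  (forall x, x \in A -> S x) -> (forall x, x \in B -> S x) ->
  exists M : seq (P * P), [/\ perm_eq (unzip1 M) A, perm_eq (unzip2 M) B &
    \sum_(ab <- M) D ab.1 ab.2 <= tree_cost edge_weight A B].
Proof.
have [n] := ubnP (size A); elim: n A B => // n IH A B sA sAB SA SB.
case: A sA sAB SA => [|a0 A0] sA sAB SA.
  case: B sAB SB => // _ _; exists [::]; split => //; rewrite big_nil.
  apply: sumr_ge0 => j _; apply: sumr_ge0 => v _.
  by rewrite mulr_ge0 ?edge_weight_ge0.
case: B sAB SB => [|b0 B0] // sAB SB.
move: {A0}(a0 :: A0) (mem_head a0 A0) (b0 :: B0) (mem_head b0 B0) sA sAB SA SB
  => A a0A B b0B sA sAB SA SB.
pose Q i := (i <= L)%N && has (fun a => has (fun b => id i a == id i b) B) A.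
have Q0 : exists i, Q i.
  exists 0; apply/hasP; exists a0 => //; apply/hasP; exists b0 => //.
  by apply/eqP/id0; [apply: SA|apply: SB].
have QL i : Q i -> (i <= L)%N by case/andP.
case: (ex_maxnP Q0 QL) => i /andP[iL /hasP[a aA /hasP[b bB /eqP ab]]] imax.
have Sa := SA _ aA; have Sb := SB _ bB.
have szA : (size (rem a A) < n)%N by rewrite size_rem //; case: (A) aA sA.
have szAB : size (rem a A) = size (rem b B) by rewrite !size_rem // sAB.
have [x|x|M [MA MB MD]] := IH (rem a A) (rem b B) szA szAB.
- by move/mem_rem; apply: SA.
- by move/mem_rem; apply: SB.
exists ((a, b) :: M); split.
- by rewrite perm_sym (perm_trans (perm_to_rem aA)) // perm_cons perm_sym.
- by rewrite perm_sym (perm_trans (perm_to_rem bB)) // perm_cons perm_sym.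
rewrite big_cons /=.
apply: le_trans (lerD (path_dominates iL Sa Sb ab) MD) _.
rewrite big_geq_mkord big_mkcond -big_split; apply: ler_sum => j _ /=.
have jL := ltn_ord j; case: leqP => [ij|ji]; last first.
  rewrite add0r; apply: ler_sum => v _; rewrite (imbalance_rem j v aA bB).
  (* A label of level [j < i] involves depths up to [j.+1 <= i] only, where [a] and [b] still share
     their bucket; removing the pair leaves its imbalance unchanged. *)
  have e k : (k <= i)%N -> id k a = id k b.
    move=> ki; rewrite -(subKn ki); elim: (i - k)%N (leq_subr k i) => [|m IHm] mi.
      by rewrite subn0.
    apply: id_nest => //; last by rewrite subnSK //; apply: IHm; apply: ltnW.
    by rewrite (leq_trans _ iL) // ltn_subrL (leq_trans _ ji).
  by rewrite /lab (e j.+1) ?(e j) ?(ltnW ji) // addrK.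
rewrite -(sum_label (edge_weight j)) -[X in _ + X + _](sum_label (edge_weight j)).
rewrite -!big_split; apply: ler_sum => v _ /=.
rewrite -!mulrDl ler_wpM2r ?edge_weight_ge0 // (imbalance_rem j v aA bB).
have sepL x y : x \in A -> y \in B -> lab j x != lab j y.
  move=> xA yB; apply/negP => /eqP[exy _].
  have : Q j.+1.
    by rewrite /Q jL; apply/hasP; exists x => //; apply/hasP; exists y => //; apply/eqP.
  by move/imax; rewrite ltnNge ij.
have a0' : lab j a = v -> count (fun x => lab j x == v) (rem b B) = 0%N.
  move=> av; apply/eqP; rewrite -leqn0 leqNgt -has_count; apply/hasP => -[y yB /eqP yv].
  by have := sepL _ _ aA (mem_rem yB); rewrite av yv eqxx.
have b0' : lab j b = v -> count (fun x => lab j x == v) (rem a A) = 0%N.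
  move=> bv; apply/eqP; rewrite -leqn0 leqNgt -has_count; apply/hasP => -[y yA /eqP yv].
  by have := sepL _ _ (mem_rem yA) bB; rewrite bv yv eqxx.
rewrite /imbalance; case: eqP => [av|_]; case: eqP => [bv|_]; rewrite ?addr0 ?subr0 ?add0r.
- by have := sepL _ _ aA bB; rewrite av bv eqxx.
- by rewrite (a0' av) subr0 !ger0_norm ?addr_ge0 // addrC.
- by rewrite (b0' bv) !sub0r -opprD !normrN !ger0_norm ?addr_ge0 // addrC.
- by [].
Qed.

End LabelledTree.

(** * Edge weights against mean distances from a fixed point *)

Section EdgeWeightBound.
Variables (R : realType) (P K V : finType) (phi : K -> P -> bool) (wt : K -> R).
Hypothesis wt_ge0 : forall k, 0 <= wt k.
Variables (L : nat) (c : P -> R) (w : cuts K L) (id : nat -> P -> V).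
Hypothesis c_ge0 : forall x, 0 <= c x.
Hypothesis id_sb : forall i x y, (i <= L)%N -> 0 < c x -> 0 < c y ->
  (id i x == id i y) = sb phi i x y w.

(** Route each distance between the child and the rest of its parent through [a]: the first leg
    averages over the child, the second over the parent. *)
Lemma edge_weight_le_avgd j a : (j < L)%N -> 1 <= c a ->
  edge_weight (cutd phi wt) c id j (lab id j a) <=
  avgd phi wt c j a w + avgd phi wt c j.+1 a w.
Proof.
move=> jL ca; set v := lab id j a; have ca0 : 0 < c a by lra.
have p0 x : 0 <= inw c id j v x by apply: inw_ge0.
have q0 x : 0 <= outw c id j v x by apply: outw_ge0.
have pE x : c x * (sb phi j.+1 a x w)%:R = inw c id j v x.
  rewrite /inw; have := c_ge0 x; rewrite le_eqVlt => /predU1P[<-|cx]; first by rewrite !mul0r.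
  rewrite -id_sb // /v /lab xpair_eqE eq_sym; case: eqP => //= /eqP e.
  have -> // : id j x == id j a.
  rewrite id_sb // ?(ltnW jL) //; apply: (@sb_le _ _ phi L j j.+1) => //.
  by rewrite -id_sb.
have pqE x : c x * (sb phi j a x w)%:R = inw c id j v x + outw c id j v x.
  rewrite /inw /outw; have := c_ge0 x; rewrite le_eqVlt => /predU1P[<-|cx].
    by rewrite !mul0r addr0.
  rewrite -id_sb ?(ltnW jL) // -mulrDr /v /lab !xpair_eqE /= eq_sym.
  by case: (id j x == id j a); case: (id j.+1 x == id j.+1 a); rewrite /= ?addr0 ?add0r.
pose D := cutd phi wt.
have D0 x y : 0 <= D x y by apply: cutd_ge0.
have N0 : 0 < inN c id j v.
  rewrite /inN (bigD1 a) //= ltr_pwDl //; first by rewrite /inw eqxx mulr1.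
  exact: sumr_ge0.
have M0 : 0 <= outN c id j v by apply: sumr_ge0.
set N := inN c id j v in N0 *; set M := outN c id j v in M0 *.
have -> : avgd phi wt c j.+1 a w = (\sum_x inw c id j v x * D a x) / N.
  by rewrite /avgd /mass; under eq_bigr do rewrite pE; under [X in _ / X]eq_bigr do rewrite pE.
have -> : avgd phi wt c j a w =
    (\sum_x inw c id j v x * D a x + \sum_x outw c id j v x * D a x) / (N + M).
  rewrite /avgd /mass; under eq_bigr do rewrite pqE mulrDl.
  under [X in _ / X]eq_bigr do rewrite pqE.
  by rewrite !big_split.
rewrite /edge_weight -/N -/M.
set SA := \sum_x inw c id j v x * D a x; set SB := \sum_x outw c id j v x * D a x.
have SA0 : 0 <= SA by apply: sumr_ge0 => x _; rewrite mulr_ge0.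
have SB0 : 0 <= SB by apply: sumr_ge0 => x _; rewrite mulr_ge0.
have le1 : \sum_x \sum_y inw c id j v x * outw c id j v y * D x y <= SA * M + N * SB.
  have Dt x y : D x y <= D a x + D a y by rewrite /D (cutdC _ _ a x) cutd_triangle.
  rewrite -/D; clearbody D; rewrite /SA mulr_suml /N /inN mulr_suml -big_split; apply: ler_sum => x _ /=.
  rewrite /M /outN /SB !mulr_sumr -big_split; apply: ler_sum => y _ /=.
  have -> : inw c id j v x * D a x * outw c id j v y + inw c id j v x * (outw c id j v y * D a y)
    = inw c id j v x * outw c id j v y * (D a x + D a y) by ring.
  by rewrite ler_wpM2l ?mulr_ge0.
apply: le_trans (_ : (SA * M + N * SB) / (N * (N + M)) <= _).
  by rewrite ler_wpM2r // invr_ge0 mulr_ge0 ?(ltW N0) //; lra.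
have -> : (SA * M + N * SB) / (N * (N + M)) = SA / N * (M / (N + M)) + SB / (N + M).
  by field; rewrite !gt_eqF //; lra.
have NM : 0 < N + M by lra.
have h1 : SA / N * (M / (N + M)) <= SA / N.
  rewrite ler_piMr ?divr_ge0 ?(ltW N0) // ler_pdivrMr // mul1r; lra.
have h2 : 0 <= SA / (N + M) by rewrite divr_ge0 ?(ltW NM).
rewrite mulrDl; lra.
Qed.

End EdgeWeightBound.

(** * Sampling a label in proportion to its imbalance *)

Lemma norm_near (R : realType) (x t e : R) :
  `|x - t| <= e -> `|x| <= `|t| + e /\ `|t| <= `|x| + e.
Proof. by move=> h; have := ler_dist_dist x t; rewrite ler_norml => /andP[]; split; lra. Qed.

Section HeavySampler.
Variables (R : realType) (V : finType) (nb : nat) (bit : 'I_nb -> V -> bool).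
Hypothesis bit_inj : forall u v, (forall o, bit o u = bit o v) -> u = v.
Variables (H B : nat).
Hypothesis B_ge : (4 * H.+1 <= B)%N.

Let B_gt0 : 0 < B%:R :> R.
Proof. by rewrite ltr0n; apply: leq_trans B_ge; rewrite muln_gt0. Qed.

Definition scale_val (o : option 'I_H.+1) : nat := if o is Some h then 2 ^ h else 0.

(** A truncated Pareto law: a scale reaches [s] with probability within constants of [1 / (s * B)],
    so label [v] reaches a threshold [T] with probability proportional to [|f v| / T]. Each dyadic
    scale adds [1 / B] to the mean, which [B_ge] keeps at most 1 / 4; scale 0 takes the remaining
    probability. *)
Definition scale_fun (o : option 'I_H.+1) : R :=
  if o is Some h then (2 ^+ h)^-1 / B%:R else 1 - \sum_(h < H.+1) (2 ^+ h)^-1 / B%:R.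

Lemma sum_option (F : option 'I_H.+1 -> R) : \sum_o F o = F None + \sum_h F (Some h).
Proof.
rewrite (bigD1 None) //=; congr (_ + _).
rewrite (reindex_omap Some id) => [|[h|] //]; by apply: eq_bigl => h; rewrite eqxx.
Qed.

Lemma scale_ge0 o : 0 <= scale_fun o.
Proof.
case: o => [h|] /=; first by rewrite divr_ge0 ?invr_ge0 ?exprn_ge0.
rewrite subr_ge0 -mulr_suml ler_pdivrMr // mul1r.
apply: le_trans (_ : \sum_(h < H.+1) 1 <= _).
  by apply: ler_sum => h _; rewrite invf_le1 ?exprn_gt0 // exprn_ege1 ?ler1n.
rewrite sumr_const card_ord ler_nat; apply: leq_trans B_ge.
by rewrite -[leqLHS]mul1n leq_mul2r orbT.
Qed.

Lemma scale_sum1 : \sum_o scale_fun o = 1.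
Proof. by rewrite sum_option /= subrK. Qed.

Definition scale_dist : fdist R (option 'I_H.+1) := Fdist scale_ge0 scale_sum1.

Lemma Ex_scale : Ex scale_dist (fun o => (scale_val o)%:R) = H.+1%:R / B%:R.
Proof.
rewrite /Ex sum_option /= mulr0 add0r.
rewrite (eq_bigr (fun=> B%:R^-1)) => [|h _]; last first.
  by rewrite natrX mulrAC mulVf ?mul1r // expf_neq0.
by rewrite sumr_const card_ord mulr_natl.
Qed.

Lemma Pr_scale_ge (s : R) : 1 <= s <= 2 ^+ H ->
  (2 * s * B%:R)^-1 <= Pr scale_dist (fun o => s <= (scale_val o)%:R).
Proof.
move=> /andP[s1 sH].
have ex : exists h, s <= 2 ^+ h by exists H.
case: (ex_minnP ex) => h sh hmin.
have hH : (h < H.+1)%N by rewrite ltnS hmin.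
have h2 : 2 ^+ h <= 2 * s.
  case: h sh hmin hH => [|h] sh hmin hH; first by rewrite expr0; lra.
  have : 2 ^+ h < s by rewrite ltNge; apply/negP => /hmin; rewrite ltnn.
  rewrite exprS; lra.
rewrite /Pr /Ex (bigD1 (Some (Ordinal hH))) //= natrX sh mulr1.
rewrite -[leLHS]addr0 lerD //; last first.
  by apply: sumr_ge0 => o _; rewrite mulr_ge0 ?scale_ge0.
rewrite invfM ler_wpM2r ?invr_ge0 ?(ltW B_gt0) // lef_pV2 ?posrE ?exprn_gt0 //; lra.
Qed.

(** The subtracted last term is what lets the induction on [n] close. *)
Lemma sum_inv_pow_tail (s : R) (n : nat) : 0 < s ->
  \sum_(h < n.+1 | s <= 2 ^+ h) (2 ^+ h)^-1 <=
  if s <= 2 ^+ n then 2 / s - (2 ^+ n)^-1 else 0.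
Proof.
move=> s0; elim: n => [|n IH].
  rewrite big_mkcond big_ord1 /= expr0 invr1; case: ifP => // s1.
  have : 1 <= s^-1 by rewrite invf_ge1. lra.
rewrite big_mkcond big_ord_recr -big_mkcond /=.
apply: le_trans (lerD IH (lexx _)) _.
have n0 : 0 < 2 ^+ n :> R by rewrite exprn_gt0.
have -> : (2 ^+ n.+1)^-1 = (2 ^+ n)^-1 / 2 :> R by rewrite exprS invfM mulrC.
have i0 : 0 < (2 ^+ n)^-1 :> R by rewrite invr_gt0.
case: (leP s (2 ^+ n)) => sn.
  have -> : s <= 2 ^+ n.+1 by rewrite exprS; lra.
  lra.
case: ifP => [sn1|_]; last by rewrite addr0.
suff : (2 ^+ n)^-1 <= 2 / s by lra.
by rewrite ler_pdivlMr // ler_pdivrMl // mulrC -exprS.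
Qed.

Lemma Pr_scale_le (s : R) : 0 < s ->
  Pr scale_dist (fun o => s <= (scale_val o)%:R) <= 2 / (s * B%:R).
Proof.
move=> s0; rewrite /Pr /Ex sum_option /=.
rewrite (_ : (s <= 0%:R) = false); last by apply/negbTE; rewrite -ltNge.
rewrite mulr0 add0r.
rewrite invfM mulrA.
have -> : \sum_(h < H.+1) (2 ^+ h)^-1 / B%:R * (s <= (2 ^ h)%:R)%R%:R =
   (\sum_(h < H.+1 | s <= 2 ^+ h) (2 ^+ h)^-1) / B%:R :> R.
  rewrite [in RHS]big_mkcond mulr_suml; apply: eq_bigr => h _.
  by rewrite natrX; case: (s <= _); rewrite ?mulr1 ?mulr0 ?mul0r.
rewrite ler_wpM2r ?invr_ge0 ?(ltW B_gt0) //.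
apply: le_trans (sum_inv_pow_tail H s0) _; case: ifP => _.
  by rewrite gerBl invr_ge0 exprn_ge0.
by rewrite divr_ge0 ?(ltW s0).
Qed.

Definition scales := {ffun V -> option 'I_H.+1}.
Definition scales_dist : fdist R scales := fpow (fun=> scale_dist).

Variable f : V -> int.

Definition counter (w : scales) : int := \sum_v (scale_val (w v))%:Z * f v.
Definition bit_counter (w : scales) (o : 'I_nb) : int :=
  \sum_v (scale_val (w v))%:Z * f v * (bit o v)%:Z.

(** When one label dominates the scaled sum, the counter of a bit is close to the full counter if
    the label has that bit and close to 0 otherwise; half of the full counter separates the two
    cases. *)
Definition decode (c : int) (cb : 'I_nb -> int) : option V :=
  [pick v | [forall o, bit o v == (`|c| <= 2 * `|cb o|)]].

Let z (w : scales) v : R := (scale_val (w v))%:R * `|f v|%:~R.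
Let Z w := \sum_v z w v.
Let dec w := decode (counter w) (bit_counter w).
Let absc w : R := `|counter w|%:~R.

Definition total : R := \sum_v `|f v|%:~R.

Let z_ge0 w v : 0 <= z w v.
Proof. by rewrite mulr_ge0 // ler0z. Qed.

Let Z_others w v : Z w - z w v = \sum_(u | u != v) z w u.
Proof. by rewrite /Z (bigD1 v) //=; ring. Qed.

Let zE w v : z w v = `|(scale_val (w v))%:Z * f v|%:~R.
Proof. by rewrite normrM intrM. Qed.

Let counter_near (w : scales) v (b : pred V) :
  `|(\sum_u (scale_val (w u))%:Z * f u * (b u)%:Z)%:~R -
    ((scale_val (w v))%:Z * f v * (b v)%:Z)%:~R| <= Z w - z w v :> R.
Proof.
rewrite Z_others (bigD1 v) //= intrD addrAC subrr add0r -intr_norm.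
have -> : \sum_(u | u != v) z w u = (\sum_(u | u != v) `|(scale_val (w u))%:Z * f u|)%:~R.
  by rewrite raddf_sum; apply: eq_bigr => u _; rewrite zE.
rewrite ler_int; apply: le_trans (ler_norm_sum _ _ _) _; apply: ler_sum => u _.
by case: (b u); rewrite ?mulr1 ?mulr0 ?normr0.
Qed.

Let decode_heavy (w : scales) v : 4 * (Z w - z w v) < z w v ->
  [/\ dec w = Some v, 3 * z w v <= 4 * absc w & 4 * absc w <= 5 * z w v].
Proof.
move=> dom; set e := Z w - z w v in dom.
have := counter_near w v predT; rewrite -/e.
under eq_bigr do rewrite mulr1.
rewrite -/(counter w) mulr1; set t : R := (_ * f v)%:~R; set x : R := (counter w)%:~R => near.
have tz : `|t| = z w v by rewrite zE intr_norm.
have xE : absc w = `|x| by rewrite /absc intr_norm.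
have [x1 x2] := norm_near near.
split; rewrite ?xE; [|lra|lra].
have bitE o : bit o v = (`|counter w| <= 2 * `|bit_counter w o|).
  rewrite -(ler_int R) intrM !intr_norm -/x.
  have := counter_near w v (bit o); rewrite -/e -/(bit_counter w o).
  set y : R := (bit_counter w o)%:~R.
  case: (bit o v); rewrite ?mulr1 ?mulr0 -?/t => h; apply/esym.
    by apply/idP; have [_ y2] := norm_near h; lra.
  apply/negbTE; rewrite -ltNge; rewrite subr0 in h.
  have : z w v > 0 by have := normr_ge0 y; lra.
  lra.
rewrite /dec /decode; case: pickP => [u /forallP hu|/(_ v)/negbT]; last first.
  by rewrite negb_forall => /existsP[ o]; rewrite bitE eqxx.
by congr Some; apply: bit_inj => o; rewrite (eqP (hu o)) bitE.
Qed.

Variable T : R.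
Hypothesis T_gt0 : 0 < T.

Definition hit (w : scales) : R := (T <= `|counter w|%:~R)%R%:R.

Lemma hit01 w : 0 <= hit w <= 1.
Proof. by rewrite /hit ler0n lern1 leq_b1. Qed.

Definition score (y : V -> R) (w : scales) : R :=
  hit w * (if decode (counter w) (bit_counter w) is Some v then y v else 0).

Let Ex_z v : Ex scales_dist (fun w => z w v) = H.+1%:R / B%:R * `|f v|%:~R.
Proof.
by rewrite ExZr (Ex_fpow_proj (fun=> scale_dist) v (fun o => (scale_val o)%:R)) Ex_scale.
Qed.

Let Ex_Z : Ex scales_dist Z = H.+1%:R / B%:R * total.
Proof.
rewrite /total mulr_sumr /Z Ex_sum.
by apply: eq_bigr => v _; rewrite Ex_z.
Qed.

Let Pr_z v (s : R) : f v != 0 ->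
  Pr scales_dist (fun w => s <= z w v) =
  Pr scale_dist (fun o => s / `|f v|%:~R <= (scale_val o)%:R).
Proof.
move=> fv; rewrite -[RHS](Ex_fpow_proj (fun=> scale_dist) v
  (fun o => ((s / `|f v|%:~R <= (scale_val o)%:R)%R%:R))).
by apply: eq_Ex => w; rewrite /z ler_pdivrMr // ltr0z normr_gt0.
Qed.

Lemma Pr_hit_le : Ex scales_dist hit <= H.+1%:R * total / (B%:R * T).
Proof.
apply: le_trans (_ : Pr scales_dist (fun w => T <= Z w) <= _).
  apply: ler_Ex => w; rewrite /hit ler_nat.
  case h : (T <= _) => //; rewrite (le_trans h) //.
  have -> : Z w = (\sum_v `|(scale_val (w v))%:Z * f v|)%:~R.
    by rewrite raddf_sum; apply: eq_bigr => v _; rewrite zE.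
  by rewrite ler_int; apply: ler_norm_sum.
apply: le_trans (markov_fin _ _ T_gt0) _; first by move=> w; apply: sumr_ge0.
rewrite Ex_Z le_eqVlt; apply/orP; left; apply/eqP.
by field; rewrite !gt_eqF.
Qed.

Variable y : V -> R.
Hypothesis y01 : forall v, 0 <= y v <= 1.

(** Count only the events that [v] alone reaches [2 * T] while all other labels together stay below
    [T / 2]. They exclude each other, since each forces the decoded label, and their two halves are
    independent: the first has probability at least [|f v| / (4 * T * B)], the second at least 1 / 2
    by Markov, the mean of [Z] being at most [T / 4]. *)
Lemma score_ge : total <= T -> 2 * T <= 2 ^+ H ->
  (\sum_v `|f v|%:~R * y v) / (8 * T * B%:R) <= Ex scales_dist (score y).
Proof.
move=> totT TH.
pose E v w := (2 * T <= z w v) && (\sum_(u | u != v) z w u < T / 2).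
have Edec v w : E v w -> dec w = Some v /\ T <= absc w.
  move=> /andP[e1 e2]; rewrite -Z_others in e2.
  by have [|h1 h2 h3] := @decode_heavy w v; [lra|split => //; lra].
apply: le_trans (_ : Ex scales_dist (fun w => \sum_v y v * (E v w)%:R) <= _); last first.
  apply: ler_Ex => w; case: (pickP (E^~ w)) => [v Ev|E0]; last first.
    rewrite big1 => [|v _]; last by rewrite E0 mulr0.
    by rewrite mulr_ge0 //; case: (decode _ _) => // v; case/andP: (y01 v).
  have [dv Tv] := Edec _ _ Ev.
  rewrite (bigD1 v) //= big1 => [|u uv]; last first.
    case Eu : (E u w); last by rewrite mulr0.
    by have [] := Edec _ _ Eu; rewrite dv => -[vu]; rewrite vu eqxx in uv.
  by rewrite Ev mulr1 addr0 /score /hit -/(absc w) Tv mul1r -/(dec w) dv.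
rewrite Ex_sum mulr_suml; apply: ler_sum => v _; rewrite ExZl.
have [y0 _] := andP (y01 v).
have [->|fv] := eqVneq (f v) 0; first by rewrite normr0 !mul0r mulr_ge0 ?Pr_ge0.
have f1 : 1 <= `|f v|%:~R :> R by rewrite ler1z -gtz0_ge1 normr_gt0.
have fT : `|f v|%:~R <= T.
  apply: le_trans totT; rewrite /total (bigD1 v) //= lerDl.
  by apply: sumr_ge0 => u _; rewrite ler0z.
rewrite mulrAC mulrC ler_wpM2l //.
pose rest w : R := (\sum_(u | u != v) z w u < T / 2)%R%:R.
rewrite (_ : Ex _ _ = Pr scales_dist (fun w => 2 * T <= z w v) * Ex scales_dist rest); last first.
  rewrite -(@Ex_indep _ _ _ (fun=> scale_dist) (pred1 v)).
  - by apply: eq_Ex => w; rewrite -natrM mulnb.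
  - by move=> w w' ww'; rewrite /z ww' //= eqxx.
  - move=> w w' ww'; rewrite /rest; congr (_ < _)%R%:R; apply: eq_bigr => u uv.
    by rewrite /z ww'.
rewrite Pr_z //.
have restP : 1 / 2 <= Ex scales_dist rest.
  rewrite -[Ex _ _]/(Pr scales_dist (fun w => \sum_(u | u != v) z w u < T / 2)) PrC.
  suff : Pr scales_dist (fun w => T / 2 <= Z w) <= 1 / 2.
    have : Pr scales_dist (fun w => ~~ (\sum_(u | u != v) z w u < T / 2)) <=
        Pr scales_dist (fun w => T / 2 <= Z w).
      apply: ler_Pr => w; rewrite -leNgt => /le_trans; apply.
      by rewrite -Z_others lerBlDr lerDl.
    lra.
  apply: le_trans (markov_fin _ _ _) _; [by move=> w; apply: sumr_ge0|lra|].
  rewrite Ex_Z ler_pdivrMr; last lra.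
  have : H.+1%:R / B%:R <= 1 / 4 :> R.
    rewrite ler_pdivrMr // mulrC mulrA mulr1 ler_pdivlMr // mulrC.
    by rewrite -natrM ler_nat.
  have : 0 <= H.+1%:R / B%:R :> R by rewrite divr_ge0.
  have : 0 <= total by apply: sumr_ge0 => u _; rewrite ler0z.
  nra.
set s := 2 * T / `|f v|%:~R.
have sP : (2 * s * B%:R)^-1 <= Pr scale_dist (fun o => s <= (scale_val o)%:R).
  apply: Pr_scale_ge; rewrite /s ler_pdivlMr ?ler_pdivrMr; [|lra|lra].
  apply/andP; split; first lra.
  apply: le_trans TH _; rewrite ler_peMr // exprn_ge0 //.
have -> : `|f v|%:~R / (8 * T * B%:R) = (2 * s * B%:R)^-1 * (1 / 2).
  rewrite /s; field; rewrite !gt_eqF //; lra.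
apply: ler_pM => //.
by rewrite /s invr_ge0 !mulr_ge0 ?invr_ge0 ?(ltW T_gt0) //; lra.
Qed.

(* When the counter is large but no single label dominates it, the pairwise
   products of distinct contributions already have total at least T ^ 2 / 5. *)
Lemma score_le :
  Ex scales_dist (score y) <= 4 * (\sum_v `|f v|%:~R * y v) / (T * B%:R) +
    5 * (H.+1%:R * total / (B%:R * T)) ^+ 2.
Proof.
pose J w := \sum_v \sum_(u | u != v) z w v * z w u.
have J0 w : 0 <= J w.
  by apply: sumr_ge0 => v _; apply: sumr_ge0 => u _; rewrite mulr_ge0.
apply: le_trans (_ : Ex scales_dist (fun w => \sum_v y v * (T / 2 <= z w v)%R%:R +
   (T ^+ 2 / 5 <= J w)%R%:R) <= _).
  apply: ler_Ex => w; rewrite /score /hit -/(absc w) -/(dec w).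
  have S0 : 0 <= \sum_v y v * (T / 2 <= z w v)%R%:R.
    by apply: sumr_ge0 => v _; rewrite mulr_ge0 //; case/andP: (y01 v).
  case: (leP T (absc w)) => hT; last by rewrite mul0r addr_ge0.
  rewrite mul1r.
  case: (pickP (fun v => 4 * (Z w - z w v) < z w v)) => [v dom|nodom].
    have [-> h1 h2] := decode_heavy dom.
    rewrite (bigD1 v) //= (_ : T / 2 <= z w v); last lra.
    rewrite mulr1 -addrA lerDl addr_ge0 //.
    by apply: sumr_ge0 => u _; rewrite mulr_ge0 //; case/andP: (y01 u).
  have ZT : T <= Z w.
    apply: le_trans hT _.
    have -> : Z w = (\sum_v `|(scale_val (w v))%:Z * f v|)%:~R.
      by rewrite raddf_sum; apply: eq_bigr => v _; rewrite zE.
    by rewrite ler_int; apply: ler_norm_sum.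
  (* Without domination [z w v <= 4 * (Z w - z w v)] for every [v], so the labels other than [v]
     carry at least a fifth of [Z w]. *)
  have JZ : Z w ^+ 2 / 5 <= J w.
    have -> : J w = \sum_v z w v * (Z w - z w v).
      by apply: eq_bigr => v _; rewrite Z_others mulr_sumr.
    have -> : Z w ^+ 2 / 5 = \sum_v z w v * (Z w / 5).
      by rewrite -mulr_suml -/(Z w); ring.
    apply: ler_sum => v _; rewrite ler_wpM2l //.
    have := nodom v => /negbT; rewrite -leNgt; lra.
  have -> : T ^+ 2 / 5 <= J w.
    apply: le_trans JZ; rewrite ler_wpM2r // lerXn2r ?nnegrE ?(ltW T_gt0) //.
    exact: le_trans (ltW T_gt0) ZT.
  apply: le_trans (_ : 1 <= _); last by rewrite lerDr.
  by case: (dec w) => // v; case/andP: (y01 v).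
rewrite ExD Ex_sum lerD //.
  rewrite mulr_sumr mulr_suml; apply: ler_sum => v _; rewrite ExZl.
  have [y0 _] := andP (y01 v).
  have [fv|fv] := eqVneq (f v) 0.
    rewrite (eq_Ex _ (Y := fun=> 0)) => [|w].
      by rewrite Ex_cst fv normr0 !(mul0r, mulr0).
    have T2 : 0 < T / 2 by rewrite divr_gt0.
    by rewrite /z fv normr0 mulr0z mulr0; move: T2; rewrite ltNge => /negbTE ->.
  rewrite -[Ex _ _]/(Pr scales_dist (fun w => T / 2 <= z w v)) Pr_z //.
  have f0 : 0 < `|f v|%:~R :> R by rewrite ltr0z normr_gt0.
  apply: le_trans (ler_wpM2l y0 (Pr_scale_le _)) _; first by rewrite !divr_gt0.
  rewrite le_eqVlt; apply/orP; left; apply/eqP; field; rewrite !gt_eqF //.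
have T5 : 0 < T ^+ 2 / 5 by rewrite divr_gt0 ?exprn_gt0.
apply: le_trans (markov_fin _ J0 T5) _.
have -> : Ex scales_dist J = \sum_v \sum_(u | u != v)
    (H.+1%:R / B%:R * `|f v|%:~R) * (H.+1%:R / B%:R * `|f u|%:~R).
  rewrite Ex_sum; apply: eq_bigr => v _; rewrite Ex_sum; apply: eq_bigr => u uv.
  rewrite -Ex_z -(Ex_z u) -(@Ex_indep _ _ _ (fun=> scale_dist) (pred1 v)) //.
  - by move=> w w' ww'; rewrite /z ww' //= eqxx.
  - by move=> w w' ww'; rewrite /z ww'.
apply: le_trans (_ : (H.+1%:R / B%:R * total) ^+ 2 / (T ^+ 2 / 5) <= _); last first.
  rewrite le_eqVlt; apply/orP; left; apply/eqP; field; rewrite !gt_eqF //.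
rewrite ler_wpM2r ?invr_ge0 ?(ltW T5) //; set h : R := H.+1%:R / B%:R.
have h0 : 0 <= h by rewrite divr_ge0 ?(ltW B_gt0).
have -> : (h * total) ^+ 2 = \sum_v h * `|f v|%:~R * (h * total).
  by rewrite -mulr_suml -mulr_sumr expr2.
apply: ler_sum => v _; rewrite -mulr_sumr ler_wpM2l ?mulr_ge0 ?ler0z //.
by rewrite -mulr_sumr ler_wpM2l // /total [leRHS](bigD1 v) //= lerDr ler0z.
Qed.

End HeavySampler.

(** * Choice of the threshold at one level *)

Section LevelEstimate.
Variables (R : realType) (H B K : nat).

(* The threshold 2 ^ k is the largest one that is still hit with frequency at
   least 1 / (32 B); it lies between the total imbalance and O(H) times it. *)
Definition level_estimate (ph eh : 'I_K.+1 -> R) (dl : R) : R :=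
  match [pick k0 | (32 * B%:R)^-1 <= ph k0] with
  | Some k0 =>
      let k := [arg max_(k > k0 | ((32 * B%:R)^-1 <= ph k)%R) (k : nat)]%N in
      8 * 2 ^+ k * B%:R * (eh k + dl)
  | None => 0
  end.

(** The least power of two above [S] is hit with probability at least [1 / (16 * B)] and passes the
    test despite the error [dl]; conversely passing forces [p k >= 1 / (64 * B)], so the chosen
    threshold [T] satisfies [S <= T <= 64 * H.+1 * S]. The first inequality turns the quadratic term
    of [score_le] into the first part of the additive error, the second bounds the contribution of
    [dl], which is added to [eh] so that the estimate errs upwards. *)
Lemma level_estimateP (ph eh p e : 'I_K.+1 -> R) (dl S G : R) :
  (0 < B)%N ->
  (forall k, `|ph k - p k| <= dl) -> (forall k, `|eh k - e k| <= dl) ->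
  1 <= S <= 2 ^+ K -> 0 <= G <= S ->
  (forall k : 'I_K.+1, S <= 2 ^+ k -> S / (8 * 2 ^+ k * B%:R) <= p k) ->
  (forall k : 'I_K.+1, p k <= H.+1%:R * S / (B%:R * 2 ^+ k)) ->
  (forall k : 'I_K.+1, S <= 2 ^+ k -> G / (8 * 2 ^+ k * B%:R) <= e k) ->
  (forall k : 'I_K.+1, e k <= 4 * G / (2 ^+ k * B%:R) +
     5 * (H.+1%:R * S / (B%:R * 2 ^+ k)) ^+ 2) ->
  0 <= dl <= (64 * B%:R)^-1 ->
  G <= level_estimate ph eh dl <=
    32 * G + (40 * H.+1%:R ^+ 2 / B%:R + 1024 * H.+1%:R * B%:R * dl) * S.
Proof.
move=> B0n php ehe /andP[S1 SK] /andP[G0 GS] plo phi_ elo ehi /andP[dl0 dlB].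
have B0 : 0 < B%:R :> R by rewrite ltr0n.
have H1 : 1 <= H.+1%:R :> R by rewrite ler1n.
have ex : exists k, S <= 2 ^+ k by exists K.
case: (ex_minnP ex) => kn skn knmin.
have knK : (kn < K.+1)%N by rewrite ltnS knmin.
have kn2 : 2 ^+ kn <= 2 * S.
  case: kn skn knmin knK => [|h] sh hmin hH; first by rewrite expr0; lra.
  have : 2 ^+ h < S by rewrite ltNge; apply/negP => /hmin; rewrite ltnn.
  rewrite exprS; lra.
pose k0 := Ordinal knK.
have t0 : 0 < 2 ^+ kn :> R by rewrite exprn_gt0.
have i32 : (32 * B%:R)^-1 = 2 * (64 * B%:R)^-1 :> R by field; rewrite gt_eqF.
have hk0 : (32 * B%:R)^-1 <= ph k0.
  have h1 : (16 * B%:R)^-1 <= p k0.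
    apply: le_trans (plo k0 skn) => /=.
    rewrite ler_pdivlMr; last by rewrite !mulr_gt0.
    rewrite mulrC ler_pdivrMr; last by rewrite mulr_gt0.
    nra.
  have i16 : (16 * B%:R)^-1 = 4 * (64 * B%:R)^-1 :> R by field; rewrite gt_eqF.
  have [_ h2] := norm_near (php k0); have := php k0; rewrite ler_norml => /andP[h3 h4].
  have : 0 < (64 * B%:R)^-1 :> R by rewrite invr_gt0 mulr_gt0.
  lra.
rewrite /level_estimate; case: pickP => [k1 hk1|/(_ k0)]; last by rewrite hk0.
case: arg_maxnP => // k hk kmax; have kkn := kmax _ hk0.
have ST : S <= 2 ^+ k by apply: le_trans skn _; rewrite ler_weXn2l ?ler1n.
set T : R := 2 ^+ k in ST *; have T0 : 0 < T by rewrite exprn_gt0.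
have pk : (64 * B%:R)^-1 <= p k.
  have := php k; rewrite ler_norml => /andP[h3 h4]; lra.
have TS : T <= 64 * H.+1%:R * S.
  have := le_trans pk (phi_ k); rewrite -/T.
  rewrite ler_pdivlMr ?mulr_gt0 // mulrC ler_pdivrMr ?mulr_gt0 //.
  have -> : H.+1%:R * S * (64 * B%:R) = B%:R * (64 * H.+1%:R * S) by ring.
  by rewrite ler_pM2l.
have := ehe k; rewrite ler_norml => /andP[e1 e2].
have c0 : 0 < 8 * T * B%:R by rewrite !mulr_gt0.
apply/andP; split.
  have := elo k ST; rewrite -/T ler_pdivrMr // mulrC => h.
  apply: le_trans h _; rewrite ler_wpM2l ?(ltW c0) //; lra.
apply: le_trans (_ : 8 * T * B%:R * (e k + 2 * dl) <= _).
  rewrite ler_wpM2l ?(ltW c0) //; lra.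
apply: le_trans (_ : 8 * T * B%:R * (4 * G / (T * B%:R) +
     5 * (H.+1%:R * S / (B%:R * T)) ^+ 2 + 2 * dl) <= _).
  by rewrite ler_wpM2l ?(ltW c0) // lerD2r ehi.
have -> : 8 * T * B%:R * (4 * G / (T * B%:R) +
     5 * (H.+1%:R * S / (B%:R * T)) ^+ 2 + 2 * dl) =
   32 * G + (40 * H.+1%:R ^+ 2 / B%:R) * S * (S / T) + 16 * B%:R * dl * T.
  by field; rewrite !gt_eqF.
have h1 : 40 * H.+1%:R ^+ 2 / B%:R * S * (S / T) <= 40 * H.+1%:R ^+ 2 / B%:R * S.
  rewrite ler_piMr ?ler_pdivrMr ?mul1r // !mulr_ge0 ?invr_ge0 ?exprn_ge0 //; lra.
have h2 : 16 * B%:R * dl * T <= 1024 * H.+1%:R * B%:R * dl * S.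
  have -> : 1024 * H.+1%:R * B%:R * dl * S = 16 * B%:R * dl * (64 * H.+1%:R * S) by ring.
  by rewrite ler_wpM2l // !mulr_ge0.
rewrite mulrDl; lra.
Qed.

Lemma level_estimate0 (ph eh : 'I_K.+1 -> R) (dl : R) : (0 < B)%N ->
  (forall k, ph k = 0) -> level_estimate ph eh dl = 0.
Proof.
move=> B0 ph0; rewrite /level_estimate; case: pickP => // k; rewrite ph0 leNgt.
by rewrite invr_gt0 mulr_gt0 ?ltr0n.
Qed.

End LevelEstimate.

(** * Cut embedding of lp grids *)

Section RademacherMoments.
Variables (R : realType) (d : nat).

Lemma half01 : 0 <= (2^-1 : R) <= 1.
Proof. by apply/andP; split; lra. Qed.

Definition sign_dist : fdist R {ffun 'I_d -> bool} := fpow (fun=> bern half01).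

Definition sgnb (b : bool) : R := if b then 1 else -1.

Lemma sgnb2 b : sgnb b * sgnb b = 1.
Proof. by case: b; rewrite /sgnb; ring. Qed.

Lemma Ex_sgnb i : Ex sign_dist (fun s => sgnb (s i)) = 0.
Proof. by rewrite (Ex_fpow_proj _ i sgnb) Ex_bern /sgnb; lra. Qed.

Let X (c : 'I_d -> R) (r : seq 'I_d) (s : {ffun 'I_d -> bool}) : R :=
  \sum_(i <- r) c i * sgnb (s i).

Let Ex_odd c r i k : i \notin r -> Ex sign_dist (fun s => sgnb (s i) * X c r s ^+ k) = 0.
Proof.
move=> ir; rewrite (@Ex_indep _ _ _ _ (pred1 i)) ?Ex_sgnb ?mul0r //.
  by move=> s s' ->; rewrite //= eqxx.
move=> s s' ss'; congr (_ ^+ _); rewrite /X !big_seq; apply: eq_bigr => j jr.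
by rewrite ss' //=; apply: contraTneq jr => ->.
Qed.

Let moments c r : uniq r ->
  Ex sign_dist (fun s => X c r s ^+ 2) = \sum_(i <- r) c i ^+ 2 /\
  Ex sign_dist (fun s => X c r s ^+ 4) <= 3 * (\sum_(i <- r) c i ^+ 2) ^+ 2.
Proof.
elim: r => [_|i r IH /= /andP[ir ur]].
  split; first by rewrite big_nil (eq_Ex _ (Y := fun=> 0)) ?Ex_cst // => s; rewrite /X big_nil; ring.
  by rewrite big_nil (eq_Ex _ (Y := fun=> 0)) ?Ex_cst => [|s]; rewrite ?/X ?big_nil; lra.
have [E2 E4] := IH ur; have O1 := Ex_odd c 1 ir; have O3 := Ex_odd c 3 ir.
split.
  rewrite (eq_Ex _ (Y := fun s : {ffun 'I_d -> bool} => (c i ^+ 2 + 2 * c i * (sgnb (s i) * X c r s ^+ 1)) + X c r s ^+ 2)).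
    by rewrite !ExD Ex_cst ExZl O1 E2 big_cons; ring.
  by move=> s; rewrite {1}/X big_cons -/(X c r s); have := sgnb2 (s i); nra.
rewrite (eq_Ex _ (Y := fun s : {ffun 'I_d -> bool} => (c i ^+ 4 + 4 * c i ^+ 3 * (sgnb (s i) * X c r s ^+ 1)) +
   (6 * c i ^+ 2 * X c r s ^+ 2 + 4 * c i * (sgnb (s i) * X c r s ^+ 3)) + X c r s ^+ 4)).
  rewrite !ExD Ex_cst !ExZl O1 O3 E2 big_cons; nra.
move=> s; rewrite {1}/X big_cons -/(X c r s); case: (s i); rewrite /sgnb; ring.
Qed.

(** The lower bound integrates [|t| >= t ^ 2 / l - t ^ 4 / (4 * l ^ 3)], using that the fourth
    moment is at most 3 times the squared variance; [l = 3 / 2 * q] is the optimal choice and gives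
    4 / 9. The upper bound integrates [|t| <= t ^ 2 / (2 * q) + q / 2]. *)
Lemma khintchine (c : 'I_d -> R) :
  4 / 9 * Num.sqrt (\sum_i c i ^+ 2) <=
    Ex sign_dist (fun s => `|\sum_i c i * sgnb (s i)|) <=
  Num.sqrt (\sum_i c i ^+ 2).
Proof.
have [E2 E4] := moments c (index_enum_uniq 'I_d).
set sg := \sum_(i <- _) _ in E2 E4 *; rewrite -/(X c _ _).
have sg0 : 0 <= sg by apply: sumr_ge0 => i _; apply: sqr_ge0.
set q := Num.sqrt sg; have q2 : q ^+ 2 = sg by rewrite sqr_sqrtr.
have q0 : 0 <= q by apply: sqrtr_ge0.
have -> : Ex sign_dist (fun s => `|\sum_i c i * sgnb (s i)|) =
  Ex sign_dist (fun s => `|X c (index_enum 'I_d) s|) by [].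
set Z := X c (index_enum 'I_d) in E2 E4 *.
have := q0; rewrite le_eqVlt => /predU1P[qz|qp].
  have sgz : sg = 0 by rewrite -q2 -qz; ring.
  have EZ0 : Ex sign_dist (fun s => `|Z s|) <= 0.
    apply/ler_addgt0Pr => e e0; rewrite add0r.
    apply: le_trans (_ : Ex sign_dist (fun s => Z s ^+ 2 / e + e) <= _).
      apply: ler_Ex => s; rewrite -(real_normK (num_real (Z s))).
      rewrite -lerBlDr ler_pdivlMr //; set u := `|_|; nra.
    by rewrite ExD ExZr Ex_cst E2 sgz mul0r add0r.
  by rewrite -qz mulr0 EZ0 andbT Ex_ge0.
apply/andP; split.
  apply: le_trans (_ : Ex sign_dist (fun s => Z s ^+ 2 / (3 / 2 * q) -
      Z s ^+ 4 / (4 * (3 / 2 * q) ^+ 3)) <= _); last first.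
    apply: ler_Ex => s; set l := 3 / 2 * q; have l0 : 0 < l by rewrite /l; lra.
    have -> : Z s ^+ 2 = `|Z s| ^+ 2 by rewrite real_normK ?num_real.
    have -> : Z s ^+ 4 = `|Z s| ^+ 4.
      by rewrite (exprM _ 2 2) [RHS](exprM _ 2 2) real_normK ?num_real.
    set u := `|Z s| / l; have u0 : 0 <= u by rewrite divr_ge0 ?(ltW l0).
    have -> : `|Z s| = u * l by rewrite divfK ?gt_eqF.
    have -> : (u * l) ^+ 2 / l - (u * l) ^+ 4 / (4 * l ^+ 3) = (u ^+ 2 - u ^+ 4 / 4) * l.
      by field; rewrite gt_eqF.
    rewrite ler_wpM2r ?(ltW l0) //.
    have : 0 <= 1 - u + u ^+ 3 / 4.
      have := sqr_ge0 (u - 6 / 5); have := sqr_ge0 (u ^+ 2 - 1); nra.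
    nra.
  rewrite ExB !ExZr E2.
  have -> : 4 / 9 * q = sg / (3 / 2 * q) - 3 * sg ^+ 2 / (4 * (3 / 2 * q) ^+ 3).
    by rewrite -q2; field; rewrite gt_eqF.
  rewrite lerB // ler_wpM2r // invr_ge0 mulr_ge0 // exprn_ge0 //; lra.
apply: le_trans (_ : Ex sign_dist (fun s => Z s ^+ 2 / (2 * q) + q / 2) <= _).
  apply: ler_Ex => s; rewrite -(real_normK (num_real (Z s))); set u := `|_|.
  rewrite -subr_ge0.
  have -> : u ^+ 2 / (2 * q) + q / 2 - u = (u - q) ^+ 2 / (2 * q) by field; rewrite gt_eqF.
  by rewrite divr_ge0 ?sqr_ge0 // mulr_ge0.
rewrite ExD ExZr Ex_cst E2 -q2 le_eqVlt; apply/orP; left; apply/eqP.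
by field; rewrite gt_eqF.
Qed.

End RademacherMoments.

(** * The heavy-tailed law of the coordinate scales *)

Section ScaleLaw.
Variables (R : realType) (u : R) (N : nat).
Hypotheses (u2 : 2 <= u) (u4 : u <= 4).

(* u stands for 2 ^ p.  The tails are chosen so that the mean of
   min(1, 4 ^ (kappa - l)) is exactly u ^ - l for l <= N. *)
Definition law_tail (k : nat) : R := if k is k'.+1 then (u ^+ k')^-1 * (4 / u - 1) / 3 else 1.

Definition law_fun (k : 'I_N.+1) : R :=
  law_tail k - (if (k < N)%N then law_tail k.+1 else 0).

Let u_gt0 : 0 < u. Proof. by move: u2; lra. Qed.
Let u_neq0 : u != 0. Proof. by rewrite gt_eqF. Qed.

Let c01 : 0 <= 4 / u - 1 <= 1.
Proof.
apply/andP; split; rewrite ?subr_ge0 ?lerBlDr ?ler_pdivlMr ?ler_pdivrMr //; move: u2 u4; lra.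
Qed.

Lemma law_tail_ge0 k : 0 <= law_tail k.
Proof.
by case: k => //= k; rewrite !mulr_ge0 ?invr_ge0 ?exprn_ge0 ?(ltW u_gt0) //; case/andP: c01.
Qed.

Lemma law_tailS k : law_tail k.+1 <= law_tail k.
Proof.
have [c0 c1] := andP c01; case: k => [|k] /=; first by rewrite expr0 invr1; lra.
do 2 rewrite ler_wpM2r //; rewrite exprSr invfM ler_piMr ?invr_ge0 ?exprn_ge0 ?(ltW u_gt0) //.
by rewrite invf_le1 //; move: u2; lra.
Qed.

Lemma law_ge0 k : 0 <= law_fun k.
Proof. by rewrite /law_fun subr_ge0; case: ifP => _; [apply: law_tailS|apply: law_tail_ge0]. Qed.

Lemma law_abel (h : nat -> R) :
  \sum_(k < N.+1) law_fun k * h k =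
  h 0 + \sum_(k < N) law_tail k.+1 * (h k.+1 - h k).
Proof.
rewrite big_ord_recr /= {2}/law_fun ltnn subr0.
rewrite (eq_bigr (fun k : 'I_N => (law_tail k - law_tail k.+1) * h k)); last first.
  by move=> k _; rewrite /law_fun /= ltn_ord.
elim: (N) => [|n IH]; first by rewrite !big_ord0 /=; ring.
by rewrite !big_ord_recr /=; move: IH; lra.
Qed.

Lemma law_sum1 : \sum_k law_fun k = 1.
Proof.
rewrite -[RHS]addr0; have := law_abel (fun=> 1).
rewrite (eq_bigr law_fun) => [->|k _]; last by rewrite mulr1.
by rewrite [X in 1 + X]big1 // => k _; rewrite subrr mulr0.
Qed.

Definition law : fdist R 'I_N.+1 := Fdist law_ge0 law_sum1.

Let hl (l k : nat) : R := Num.min 1 (4 ^+ k / 4 ^+ l).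

Let hl_le l k : (k <= l)%N -> hl l k = 4 ^+ k / 4 ^+ l.
Proof.
move=> kl; apply/min_idPr; rewrite ler_pdivrMr ?exprn_gt0 // mul1r.
by rewrite ler_weXn2l // ler1n.
Qed.

Let hl_ge l k : (l <= k)%N -> hl l k = 1.
Proof.
move=> kl; apply/min_idPl; rewrite ler_pdivlMr ?exprn_gt0 // mul1r.
by rewrite ler_weXn2l // ler1n.
Qed.

Lemma law_min l : Ex law (fun k => Num.min 1 (4 ^+ k / 4 ^+ l)) =
  (4 / u) ^+ minn l N / 4 ^+ l.
Proof.
rewrite /Ex (law_abel (hl l)) hl_le // expr0.
have E n : \sum_(k < n) law_tail k.+1 * (hl l k.+1 - hl l k) =
    ((4 / u) ^+ minn l n - 1) / 4 ^+ l.
  elim: n => [|n IH]; first by rewrite big_ord0 minn0 expr0 subrr mul0r.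
  rewrite big_ord_recr /= IH; case: (ltnP n l) => nl.
    rewrite (minn_idPr nl) (hl_le nl) (hl_le (ltnW nl)).
    rewrite !exprS !expr_div_n; field; rewrite !expf_neq0 ?pnatr_eq0 ?u_neq0 //.
  by rewrite (minn_idPl (leqW nl)) !hl_ge ?subrr ?mulr0 ?addr0 ?(leqW nl).
by rewrite E; field; rewrite expf_neq0.
Qed.

Lemma law_min_eq l : (l <= N)%N -> Ex law (fun k => Num.min 1 (4 ^+ k / 4 ^+ l)) = (u ^+ l)^-1.
Proof.
by move=> lN; rewrite law_min (minn_idPl lN) expr_div_n; field; rewrite !expf_neq0 ?pnatr_eq0 ?u_neq0 //.
Qed.

Lemma law_min_le l : Ex law (fun k => Num.min 1 (4 ^+ k / 4 ^+ l)) <= (u ^+ l)^-1.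
Proof.
case: (leqP l N) => [/law_min_eq->//|Nl]; rewrite law_min (minn_idPr (ltnW Nl)).
have -> : (u ^+ l)^-1 = (4 / u) ^+ l / 4 ^+ l.
  by rewrite expr_div_n; field; rewrite !expf_neq0 ?pnatr_eq0 ?u_neq0 //.
rewrite ler_wpM2r ?invr_ge0 ?exprn_ge0 // ler_weXn2l ?(ltnW Nl) //.
by rewrite ler_pdivlMr // mul1r.
Qed.

End ScaleLaw.

(** * Square roots as dyadic sums of truncations *)

Section DyadicSums.
Variable R : realType.

(** A discretised square root: the terms double until [4 ^ l] passes [Y] and then halve, so the sum
    is within constants of [sqrt Y] as long as [1 <= Y < 4 ^ M.+1]. It is linear in the truncations
    [min (1, Y / 4 ^ l)], whose means the scale law controls. *)
Definition dyadic_sum (M : nat) (Y : R) := \sum_(l < M.+1) 2 ^+ l * Num.min 1 (Y / 4 ^+ l).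

Let pow4 l : 4 ^+ l = 2 ^+ l * 2 ^+ l :> R.
Proof. by rewrite -exprMn; congr (_ ^+ _); ring. Qed.

Lemma dyadic_sum_le (M : nat) (s : R) : 0 <= s -> dyadic_sum M (s ^+ 2) <= 4 * s.
Proof.
move=> s0.
(* Invariant for the induction on [M]: below saturation one must keep track of the tail still to
   come, namely [s ^ 2 / 2 ^ M]. *)
suff : if 2 ^+ M <= s then dyadic_sum M (s ^+ 2) <= 2 * 2 ^+ M
       else dyadic_sum M (s ^+ 2) <= 4 * s - s ^+ 2 / 2 ^+ M.
  case: ifP => h1 h2; first lra.
  by apply: le_trans h2 _; rewrite gerBl divr_ge0 ?sqr_ge0 ?exprn_ge0.
rewrite /dyadic_sum; elim: M => [|M IH].
  rewrite big_ord1 /= !expr0 !divr1 mul1r mulr1.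
  case: leP => s1; first by rewrite ge_min; apply/orP; left; lra.
  apply: le_trans (_ : s ^+ 2 <= _); first by rewrite ge_min lexx orbT.
  nra.
rewrite big_ord_recr /=; set S := \sum_(l < M.+1) _ in IH *.
have t0 : 0 < 2 ^+ M :> R by rewrite exprn_gt0.
have E : 2 ^+ M.+1 * Num.min 1 (s ^+ 2 / 4 ^+ M.+1) <= s ^+ 2 / 2 ^+ M / 2.
  apply: le_trans (_ : 2 ^+ M.+1 * (s ^+ 2 / 4 ^+ M.+1) <= _).
    by rewrite ler_wpM2l ?exprn_ge0 // ge_min lexx orbT.
  by rewrite le_eqVlt; apply/orP; left; apply/eqP; rewrite pow4 !exprS; field; rewrite gt_eqF.
have E1 : 2 ^+ M.+1 * Num.min 1 (s ^+ 2 / 4 ^+ M.+1) <= 2 * 2 ^+ M.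
  by rewrite exprS ler_piMr ?mulr_ge0 ?(ltW t0) // ge_min lexx.
have -> : s ^+ 2 / 2 ^+ M.+1 = s ^+ 2 / 2 ^+ M / 2.
  by rewrite (exprS _ M); field; rewrite gt_eqF.
case: leP => h1; case: ifP IH => h2 IH.
- apply: le_trans (lerD IH E1) _; rewrite exprS; lra.
- by move: h2; rewrite (le_trans _ h1) // exprS ler_peMl ?(ltW t0) // ler1n.
- apply: le_trans (lerD IH E) _.
  set r := s / 2 ^+ M; have sr : s = r * 2 ^+ M by rewrite divfK ?gt_eqF.
  have -> : s ^+ 2 / 2 ^+ M = r ^+ 2 * 2 ^+ M by rewrite sr; field; rewrite gt_eqF.
  have r1 : 1 <= r by rewrite ler_pdivlMr ?mul1r.
  have r2 : r <= 2 by rewrite ler_pdivrMr // -exprS ltW.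
  suff : (2 + r ^+ 2 - 4 * r) * 2 ^+ M <= 0 by rewrite {1}sr; lra.
  by rewrite pmulr_lle0 //; nra.
- apply: le_trans (lerD IH E) _; lra.
Qed.

Lemma dyadic_bracket (b s : R) (M : nat) : 1 < b -> 1 <= s -> s < b ^+ M.+1 ->
  exists2 a, (a <= M)%N & b ^+ a <= s < b ^+ a.+1.
Proof.
move=> b1 s1 sM; have ex : exists h, s < b ^+ h by exists M.+1.
case: (ex_minnP ex) => -[|h] sh hmin.
  by move: sh; rewrite expr0 ltNge s1.
exists h; first by rewrite -ltnS; apply: hmin.
by rewrite sh andbT leNgt; apply/negP => /hmin; rewrite ltnn.
Qed.

Lemma dyadic_sum_ge (M : nat) (s : R) : 1 <= s -> s < 2 ^+ M.+1 ->
  s <= 2 * dyadic_sum M (s ^+ 2).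
Proof.
move=> s1 sM; have [|a aM /andP[a1 a2]] := dyadic_bracket _ s1 sM; first by rewrite ltr1n.
have aM' : (a < M.+1)%N by [].
rewrite /dyadic_sum (bigD1 (Ordinal aM')) //=.
have -> : Num.min 1 (s ^+ 2 / 4 ^+ a) = 1.
  apply/min_idPl; rewrite ler_pdivlMr ?exprn_gt0 // mul1r pow4 -expr2.
  by rewrite lerXn2r ?nnegrE ?exprn_ge0 //; lra.
have : 0 <= \sum_(i < M.+1 | i != Ordinal aM') 2 ^+ i * Num.min 1 (s ^+ 2 / 4 ^+ i) :> R.
  apply: sumr_ge0 => i _; rewrite mulr_ge0 ?exprn_ge0 // le_min ler01 /=.
  by rewrite divr_ge0 ?sqr_ge0 ?exprn_ge0.
move: a2; rewrite exprS mulr1; lra.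
Qed.

Variable u : R.
Hypotheses (u2 : 2 <= u) (u4 : u <= 4).

(** What the dyadic sum becomes when each truncation is replaced by its mean. Levels with
    [u ^ l <= Q] double; later ones decay only with ratio [2 / u], and at [p = 1] not at all, as for
    the infinite mean of a Cauchy variable. Dividing by [geo] keeps the constants uniform in [p]. *)
Definition mix_sum (M : nat) (Q : R) := \sum_(l < M.+1) 2 ^+ l * Num.min 1 (Q / u ^+ l).
Definition geo (M : nat) : R := \sum_(j < M.+1) (2 / u) ^+ j.

Let u_gt0 : 0 < u. Proof. by move: u2; lra. Qed.
Let u_neq0 : u != 0. Proof. by rewrite gt_eqF. Qed.
Let s0 : 0 <= 2 / u. Proof. by rewrite divr_ge0 ?(ltW u_gt0). Qed.
Let s1 : 2 / u <= 1. Proof. by rewrite ler_pdivrMr // mul1r. Qed.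

Lemma geo_ge1 M : 1 <= geo M.
Proof.
rewrite /geo big_ord_recl expr0 lerDl; apply: sumr_ge0 => i _; exact: exprn_ge0.
Qed.

Lemma geo_le M M' : (M <= M')%N -> geo M <= geo M'.
Proof.
move=> MM'; rewrite /geo (big_ord_widen_cond M'.+1 predT (fun j => (2 / u) ^+ j)) //.
by rewrite big_mkcond; apply: ler_sum => i _; case: ifP => // _; apply: exprn_ge0.
Qed.

(** The ratio [2 / u] is at most 1, so the second half weighs no more than the first. The lower
    bound on the mean sees [2 * A] tail levels and the upper bound [4 * A]; this lets one
    normalisation serve both. *)
Lemma geo_double m : geo (m + m) <= 2 * geo m.
Proof.
rewrite /geo -addSn big_split_ord /=; set X := \sum_(j < m.+1) _.
have -> : 2 * X = X + X by ring.
rewrite lerD2l.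
apply: le_trans (_ : \sum_(i < m) (2 / u) ^+ i <= _).
  apply: ler_sum => i _; rewrite exprD ler_piMl ?exprn_ge0 // exprn_ile1 //.
by rewrite /X big_ord_recr /= lerDl exprn_ge0.
Qed.

Lemma mix_sum_ge (a A N : nat) (Q : R) : (a <= A <= N)%N -> u ^+ a <= Q ->
  2 ^+ a * geo (N - A) <= mix_sum N Q.
Proof.
move=> /andP[aA AN] aQ; rewrite /mix_sum.
have -> : N.+1 = (a + (N - a).+1)%N by rewrite addnS subnKC // (leq_trans aA).
rewrite big_split_ord /=.
apply: le_trans (_ : 2 ^+ a * geo (N - a) <= _).
  by rewrite ler_wpM2l ?exprn_ge0 // geo_le // leq_sub2l.
apply: le_trans (_ : \sum_(i < (N - a).+1) 2 ^+ (a + i) * Num.min 1 (Q / u ^+ (a + i)) <= _).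
  rewrite /geo mulr_sumr; apply: ler_sum => i _.
  rewrite exprD -mulrA ler_wpM2l ?exprn_ge0 // expr_div_n ler_wpM2l ?exprn_ge0 //.
  rewrite le_min invf_le1 ?exprn_gt0 // exprn_ege1 /=; last by move: u2; lra.
  rewrite exprD invfM mulrA -[leLHS]mul1r ler_wpM2r ?invr_ge0 ?exprn_ge0 ?(ltW u_gt0) //.
  by rewrite ler_pdivlMr ?exprn_gt0 // mul1r.
rewrite lerDr; apply: sumr_ge0 => i _; rewrite mulr_ge0 ?exprn_ge0 // le_min ler01 /=.
by rewrite divr_ge0 ?exprn_ge0 ?(ltW u_gt0) // (le_trans _ aQ) // exprn_ge0 ?(ltW u_gt0).
Qed.

Lemma mix_sum_le (a M : nat) (Q : R) : 0 <= Q -> Q <= 4 * u ^+ a.+1 ->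
  mix_sum M Q <= 17 * 2 ^+ a * geo M.
Proof.
move=> Q0 Qa; rewrite /mix_sum.
have ta : 0 <= 2 ^+ a :> R by rewrite exprn_ge0.
have sumt : \sum_(l < a) 2 ^+ l <= 2 ^+ a :> R.
  elim: (a) => [|n IH]; first by rewrite big_ord0 expr0.
  by rewrite big_ord_recr exprS /=; lra.
apply: le_trans (_ : \sum_(l < a) 2 ^+ l + \sum_(j < M.+1) 16 * 2 ^+ a * (2 / u) ^+ j <= _);
  last first.
  rewrite -mulr_sumr -/(geo M); have := geo_ge1 M; nra.
case: (leqP a M) => aM; last first.
  apply: le_trans (_ : \sum_(l < a) 2 ^+ l <= _); last first.
    by rewrite lerDl; apply: sumr_ge0 => j _; rewrite !mulr_ge0 ?exprn_ge0.
  rewrite (big_ord_widen_cond a predT (fun l => 2 ^+ l * Num.min 1 (Q / u ^+ l))) //.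
  rewrite big_mkcond; apply: ler_sum => l _; case: ifP => _; last by rewrite exprn_ge0.
  by rewrite ler_piMr ?exprn_ge0 // ge_min lexx.
apply: le_trans (_ : \sum_(l < a) 2 ^+ l + 16 * 2 ^+ a * geo (M - a) <= _); last first.
  by rewrite -mulr_sumr lerD2l ler_wpM2l ?mulr_ge0 // geo_le ?leq_subr.
have -> : M.+1 = (a + (M - a).+1)%N by rewrite addnS subnKC.
rewrite [leLHS]big_split_ord /= lerD //.
  by apply: ler_sum => l _; rewrite ler_piMr ?exprn_ge0 // ge_min lexx.
rewrite /geo mulr_sumr; apply: ler_sum => i _.
apply: le_trans (_ : 2 ^+ (a + i) * (Q / u ^+ (a + i)) <= _).
  by rewrite ler_wpM2l ?exprn_ge0 // ge_min lexx orbT.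
rewrite !exprD expr_div_n.
have -> : 16 * 2 ^+ a * (2 ^+ i / u ^+ i) = 2 ^+ a * 2 ^+ i * (16 * u ^+ a / (u ^+ a * u ^+ i)).
  by field; rewrite !expf_neq0.
rewrite ler_wpM2l ?mulr_ge0 ?exprn_ge0 // ler_wpM2r ?invr_ge0 ?mulr_ge0 ?exprn_ge0 ?(ltW u_gt0) //.
have ua : 0 < u ^+ a by rewrite exprn_gt0.
by move: Qa u4; rewrite exprS; nra.
Qed.

End DyadicSums.

(** * Signed scaled sums against the lp norm *)

Section NormEmbedding.
Variables (R : realType) (p : R) (d A : nat).
Hypotheses (p1 : 1 <= p) (p2 : p <= 2).

Let u : R := 2 `^ p.
(** [A] will bound the binary logarithm of the norms. Scales up to [2 ^ (3 * A)] leave [2 * A] tail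
    levels above every such norm, and [sqrt Y] stays below [2 ^ (4 * A + 1)], the range of dyadic
    sums of depth [4 * A]. *)
Let N := (3 * A)%N.
Let M := (4 * A)%N.

Let u2 : 2 <= u.
Proof. by rewrite /u -{1}[2]powRr1 // ler_powR // ler1n. Qed.

Let u4 : u <= 4.
Proof.
rewrite /u (_ : 4 = 2 `^ 2) ?ler_powR ?ler1n //.
by rewrite powR_mulrn // -natrX.
Qed.

Let u_gt0 : 0 < u. Proof. by move: u2; lra. Qed.

Lemma powR2X b : (2 ^+ b) `^ p = u ^+ b.
Proof. by rewrite -powR_mulrn // -powRrM mulrC powRrM powR_mulrn ?powR_ge0. Qed.

Let p0 : 0 <= p. Proof. by move: p1; lra. Qed.

Let minr0 (z : R) : 0 <= z -> 0 <= Num.min 1 z.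
Proof. by move=> z0; rewrite le_min ler01. Qed.

Let k4 (b l : nat) : (b <= l)%N -> forall k, 4 ^+ b * 4 ^+ k / 4 ^+ l = 4 ^+ k / 4 ^+ (l - b) :> R.
Proof.
move=> bl k; rewrite -{1}(subnKC bl) exprD; field.
by rewrite !expf_neq0 ?pnatr_eq0.
Qed.

(** With [2 ^ b <= m < 2 ^ b.+1], a factor [m] amounts to lowering the level [l] by [b] or [b.+1],
    and the law turns the lowered level into a power of [u]. *)
Let coord_bounds (m l : nat) : (0 < m)%N ->
  let E := Ex (law N u2 u4) (fun k => Num.min 1 (m%:R ^+ 2 * 4 ^+ k / 4 ^+ l)) in
  E <= 4 * (m%:R `^ p / u ^+ l) /\
  ((l <= N)%N -> Num.min 1 (m%:R `^ p / u ^+ l) / 4 <= E).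
Proof.
move=> m0 E.
have [|||b _ /andP[b1 b2]] := @dyadic_bracket R 2 m%:R m.
- by rewrite ltr1n.
- by rewrite ler1n.
- by rewrite -natrX ltr_nat (leq_trans (ltn_expl m (isT : 1 < 2)%N)) // leq_exp2l.
have w1 : u ^+ b <= m%:R `^ p.
  by rewrite -powR2X ge0_ler_powR // ?nnegrE ?exprn_ge0.
have w2 : m%:R `^ p <= u * u ^+ b.
  by rewrite -exprS -powR2X ge0_ler_powR // ?nnegrE ?exprn_ge0 // ltW.
have ul : 0 < u ^+ l by rewrite exprn_gt0.
have ub : 0 < u ^+ b by rewrite exprn_gt0.
have m1 : 4 ^+ b <= m%:R ^+ 2 :> R.
  have -> : 4 ^+ b = (2 ^+ b) ^+ 2 :> R by rewrite -exprM mulnC exprM; congr (_ ^+ _); ring.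
  by rewrite lerXn2r ?nnegrE ?exprn_ge0.
have m2 : m%:R ^+ 2 <= 4 ^+ b.+1 :> R.
  have -> : 4 ^+ b.+1 = (2 ^+ b.+1) ^+ 2 :> R by rewrite -exprM mulnC exprM; congr (_ ^+ _); ring.
  by rewrite lerXn2r ?nnegrE ?exprn_ge0 // ltW.
have mono (x y : R) k : x <= y ->
    Num.min 1 (x * 4 ^+ k / 4 ^+ l) <= Num.min 1 (y * 4 ^+ k / 4 ^+ l).
  move=> xy; rewrite le_min ge_min lexx /= ge_min; apply/orP; right.
  by rewrite ler_wpM2r ?invr_ge0 ?exprn_ge0 // ler_wpM2r ?exprn_ge0.
split => [|lN].
  case: (leqP b.+1 l) => bl; last first.
    apply: le_trans (_ : 1 <= _); first by apply: Ex_le => k; rewrite ge_min lexx.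
    apply: le_trans (_ : m%:R `^ p / u ^+ l <= _); last first.
      by rewrite ler_peMl ?ler1n // divr_ge0 ?powR_ge0 ?(ltW ul).
    rewrite ler_pdivlMr // mul1r; apply: le_trans w1; rewrite ler_weXn2l //.
    by move: u2; lra.
  apply: le_trans (_ : Ex (law N u2 u4) (fun k => Num.min 1 (4 ^+ k / 4 ^+ (l - b.+1))) <= _).
    by apply: ler_Ex => k; rewrite -k4 //; apply: mono.
  apply: le_trans (law_min_le _ _ _ _) _.
  have -> : (u ^+ (l - b.+1))^-1 = u ^+ b.+1 / u ^+ l.
    by rewrite -{2}(subnKC bl) exprD; field; rewrite !expf_neq0 ?gt_eqF.
  rewrite mulrA ler_wpM2r ?invr_ge0 ?(ltW ul) // exprS.
  by move: u4 w1; nra.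
case: (leqP b l) => bl; last first.
  rewrite /E (eq_Ex _ (Y := fun=> 1)) => [|k]; last first.
    apply/min_idPl; rewrite ler_pdivlMr ?exprn_gt0 // mul1r.
    apply: le_trans (_ : 4 ^+ b <= _); first by rewrite ler_weXn2l ?ler1n // ltnW.
    by apply: le_trans m1 _; rewrite ler_peMr ?exprn_ge0 // exprn_ege1 // ler1n.
  rewrite Ex_cst; have : Num.min 1 (m%:R `^ p / u ^+ l) <= 1 by rewrite ge_min lexx.
  lra.
apply: le_trans (_ : Ex (law N u2 u4) (fun k => Num.min 1 (4 ^+ k / 4 ^+ (l - b))) <= _);
  last by apply: ler_Ex => k; rewrite -k4 //; apply: mono.
rewrite law_min_eq ?(leq_trans (leq_subr _ _)) //.
have -> : (u ^+ (l - b))^-1 = u ^+ b / u ^+ l.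
  by rewrite -{2}(subnKC bl) exprD; field; rewrite !expf_neq0 ?gt_eqF.
rewrite ler_pdivrMr // ge_min; apply/orP; right.
rewrite mulrAC ler_wpM2r ?invr_ge0 ?(ltW ul) //.
by move: u4; nra.
Qed.

Definition norm_space := ({ffun 'I_d -> 'I_N.+1} * {ffun 'I_d -> bool})%type.
Definition norm_dist : fdist R norm_space :=
  fprod (fpow (fun=> law N u2 u4)) (sign_dist R d).

Definition int_proj (z : norm_space) (v : 'I_d -> int) : int :=
  \sum_i v i * (if z.2 i then 1 else -1) * (2 ^ z.1 i)%:Z.

Variable v : 'I_d -> int.
Let x i : nat := `|v i|%N.
Let Q : R := \sum_i (x i)%:R `^ p.
Let Y (k : {ffun 'I_d -> 'I_N.+1}) : R := \sum_i (x i)%:R ^+ 2 * 4 ^+ k i.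

Let Y_ge0 k : 0 <= Y k.
Proof. by apply: sumr_ge0 => i _; rewrite mulr_ge0 ?exprn_ge0. Qed.

Let kd := fpow (fun=> law N u2 u4) : fdist R {ffun 'I_d -> 'I_N.+1}.

Lemma Ex_int_proj_bounds :
  4 / 9 * Ex kd (fun k => Num.sqrt (Y k)) <=
    Ex norm_dist (fun z => `|int_proj z v|%:~R) <= Ex kd (fun k => Num.sqrt (Y k)).
Proof.
rewrite /norm_dist Ex_prod -ExZl.
have E k : Ex (sign_dist R d) (fun s => `|int_proj (k, s) v|%:~R) =
    Ex (sign_dist R d) (fun s => `|\sum_i (v i)%:~R * 2 ^+ k i * sgnb R (s i)|).
  apply: eq_Ex => s; rewrite intr_norm; congr `|_|; rewrite /int_proj.
  rewrite (big_morph (fun z : int => z%:~R : R) (intrD R) (mulr0z 1)).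
  apply: eq_bigr => i _; rewrite !intrM /= -pmulrn natrX /sgnb.
  by case: (s i); ring.
have K (k : {ffun 'I_d -> 'I_N.+1}) := khintchine (fun i => (v i)%:~R * 2 ^+ k i : R).
have YE (k : {ffun 'I_d -> 'I_N.+1}) : \sum_i ((v i)%:~R * 2 ^+ k i) ^+ 2 = Y k.
  apply: eq_bigr => i _; rewrite exprMn -exprM mulnC exprM; congr (_ * _).
    by rewrite /x natr_absz intr_norm real_normK ?num_real.
  by congr (_ ^+ _); ring.
apply/andP; split; apply: ler_Ex => k; rewrite E -YE; by case/andP: (K k).
Qed.

Let F (l : nat) := Ex kd (fun k => Num.min 1 (Y k / 4 ^+ l)).

Let coordE (i : 'I_d) (l : nat) :
  Ex kd (fun k => Num.min 1 ((x i)%:R ^+ 2 * 4 ^+ k i / 4 ^+ l)) =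
  Ex (law N u2 u4) (fun k => Num.min 1 ((x i)%:R ^+ 2 * 4 ^+ k / 4 ^+ l)).
Proof.
exact: (Ex_fpow_proj (fun=> law N u2 u4) i
  (fun k : 'I_N.+1 => Num.min 1 ((x i)%:R ^+ 2 * 4 ^+ k / 4 ^+ l))).
Qed.

Let min_sum_le (r : seq 'I_d) (h : 'I_d -> R) : (forall i, 0 <= h i) ->
  Num.min 1 (\sum_(i <- r) h i) <= \sum_(i <- r) Num.min 1 (h i).
Proof.
move=> h0; elim: r => [|i r IH]; first by rewrite !big_nil ge_min lexx orbT.
rewrite !big_cons.
have := sumr_ge0 (P := predT) r (fun i _ => h0 i) => S0.
have := sumr_ge0 (P := predT) r (fun i _ => minr0 (h0 i)) => S1.
have hi := h0 i; move: IH; set S := \sum_(j <- r) h j in S0 *.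
set S' := \sum_(j <- r) Num.min _ _ in S1 *; rewrite ge_min => /orP IH.
case: (leP 1 (h i)) => h1; first by rewrite ge_min lerDl S1.
by case: IH => IH; rewrite ge_min; apply/orP; [left|right]; lra.
Qed.

Let F_le l : F l <= Num.min 1 (4 * Q / u ^+ l).
Proof.
rewrite le_min; apply/andP; split; first by apply: Ex_le => k; rewrite ge_min lexx.
apply: le_trans (_ : Ex kd (fun k => \sum_i Num.min 1 ((x i)%:R ^+ 2 * 4 ^+ k i / 4 ^+ l)) <= _).
  apply: ler_Ex => k; rewrite /Y mulr_suml; apply: min_sum_le => i.
  by rewrite divr_ge0 ?mulr_ge0 ?exprn_ge0.
rewrite Ex_sum /Q mulr_sumr mulr_suml; apply: ler_sum => i _; rewrite coordE.
have [->|xi] := posnP (x i).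
  rewrite (eq_Ex _ (Y := fun=> 0)) => [|k]; last first.
    by rewrite expr0n /= !mul0r; apply/min_idPr.
  by rewrite Ex_cst divr_ge0 ?mulr_ge0 ?powR_ge0 ?exprn_ge0 ?(ltW u_gt0).
by have [h _] := coord_bounds l xi; rewrite -mulrA.
Qed.

Let expR_le (z : R) : 0 <= z -> Num.min 1 z / 2 <= 1 - expR (- z).
Proof.
move=> z0; rewrite expRN.
have e1 : 1 + z <= expR z by apply: expR_ge1Dx.
have e2 : (expR z)^-1 <= (1 + z)^-1 by rewrite lef_pV2 ?posrE ?expR_gt0 //; lra.
have e3 : 1 - (1 + z)^-1 = z / (1 + z) by field; rewrite gt_eqF //; lra.
suff : Num.min 1 z / 2 <= z / (1 + z) by lra.
rewrite ler_pdivlMr; last by lra.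
case: (leP 1 z) => z1; nra.
Qed.

(** Independence enters through the Laplace transform: [1 - exp (- z)] lies between [min (1, z) / 2]
    and [min (1, z)], and the mean of [exp (- Y / 4 ^ l)] factorises over the coordinates. *)
Let F_ge l : (l <= N)%N -> Num.min 1 (Q / u ^+ l) / 16 <= F l.
Proof.
move=> lN.
pose a i : R := Ex (law N u2 u4) (fun k => 1 - expR (- ((x i)%:R ^+ 2 * 4 ^+ k / 4 ^+ l))).
have arg0 i (k : nat) : 0 <= (x i)%:R ^+ 2 * 4 ^+ k / 4 ^+ l :> R.
  by rewrite divr_ge0 ?mulr_ge0 ?exprn_ge0.
have a_ge i : Num.min 1 ((x i)%:R `^ p / u ^+ l) / 8 <= a i.
  apply: le_trans (_ : Ex (law N u2 u4)
      (fun k => Num.min 1 ((x i)%:R ^+ 2 * 4 ^+ k / 4 ^+ l) / 2) <= _); last first.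
    by apply: ler_Ex => k; apply: expR_le.
  rewrite ExZr; have [xi|xi] := posnP (x i); last first.
    by have [_ /(_ lN)] := coord_bounds l xi; lra.
  rewrite xi powR0; last by rewrite gt_eqF //; move: p1; lra.
  have -> : Num.min 1 (0 / u ^+ l) = 0 :> R by rewrite mul0r; apply/min_idPr.
  rewrite mul0r mulr_ge0 ?invr_ge0 //; apply: Ex_ge0 => k; apply: minr0.
  by rewrite divr_ge0 ?mulr_ge0 ?exprn_ge0.
have a_ge0 i : 0 <= a i.
  apply: le_trans (a_ge i); rewrite divr_ge0 // minr0 // divr_ge0 ?powR_ge0 //.
  by rewrite exprn_ge0 // ltW.
have a_le1 i : a i <= 1 by apply: Ex_le => k; rewrite gerBl expR_ge0.
have E1 : 1 - \prod_i (1 - a i) <= F l.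
  have -> : \prod_i (1 - a i) = Ex kd (fun k => expR (- (Y k / 4 ^+ l))).
    rewrite (eq_Ex _ (Y := fun k : {ffun 'I_d -> 'I_N.+1} => \prod_i expR (- ((x i)%:R ^+ 2 * 4 ^+ k i / 4 ^+ l)))).
      rewrite (Ex_fpow_prod (fun=> law N u2 u4)
        (fun i (k : 'I_N.+1) => expR (- ((x i)%:R ^+ 2 * 4 ^+ k / 4 ^+ l)))).
      by apply: eq_bigr => i _; rewrite /a ExB Ex_cst opprB addrC subrK.
    by move=> k; rewrite /Y mulr_suml -sumrN expR_sum.
  rewrite -[X in X - _](Ex_cst kd) -ExB; apply: ler_Ex => k.
  rewrite le_min gerBl expR_ge0 /=.
  by have := expR_ge1Dx (- (Y k / 4 ^+ l)); lra.
apply: le_trans E1.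
have E2 : \prod_i (1 - a i) <= expR (- \sum_i a i).
  rewrite -sumrN expR_sum; apply: ler_prod => i _.
  by rewrite subr_ge0 a_le1 /=; apply: expR_ge1Dx.
have sa0 : 0 <= \sum_i a i by apply: sumr_ge0.
apply: le_trans (_ : Num.min 1 (\sum_i a i) / 2 <= _).
  have Q1 : Num.min 1 (Q / u ^+ l) / 8 <= \sum_i a i.
    apply: le_trans (ler_sum _ (fun i _ => a_ge i)); rewrite -mulr_suml ler_wpM2r //.
    rewrite /Q mulr_suml; apply: min_sum_le => i.
    by rewrite divr_ge0 ?powR_ge0 ?exprn_ge0 ?(ltW u_gt0).
  have : Num.min 1 (Q / u ^+ l) <= 1 by rewrite ge_min lexx.
  move: Q1; set q := Num.min 1 (Q / _) => q1 q2.
  suff : q / 8 <= Num.min 1 (\sum_i a i) by lra.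
  by rewrite le_min; apply/andP; split; lra.
apply: le_trans (expR_le sa0) _; lra.
Qed.

Let sqrt_lo : mix_sum u N Q / 64 <= Ex kd (fun k => Num.sqrt (Y k)).
Proof.
apply: le_trans (_ : Ex kd (fun k => dyadic_sum N (Y k) / 4) <= _); last first.
  apply: ler_Ex => k; have := dyadic_sum_le N (sqrtr_ge0 (Y k)).
  by rewrite sqr_sqrtr //; lra.
rewrite ExZr /dyadic_sum Ex_sum.
suff : mix_sum u N Q / 16 <= \sum_(l < N.+1) Ex kd (fun k => 2 ^+ l * Num.min 1 (Y k / 4 ^+ l)).
  lra.
rewrite /mix_sum mulr_suml; apply: ler_sum => l _; rewrite ExZl -mulrA.
by rewrite ler_wpM2l ?exprn_ge0 // F_ge // -ltnS.
Qed.

Variable B : nat.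
Hypotheses (xB : forall i, (`|v i| <= B)%N) (dB : (d * B <= 2 ^ A)%N).
Hypothesis v_neq0 : exists i, v i != 0.

Let d_gt0 : (0 < d)%N.
Proof. by have [[i id] _] := v_neq0; apply: leq_trans id. Qed.

Let Y_ge1 k : 1 <= Y k.
Proof.
have [i vi] := v_neq0; rewrite /Y (bigD1 i) //= -[leLHS]addr0 lerD //.
  rewrite -[leLHS]mulr1 ler_pM ?exprn_ege1 ?ler1n //.
  by rewrite /x lt0n absz_eq0.
by apply: sumr_ge0 => j _; rewrite mulr_ge0 ?exprn_ge0.
Qed.

Let sqrtY_lt k : Num.sqrt (Y k) < 2 ^+ M.+1.
Proof.
have t0 : 0 <= 2 ^+ M.+1 :> R by rewrite exprn_ge0.
rewrite -[ltRHS](ger0_norm t0) -sqrtr_sqr ltr_sqrt; last by rewrite exprn_gt0 // exprn_gt0.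
apply: le_lt_trans (_ : (2 ^+ M) ^+ 2 < _); last first.
  by rewrite ltrXn2r ?nnegrE ?exprn_ge0 // exprS ltr_pMl ?exprn_gt0 // ltr1n.
apply: le_trans (_ : \sum_(i < d) B%:R ^+ 2 * 4 ^+ N <= _).
  apply: ler_sum => i _; rewrite ler_pM ?exprn_ge0 //.
    by rewrite lerXn2r ?nnegrE // ler_nat; apply: xB.
  by rewrite ler_weXn2l ?ler1n // -ltnS.
have -> : (2 ^+ M) ^+ 2 = (2 ^+ A) ^+ 2 * 4 ^+ N :> R.
  have -> : 4 = 2 ^+ 2 :> R by ring.
  by rewrite /M /N -!exprM -exprD; congr (_ ^+ _); ring.
rewrite sumr_const card_ord -mulrnAl ler_wpM2r ?exprn_ge0 //.
apply: le_trans (_ : (d * B)%:R ^+ 2 <= _).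
  rewrite natrM exprMn -mulr_natl ler_wpM2r ?sqr_ge0 //.
  by rewrite expr2 ler_peMl // ler1n.
by rewrite lerXn2r ?nnegrE ?exprn_ge0 // -natrX ler_nat.
Qed.

Let Q_ge1 : 1 <= Q.
Proof.
have [i vi] := v_neq0; rewrite /Q (bigD1 i) //= -[leLHS]addr0 lerD //.
  apply: le_trans (_ : 1 `^ p <= _); first by rewrite powR1.
  by rewrite ge0_ler_powR ?nnegrE // ler1n /x lt0n absz_eq0.
by apply: sumr_ge0 => j _; apply: powR_ge0.
Qed.

Let Q_le : Q <= u ^+ A.
Proof.
apply: le_trans (_ : \sum_(i < d) B%:R `^ p <= _).
  by apply: ler_sum => i _; rewrite ge0_ler_powR ?nnegrE ?ler_nat //; apply: xB.
rewrite sumr_const card_ord -(mulr_natl (B%:R `^ p)).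
apply: le_trans (_ : d%:R `^ p * B%:R `^ p <= _).
  rewrite ler_wpM2r ?powR_ge0 // -{1}[d%:R]powRr1 // ler_powR // ler1n //.
by rewrite -powRM // -natrM -powR2X ge0_ler_powR ?nnegrE ?exprn_ge0 // -natrX ler_nat.
Qed.

(** Here 288 = 2 * 64 * 9 / 4 collects the dyadic bracket, [sqrt_lo] and Khintchine, while 19584 =
    288 * 68, the mean being at most [2 * 34 * n * g]. *)
Lemma norm_embedding_bounds :
  Q `^ p^-1 <= 288 / geo u (2 * A) * Ex norm_dist (fun z => `|int_proj z v|%:~R)
    <= 19584 * Q `^ p^-1.
Proof.
set n := Q `^ p^-1.
have u1 : 1 < u by move: u2; lra.
have [|a aA /andP[a1 a2]] := dyadic_bracket (M := A) u1 Q_ge1.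
  by apply: le_lt_trans Q_le _; rewrite exprS ltr_pMl // exprn_gt0.
have pn0 : p != 0 by rewrite gt_eqF //; move: p1; lra.
have root b : (u ^+ b) `^ p^-1 = 2 ^+ b.
  by rewrite -powR2X -powRrM divff // powRr1 // exprn_ge0.
have Q0 : 0 <= Q by move: Q_ge1; lra.
have ue b : 0 <= u ^+ b by rewrite exprn_ge0 // ltW.
have n1 : 2 ^+ a <= n by rewrite -root /n ge0_ler_powR ?nnegrE ?invr_ge0.
have n2 : n <= 2 * 2 ^+ a.
  by rewrite -exprS -root /n ge0_ler_powR ?nnegrE ?invr_ge0 // ltW.
have g1 := geo_ge1 u2 (2 * A); set g := geo u (2 * A) in g1 *.
have NA : (N - A = 2 * A)%N by rewrite /N mulSn addKn.
have lo := mix_sum_ge u2 (a := a) (A := A) (N := N) (Q := Q).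
have {lo} lo : 2 ^+ a * g <= mix_sum u N Q.
  by rewrite /g -NA; apply: lo => //; rewrite aA /N leq_pmull.
have hi : mix_sum u M (4 * Q) <= 34 * n * g.
  have Qa : 4 * Q <= 4 * u ^+ a.+1 by rewrite ler_pM2l // ltW.
  have Q40 : 0 <= 4 * Q by rewrite mulr_ge0.
  apply: le_trans (mix_sum_le u2 u4 M Q40 Qa) _.
  have -> : M = (2 * A + 2 * A)%N by rewrite /M; ring.
  have := geo_double u2 (2 * A); rewrite -/g => gd.
  have t0 : 0 <= 2 ^+ a :> R by rewrite exprn_ge0.
  apply: le_trans (_ : 17 * 2 ^+ a * (2 * g) <= _); first by rewrite ler_wpM2l ?mulr_ge0.
  nra.
have up : Ex kd (fun k => Num.sqrt (Y k)) <= 2 * mix_sum u M (4 * Q).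
  apply: le_trans (_ : Ex kd (fun k => 2 * dyadic_sum M (Y k)) <= _).
    apply: ler_Ex => k; rewrite -{2}[Y k]sqr_sqrtr //; apply: dyadic_sum_ge => //.
    by rewrite -sqrtr1 ler_sqrt.
  rewrite ExZl ler_pM2l // /dyadic_sum Ex_sum /mix_sum; apply: ler_sum => l _.
  by rewrite ExZl ler_wpM2l ?exprn_ge0 // F_le.
have /andP[L1 L2] := Ex_int_proj_bounds.
have sl := sqrt_lo; set e := Ex norm_dist _ in L1 L2 *.
have g0 : 0 < g by lra.
rewrite mulrAC ler_pdivlMr // ler_pdivrMr //; apply/andP; split; nra.
Qed.

End NormEmbedding.

(** * From integer projections to cuts *)

Section LpEmbedding.
Variables (R : realType) (p : R) (d Delta : nat).
Hypotheses (p1 : 1 <= p) (p2 : p <= 2).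

Lemma sum_threshold (m a b : nat) : (a <= m)%N -> (b <= m)%N ->
  (\sum_(t < m | (t < a) != (t < b)) 1)%N = `|a%:Z - b%:Z|%N.
Proof.
wlog ab : a b / (a <= b)%N => [hw am bm|am bm].
  case: (leqP a b) => [/hw->//|/ltnW ba]; rewrite distnC -hw //.
  by apply: eq_bigl => t; rewrite eq_sym.
rewrite distnEr // (eq_bigl (fun t : 'I_m => (a <= t < b)%N)); last first.
  by move=> t; case: (ltnP t a) => ta; case: (ltnP t b) => tb //; move: (leq_trans ta ab); lia.
rewrite sum1_card.
have -> : (b - a)%N = #|[set t : 'I_m | (a <= t < b)%N]|.
  rewrite -sum1_card (eq_bigl (fun t : 'I_m => (a <= t) && (t < b))%N); last first.
    by move=> t; rewrite inE.
  rewrite -(big_ord_widen_cond m (fun t => a <= t)%N (fun=> 1%N) bm).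
  have := @big_geq_mkord _ 0%N addn a b predT (fun=> 1%N); rewrite /= => <-.
  by rewrite sum_nat_const_nat muln1.
by apply: eq_card => t; rewrite inE.
Qed.

(* Each sampled projection is integer-valued, so that its absolute differences
   count the separating integer thresholds. *)
Lemma lp_cut_embedding : exists (K : finType) (phi : K -> grid d Delta -> bool) (wt : K -> R),
  (forall k, 0 <= wt k) /\
  forall x y, lp_dist p x y <= cutd phi wt x y <= 19584 * lp_dist p x y.
Proof.
have pn0 : p != 0 by apply: lt0r_neq0; apply: lt_le_trans ltr01 p1.
pose A := (d * Delta)%N.
have dA : (d * Delta <= 2 ^ A)%N by rewrite ltnW // ltn_expl.
pose N := (3 * A)%N.
(* A bound on all projections; shifted by [S] they become naturals up to [2 * S], so finitely many
   thresholds suffice. *)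
pose S := (d * (Delta * 2 ^ N))%N.
pose co (x : grid d Delta) (i : 'I_d) : int := (x i : nat)%:Z.
pose pr (z : norm_space d A) (x : grid d Delta) := int_proj z (co x).
have prS z x : `|pr z x| <= S%:Z.
  apply: le_trans (ler_norm_sum _ _ _) _.
  apply: le_trans (_ : \sum_(i < d) (Delta * 2 ^ N)%:Z <= _).
    apply: ler_sum => i _; rewrite !normrM.
    have -> : `|if z.2 i then 1 else -1 : int| = 1 by case: (z.2 i).
    rewrite mulr1 !ger0_norm // -PoszM lez_nat leq_mul ?(ltnW (ltn_ord _)) //.
    by rewrite leq_exp2l // -ltnS.
  by rewrite sumr_const card_ord -mulr_natl /S PoszM natz.
pose h z x : nat := absz (pr z x + S%:Z).
have hE z x : (h z x)%:Z = pr z x + S%:Z.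
  rewrite /h gez0_abs //; have := prS z x; rewrite ler_norml => /andP[]; lia.
have hS z x : (h z x <= 2 * S)%N.
  rewrite -lez_nat hE; have := prS z x; rewrite ler_norml => /andP[]; lia.
pose cst : R := 288 / geo (2 `^ p) (2 * A).
have g1 : 1 <= geo (2 `^ p) (2 * A) :> R.
  by apply: geo_ge1; rewrite -{1}[2]powRr1 // ler_powR // ler1n.
have cst0 : 0 <= cst.
  by apply: mulr_ge0; [apply: ler0n|rewrite invr_ge0; apply: le_trans ler01 g1].
pose K := (norm_space d A * 'I_(2 * S))%type.
pose phi (k : K) x := (k.2 < h k.1 x)%N.
pose wt (nd : fdist R (norm_space d A)) (k : K) := cst * nd k.1.
have wtE nd x y : cutd phi (wt nd) x y =
    cst * Ex nd (fun z => `|int_proj z (fun i => co x i - co y i)|%:~R).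
  rewrite /cutd big_mkcond /= -(pair_bigA _ (fun z (t : 'I_(2 * S)) =>
    if (t < h z x)%N != (t < h z y)%N then cst * nd z else 0)) /=.
  rewrite /Ex mulr_sumr; apply: eq_bigr => z _.
  rewrite -big_mkcond /= sumr_const -mulr_natr -mulrA; congr (_ * (_ * _)).
  rewrite -sum1_card (sum_threshold (hS z x) (hS z y)) pmulrn abszE; congr (`| _ |%:~R).
  rewrite !hE /pr /int_proj opprD addrACA subrr addr0 -sumrB; apply: eq_bigr => i _.
  by rewrite !mulrBl.
exists K, phi, (wt (norm_dist d A p1 p2)).
split=> [k|x y]; first by rewrite mulr_ge0 ?fd_ge0.
rewrite wtE.
have lpE : lp_dist p x y = (\sum_i (`|co x i - co y i|%N)%:R `^ p) `^ p^-1 :> R.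
  rewrite /lp_dist; congr (_ `^ _); apply: eq_bigr => i _; congr (_ `^ _).
  rewrite /Defs.coord natr_absz intr_norm intrB -!pmulrn -!natr1; congr `|_|.
  ring.
case: (pickP (fun i => co x i - co y i != 0)) => [i xy|xy].
  have xyD j : (absz (co x j - co y j) <= Delta)%N.
    rewrite /co; have := ltn_ord (x j); have := ltn_ord (y j); clear; lia.
  have xy0 : exists i, co x i - co y i != 0 by exists i.
  have bd := norm_embedding_bounds p1 p2 xyD dA xy0.
  rewrite lpE; exact: bd.
have co0 i : co x i - co y i = 0 by apply/eqP; rewrite -[_ == _]negbK xy.
have -> : lp_dist p x y = 0 :> R.
  rewrite lpE big1 => [|i _]; first by apply: powR0; rewrite invr_eq0.
  by rewrite co0; apply: powR0.
rewrite (eq_Ex _ (Y := fun=> 0)) => [|z]; first by rewrite Ex_cst !mulr0 lexx.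
by rewrite /int_proj big1 => [|i _]; [apply: mulr0z|rewrite co0 !mul0r].
Qed.

End LpEmbedding.

(** * The estimator *)

Section BaseSketch.
Variables (R : realType) (P K : finType) (phi : K -> P -> bool) (wt : K -> R).
Hypothesis wt_ge0 : forall k, 0 <= wt k.
Variables (L : nat) (r0 : R) (tau : R).
Hypotheses (r0_gt0 : 0 < r0) (tau_ge1 : 1 <= tau).
Variables (beta H B Kt m : nat) (dl : R).
Hypothesis B_ge : (4 * H.+1 <= B)%N.

Local Notation D := (cutd phi wt).

Definition node_id := beta.-tuple bool.
Definition label := (node_id * node_id)%type.

Definition label_bit (o : 'I_(beta + beta)) (v : label) : bool := tnth (cat_tuple v.1 v.2) o.

Lemma label_bit_inj (u v : label) : (forall o, label_bit o u = label_bit o v) -> u = v.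
Proof.
move=> h; have /(congr1 val) /= : cat_tuple u.1 u.2 = cat_tuple v.1 v.2.
  by apply: eq_from_tnth => o; apply: h.
move/eqP; rewrite eqseq_cat ?size_tuple // => /andP[/eqP e1 /eqP e2].
by case: u v e1 e2 {h} => [u1 u2] [v1 v2] /= /val_inj -> /val_inj ->.
Qed.

(** On good coins two data points of one depth-[j] bucket are within [tau] times the radius of level
    [j - 1], which is this value. *)
Definition width (j : nat) : R := 2 * tau * radius r0 j.

Lemma width_gt0 j : 0 < width j.
Proof.
by rewrite !mulr_gt0 ?radius_gt0 //; apply: lt_le_trans ltr01 tau_ge1.
Qed.

(** Makes the random sign of cut [k] have mean [expR (- (2 * wt k / width))], so that the parity
    separates two points with probability exactly [psi], which is comparable to [D / width] as long
    as [D <= width]. *)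
Definition parity_prob (j : nat) (k : K) : R := (1 - expR (- (2 * (wt k / width j)))) / 2.

Lemma parity_prob01 j k : 0 <= parity_prob j k <= 1.
Proof.
have e0 := expR_ge0 (- (2 * (wt k / width j))).
have e1 : expR (- (2 * (wt k / width j))) <= 1.
  by rewrite -expR0 ler_expR oppr_le0 mulr_ge0 // divr_ge0 // ltW // width_gt0.
by rewrite /parity_prob; apply/andP; split; lra.
Qed.

Definition parity_dist (j : nat) : fdist R {ffun K -> bool} :=
  fpow (fun k => bern (parity_prob01 j k)).

Definition parity (h : {ffun K -> bool}) (x : P) : bool := odd (\sum_k (h k && phi k x))%N.

Definition psi (j : nat) (x y : P) : R := (1 - expR (- (2 * (D x y / width j)))) / 2.

Lemma sign_parity (h : {ffun K -> bool}) x y :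
  (-1) ^+ (parity h x != parity h y) =
  \prod_k (if (phi k x != phi k y) && h k then -1 else 1) :> R.
Proof.
have -> : (parity h x != parity h y) = parity h x (+) parity h y.
  by case: (parity h x); case: (parity h y).
rewrite signr_addb /parity !signr_odd !expr_sum -big_split; apply: eq_bigr => k _ /=.
by case: (h k); case: (phi k x); case: (phi k y); rewrite /= ?expr0 ?expr1 ?mulr1 ?mul1r // mulrNN mulr1.
Qed.

Lemma Ex_parity j x y :
  Ex (parity_dist j) (fun h => (parity h x != parity h y)%:R) = psi j x y.
Proof.
pose F k (b : bool) : R := if (phi k x != phi k y) && b then -1 else 1.
rewrite (eq_Ex _ (Y := fun h : {ffun K -> bool} => (1 - \prod_k F k (h k)) / 2)) => [|h]; last first.
  by rewrite -sign_parity; case: (_ != _); rewrite ?expr0 ?expr1 /=; lra.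
rewrite ExZr ExB Ex_cst (Ex_fpow_prod (fun k => bern (parity_prob01 j k)) F).
congr ((1 - _) / 2).
rewrite (eq_bigr (fun k => if phi k x != phi k y then expR (- (2 * (wt k / width j))) else 1)).
  rewrite -big_mkcond -expR_sum sumrN; congr (expR (- _)).
  by rewrite /cutd mulr_suml mulr_sumr.
by move=> k _; rewrite Ex_bern /F; case: (phi k x != phi k y); rewrite /= /parity_prob; lra.
Qed.

Lemma psi_le j x y : psi j x y <= D x y / width j.
Proof. have := expR_ge1Dx (- (2 * (D x y / width j))); rewrite /psi; lra. Qed.

Lemma psi_ge j x y : D x y <= width j -> D x y / width j <= 3 * psi j x y.
Proof.
move=> Dw; set z := D x y / width j; rewrite /psi -/z.
have z0 : 0 <= z by rewrite divr_ge0 ?cutd_ge0 // ltW // width_gt0.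
have z1 : z <= 1 by rewrite ler_pdivrMr ?width_gt0 // mul1r.
have e1 := expR_ge1Dx (2 * z).
have e2 : (expR (2 * z))^-1 <= (1 + 2 * z)^-1 by rewrite lef_pV2 ?posrE ?expR_gt0 //; lra.
have e3 : 1 - (1 + 2 * z)^-1 = 2 * z / (1 + 2 * z) by field; rewrite gt_eqF //; lra.
have e4 : 2 * z / 3 <= 2 * z / (1 + 2 * z).
  by rewrite ler_wpM2l ?lef_pV2 ?posrE //; lra.
rewrite expRN; lra.
Qed.

Definition trial := (scales label H * {ffun K -> bool})%type.
Definition trial_dist (j : nat) : fdist R trial :=
  fprod (scales_dist R label B_ge) (parity_dist j).

(** A random function on all sets of grid points: it belongs to the random string, and only its
    short values ever reach the memory. *)
Definition hashing := {ffun {set P} -> node_id}.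

Lemma node_id_gt0 : (0 < #|{: beta.-tuple bool}|)%N.
Proof. by rewrite card_tuple expn_gt0 card_bool. Qed.

Definition hash_dist : fdist R hashing := fpow (fun=> unif R node_id_gt0).

Definition trials := {ffun 'I_L * 'I_m -> trial}.
Definition trials_dist : fdist R trials := fpow (fun js : 'I_L * 'I_m => trial_dist js.1).

Definition coins := (cuts K L * (hashing * trials))%type.
Definition coins_dist : fdist R coins :=
  fprod (tree_dist wt_ge0 L r0_gt0) (fprod hash_dist trials_dist).

(** A set of grid points fixed by the coins alone, independently of the data, so that its name can
    be computed at each update. *)
Definition bucket (w : cuts K L) i x : {set P} := [set z | sb phi i x z w].
Definition nid (w : coins) i x : node_id := w.2.1 (bucket w.1 i x).

Definition counter1 := ('I_L * 'I_m * option 'I_(beta + beta))%type.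
Definition counter2 := ('I_L * 'I_m * (bool * bool))%type.

Definition weight1 (w : coins) (q : counter1) (side : bool) (x : P) : int :=
  let: (j, s, o) := q in let v := lab (nid w) j x in
  (scale_val ((w.2.2 (j, s)).1 v))%:Z *
  (if o is Some b then (label_bit b v)%:Z else 1) * (if side then -1 else 1).

Definition decoded (c1 : counter1 -> int) (j : 'I_L) (s : 'I_m) : option label :=
  decode label_bit (c1 (j, s, None)) (fun o => c1 (j, s, Some o)).

(* The flag [inside] selects the decoded bucket or the rest of its parent. *)
Definition weight2 (w : coins) (c1 : counter1 -> int) (q : counter2) (side : bool) (x : P) : int :=
  let: (j, s, (inside, b)) := q in
  if decoded c1 j s is Some v then
    ((if inside then lab (nid w) j x == v
      else (nid w j x == v.2) && (lab (nid w) j x != v)) &&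
     (parity (w.2.2 (j, s)).2 x == b))%:Z
  else 0.

Definition sketch (C : Type) (weight : C -> bool -> P -> int) (a b : P -> nat) (q : C) : int :=
  \sum_x (weight q false x * (a x)%:Z + weight q true x * (b x)%:Z).

(** From the sizes of the two parity classes inside a bucket and in the rest of its parent, the
    numerator counts the inside-outside pairs that the parity separates. It is [edge_weight] with
    [D] replaced by that indicator. *)
Definition split_ratio (i0 i1 o0 o1 : R) : R :=
  (i0 * o1 + i1 * o0) / ((i0 + i1) * (i0 + i1 + (o0 + o1))).

Definition trial_score (c2 : counter2 -> int) (j : 'I_L) (s : 'I_m) : R :=
  let c i b := (c2 (j, s, (i, b)))%:~R in
  split_ratio (c true false) (c true true) (c false false) (c false true).

Definition hit_freq (c1 : counter1 -> int) (j : 'I_L) (k : 'I_Kt.+1) : R :=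
  m%:R^-1 * \sum_(s < m) ((2 ^+ k : R) <= `|c1 (j, s, None)|%:~R)%R%:R.

Definition score_freq (c1 : counter1 -> int) (c2 : counter2 -> int) (j : 'I_L) (k : 'I_Kt.+1) : R :=
  m%:R^-1 * \sum_(s < m) ((2 ^+ k : R) <= `|c1 (j, s, None)|%:~R)%R%:R * trial_score c2 j s.

(** Scores measure edge weights in units of [width] and lose at most the factor 3 of [psi_ge], which
    is restored here so that the estimate errs upwards. *)
Definition estimate (c1 : counter1 -> int) (c2 : counter2 -> int) : R :=
  \sum_(j < L) 3 * width j * level_estimate B (hit_freq c1 j) (score_freq c1 c2 j) dl.

(** * Failure probability on a fixed input *)

Section FixedInput.
Variables (A0 B0 : seq P).
Let a x := count_mem x A0.
Let b x := count_mem x B0.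

Definition mult x : R := (a x + b x)%:R.
Definition flow (w : coins) (j : nat) (v : label) : int :=
  \sum_(x | lab (nid w) j x == v) ((a x)%:Z - (b x)%:Z).

Let c1 w := sketch (weight1 w) a b.
Let c2 w := sketch (weight2 w (c1 w)) a b.

Lemma count_sum_mult (p : pred P) (s : seq P) : count p s = (\sum_(x | p x) count_mem x s)%N.
Proof.
elim: s => [|y s IH] /=; first by rewrite big1.
rewrite big_split /= -IH; congr (_ + _)%N.
rewrite big_mkcond (bigD1 y) //= eqxx big1 ?addn0; first by case: (p y).
by move=> x /negPf xy; rewrite eq_sym xy; case: (p x).
Qed.

Lemma flowE w j v : (flow w j v)%:~R = imbalance R (nid w) j A0 B0 v.
Proof.
rewrite /flow /imbalance !count_sum_mult sumrB intrB.
by congr (_ - _); rewrite natr_sum (big_morph (fun z : int => z%:~R : R) (intrD R) (mulr0z 1)).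
Qed.

Lemma c1_counter w j s : c1 w (j, s, None) = counter (flow w j) (w.2.2 (j, s)).1.
Proof.
rewrite /c1 /sketch /counter (partition_big (lab (nid w) j) predT) //=.
apply: eq_bigr => v _; rewrite /flow mulr_sumr; apply: eq_bigr => x /eqP ->; ring.
Qed.

Lemma c1_bit_counter w j s o :
  c1 w (j, s, Some o) = bit_counter label_bit (flow w j) (w.2.2 (j, s)).1 o.
Proof.
rewrite /c1 /sketch /bit_counter (partition_big (lab (nid w) j) predT) //=.
apply: eq_bigr => v _; rewrite /flow mulr_sumr mulr_suml; apply: eq_bigr => x /eqP ->; ring.
Qed.

Definition label_score (w : coins) (j : nat) (v : label) (h : {ffun K -> bool}) : R :=
  let i b := \sum_(x | parity h x == b) inw mult (nid w) j v x in
  let o b := \sum_(x | parity h x == b) outw mult (nid w) j v x in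
  split_ratio (i false) (i true) (o false) (o true).

Lemma trial_scoreE w (j : 'I_L) (s : 'I_m) : trial_score (c2 w) j s =
  if decode label_bit (counter (flow w j) (w.2.2 (j, s)).1)
       (bit_counter label_bit (flow w j) (w.2.2 (j, s)).1) is Some v
  then label_score w j v (w.2.2 (j, s)).2 else 0.
Proof.
have dE : decoded (c1 w) j s = decode label_bit (counter (flow w j) (w.2.2 (j, s)).1)
       (bit_counter label_bit (flow w j) (w.2.2 (j, s)).1).
  rewrite /decoded c1_counter /decode; apply: eq_pick => v.
  by apply: eq_forallb => o; rewrite c1_bit_counter.
rewrite -dE; case E : (decoded (c1 w) j s) => [v|]; last first.
  have c0 i b' : c2 w (j, s, (i, b')) = 0.
    by rewrite /c2 /sketch big1 // => x _; rewrite /weight2 E !mul0r.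
  by rewrite /trial_score /= !c0 /split_ratio mulr0z !mul0r addr0 mul0r.
have mapsum (Q : pred P) : (\sum_x ((Q x)%:Z * (a x)%:Z + (Q x)%:Z * (b x)%:Z))%:~R =
    \sum_x mult x * (Q x)%:R :> R.
  rewrite (big_morph (fun z : int => z%:~R : R) (intrD R) (mulr0z 1)).
  apply: eq_bigr => x _; rewrite -mulrDr intrM mulrC -PoszD -!pmulrn.
  by [].
rewrite /trial_score /label_score /=; congr split_ratio; rewrite /c2 /sketch /weight2 E /=
  (mapsum (fun x => _ && _)) [RHS]big_mkcond; apply: eq_bigr => x _;
  rewrite /inw /outw; case: (parity _ x == _); rewrite ?andbT ?andbF ?mulr0 //.
Qed.

Definition mean_score (w : coins) (j : nat) (v : label) : R :=
  (\sum_x \sum_y inw mult (nid w) j v x * outw mult (nid w) j v y * psi j x y) /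
  (inN mult (nid w) j v * (inN mult (nid w) j v + outN mult (nid w) j v)).

Let mult_ge0 x : 0 <= mult x.
Proof. by []. Qed.

Lemma label_scoreE w j v h : label_score w j v h =
  (\sum_x \sum_y inw mult (nid w) j v x * outw mult (nid w) j v y *
     (parity h x != parity h y)%:R) /
  (inN mult (nid w) j v * (inN mult (nid w) j v + outN mult (nid w) j v)).
Proof.
have split (F : P -> R) : \sum_x F x =
    \sum_(x | parity h x == false) F x + \sum_(x | parity h x == true) F x.
  rewrite (bigID (fun x => parity h x == false)) /=; congr (_ + _).
  by apply: eq_bigl => x; case: (parity h x).
rewrite /label_score /split_ratio /inN /outN -!split; congr (_ / _).
rewrite [RHS]split; congr (_ + _); rewrite mulr_suml; apply: eq_bigr => x /eqP px;
  rewrite mulr_sumr [LHS]big_mkcond; apply: eq_bigr => y _; rewrite px;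
  by case: (parity h y); rewrite /= ?mulr1 ?mulr0.
Qed.

Lemma Ex_label_score w j v : Ex (parity_dist j) (label_score w j v) = mean_score w j v.
Proof.
rewrite (eq_Ex _ (label_scoreE w j v)) ExZr Ex_sum; congr (_ / _).
apply: eq_bigr => x _; rewrite Ex_sum; apply: eq_bigr => y _.
by rewrite ExZl Ex_parity.
Qed.

Lemma label_score01 w j v h : 0 <= label_score w j v h <= 1.
Proof.
have p0 x : 0 <= inw mult (nid w) j v x by apply: inw_ge0.
have q0 x : 0 <= outw mult (nid w) j v x by apply: outw_ge0.
rewrite label_scoreE; set N := inN _ _ _ _; set M := outN _ _ _ _.
have N0 : 0 <= N by apply: sumr_ge0.
have M0 : 0 <= M by apply: sumr_ge0.
have S0 : 0 <= \sum_x \sum_y inw mult (nid w) j v x * outw mult (nid w) j v y *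
     (parity h x != parity h y)%:R.
  by apply: sumr_ge0 => x _; apply: sumr_ge0 => y _; rewrite !mulr_ge0.
rewrite divr_ge0 ?mulr_ge0 ?addr_ge0 //=.
have := mulr_ge0 N0 (addr_ge0 N0 M0); rewrite le_eqVlt => /predU1P[<-|NM].
  by rewrite invr0 mulr0.
rewrite ler_pdivrMr // mul1r.
apply: le_trans (_ : N * M <= _); last by rewrite ler_wpM2l // lerDr.
rewrite /N /inN mulr_suml; apply: ler_sum => x _; rewrite /M /outN mulr_sumr.
by apply: ler_sum => y _; rewrite ler_piMr ?mulr_ge0 // lern1 leq_b1.
Qed.

Lemma mean_score01 w j v : 0 <= mean_score w j v <= 1.
Proof.
rewrite -Ex_label_score; apply/andP; split.
  by apply: Ex_ge0 => h; case/andP: (label_score01 w j v h).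
by apply: Ex_le => h; case/andP: (label_score01 w j v h).
Qed.

Lemma mean_score_le w j v :
  width j * mean_score w j v <= edge_weight D mult (nid w) j v.
Proof.
rewrite /mean_score mulrA ler_wpM2r ?invr_ge0 ?mulr_ge0 ?addr_ge0 ?inN_ge0 ?outN_ge0 //.
rewrite mulr_sumr; apply: ler_sum => x _; rewrite mulr_sumr; apply: ler_sum => y _.
rewrite mulrCA ler_wpM2l ?mulr_ge0 ?inw_ge0 ?outw_ge0 //.
rewrite mulrC -ler_pdivlMr ?width_gt0 //; exact: psi_le.
Qed.

Lemma mean_score_ge w j v :
  (forall x y, 0 < inw mult (nid w) j v x -> 0 < outw mult (nid w) j v y -> D x y <= width j) ->
  edge_weight D mult (nid w) j v <= 3 * width j * mean_score w j v.
Proof.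
move=> near; rewrite /mean_score mulrA.
rewrite ler_wpM2r ?invr_ge0 ?mulr_ge0 ?addr_ge0 ?inN_ge0 ?outN_ge0 //.
rewrite mulr_sumr; apply: ler_sum => x _; rewrite mulr_sumr; apply: ler_sum => y _.
have [px|px] := boolP (0 < inw mult (nid w) j v x); last first.
  have -> : inw mult (nid w) j v x = 0.
    by apply/eqP; rewrite eq_le inw_ge0 // andbT leNgt.
  by rewrite !mul0r mulr0.
have [qy|qy] := boolP (0 < outw mult (nid w) j v y); last first.
  have -> : outw mult (nid w) j v y = 0.
    by apply/eqP; rewrite eq_le outw_ge0 // andbT leNgt.
  by rewrite mulr0 !mul0r mulr0.
rewrite [leRHS]mulrCA ler_wpM2l ?mulr_ge0 ?inw_ge0 ?outw_ge0 //.
have := psi_ge (near _ _ px qy); rewrite ler_pdivrMr ?width_gt0 //; nra.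
Qed.

Hypothesis szAB : size A0 = size B0.
Hypotheses (D_le_r0 : forall x y, D x y <= r0) (D_ge1 : forall x y, x != y -> 1 <= D x y).
Hypotheses (L_gt0 : (0 < L)%N) (fine : tau * radius r0 L.-1 < 1).
Hypotheses (KtH : (Kt < H)%N) (nKt : (size A0 + size B0 <= 2 ^ Kt)%N).
Hypotheses (dl_gt0 : 0 < dl) (dlB : dl <= (64 * B%:R)^-1).
Let eps : R := 40 * H.+1%:R ^+ 2 / B%:R + 1024 * H.+1%:R * B%:R * dl.
Hypothesis epsL : 6 * tau * eps <= L%:R^-1.
Hypotheses (m_gt0 : (0 < m)%N)
  (m_large : (L * Kt.+1)%:R * (2 / (m%:R * dl ^+ 2)) <= 64^-1).
Let N : R := (size A0 + size B0)%:R.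
Hypotheses (far_small : L%:R * (N * N * expR (- tau)) <= 64^-1)
  (coll_small : L.+1%:R * (N * N / 2 ^+ beta) <= 64^-1).
Variable M : seq (P * P).
Hypotheses (MA : perm_eq (unzip1 M) A0) (MB : perm_eq (unzip2 M) B0).

Let S x := 0 < mult x.

Let memS x : S x = (x \in A0) || (x \in B0).
Proof. by rewrite /S /mult ltr0n addn_gt0 /a /b -!has_count !has_pred1. Qed.

Let mult_ge1 x : S x -> 1 <= mult x.
Proof. by rewrite /S /mult ltr0n ler1n. Qed.

Let sum_mult : \sum_x mult x = N.
Proof. by rewrite /N /mult -natr_sum big_split /= /a /b -!(count_sum_mult predT) !count_predT. Qed.

Let card_S : (\sum_(x | S x) 1 <= N).
Proof.
rewrite -sum_mult big_mkcond; apply: ler_sum => x _.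
by case: ifP => // /mult_ge1.
Qed.

Definition far (w : cuts K L) := [exists u : 'I_L * (P * P),
  [&& S u.2.1, S u.2.2, sb phi u.1.+1 u.2.1 u.2.2 w & tau * radius r0 u.1 < D u.2.1 u.2.2]].

Definition collision (w : cuts K L * hashing) := [exists u : 'I_L.+1 * (P * P),
  [&& S u.2.1, S u.2.2, bucket w.1 u.1 u.2.1 != bucket w.1 u.1 u.2.2 &
    w.2 (bucket w.1 u.1 u.2.1) == w.2 (bucket w.1 u.1 u.2.2)]].

(** Union bounds run over pairs of data points only, at most [N * N] of them, instead of all pairs
    of grid points. *)
Let sum_pairs (I : finType) (z : R) (F : I * (P * P) -> R) : 0 <= z ->
  (forall u, F u <= (S u.2.1 && S u.2.2)%:R * z) -> \sum_u F u <= #|I|%:R * (N * N * z).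
Proof.
move=> z0 Fz; apply: le_trans (ler_sum _ (fun u _ => Fz u)) _.
rewrite -(pair_bigA _ (fun (i : I) (xy : P * P) => (S xy.1 && S xy.2)%:R * z)) /=.
rewrite sumr_const -(mulr_natl _ #|I|) ler_wpM2l //.
rewrite -(pair_bigA _ (fun x y => (S x && S y)%:R * z)) /=.
apply: le_trans (_ : (\sum_(x | S x) 1) * (\sum_(x | S x) 1) * z <= _); last first.
  by rewrite ler_wpM2r // ler_pM ?sumr_ge0.
rewrite mulr_suml mulr_suml [leRHS]big_mkcond; apply: ler_sum => x _.
case: (S x) => /=; last by rewrite big1 // => y _; rewrite mul0r.
rewrite mul1r mulr_suml [leRHS]big_mkcond; apply: ler_sum => y _.
by case: (S y); rewrite ?mul1r ?mul0r.
Qed.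

Lemma Pr_far : Pr (tree_dist wt_ge0 L r0_gt0) far <= 64^-1.
Proof.
apply: le_trans far_small; rewrite -[L in L%:R]card_ord.
apply: le_trans (Pr_exists _ _) _; apply: sum_pairs; first exact: expR_ge0.
move=> [j [x y]] /=; case: (S x) (S y) => [] [] /=;
  try by rewrite mul0r; apply: Ex_le => w; rewrite /= ?andbF.
rewrite mul1r; case: (ltP (tau * radius r0 j) (D x y)) => fr; last first.
  apply: le_trans (expR_ge0 _); apply: Ex_le => w /=.
  by rewrite andbF.
apply: le_trans (ler_Pr _ (F := sb phi j.+1 x y) _) _; first by move=> w /andP[].
have j0L : (0 < j.+1 <= L)%N by rewrite ltn_ord.
apply: le_trans (Pr_sb_le phi wt_ge0 r0_gt0 x y j0L) _.
by rewrite ler_expR lerN2 /= ler_pdivlMr ?radius_gt0 // ltW.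
Qed.

Lemma Pr_collision w0 : Pr hash_dist (fun chi => collision (w0, chi)) <= 64^-1.
Proof.
apply: le_trans coll_small; have -> : L.+1%:R = #|'I_L.+1|%:R :> R by rewrite card_ord.
apply: le_trans (Pr_exists _ _) _; apply: sum_pairs; first by rewrite invr_ge0 exprn_ge0.
move=> [i [x y]] /=; case: (S x) (S y) => [] [] /=;
  try by rewrite mul0r; apply: Ex_le => chi; rewrite /= ?andbF.
rewrite mul1r; set u := bucket w0 i x; set v := bucket w0 i y.
case: (eqVneq u v) => uv /=.
  by apply: le_trans (_ : 0 <= _); [apply: Ex_le => chi|rewrite invr_ge0 exprn_ge0].
rewrite /Pr (eq_Ex _ (Y := fun chi : hashing => \sum_(c : node_id) (chi u == c)%:R * (chi v == c)%:R)).
  rewrite Ex_sum (eq_bigr (fun=> (2 ^+ beta)^-1 * (2 ^+ beta)^-1)) => [|c _].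
    rewrite sumr_const card_tuple card_bool -(mulr_natl _ (2 ^ beta)) natrX mulrA.
    by rewrite divff ?mul1r // expf_neq0.
  rewrite (@Ex_fpow_indep2 _ _ _ (fun=> unif R node_id_gt0) u v
    (fun t => (t == c)%:R) (fun t => (t == c)%:R)) //.
  have -> : Ex (unif R node_id_gt0) (fun t => (t == c)%:R) = (2 ^+ beta)^-1.
    rewrite /Ex (bigD1 c) //= eqxx mulr1 big1 ?addr0 => [|t /negPf->]; last by rewrite mulr0.
    by rewrite /unif_fun card_tuple card_bool natrX.
  by [].
move=> chi; rewrite (bigD1 (chi u)) //= eqxx mul1r big1 ?addr0 => [|c /negPf cu].
  by rewrite eq_sym.
by rewrite eq_sym cu mul0r.
Qed.

Let p_ w (j : 'I_L) (k : 'I_Kt.+1) : R :=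
  Ex (scales_dist R label B_ge) (hit (flow w j) (2 ^+ k : R)).
Let e_ w (j : 'I_L) (k : 'I_Kt.+1) : R :=
  Ex (scales_dist R label B_ge) (score label_bit (flow w j) (2 ^+ k : R) (mean_score w j)).

Definition deviation (w : coins) := [exists jk : 'I_L * 'I_Kt.+1,
  (dl <= `|hit_freq (c1 w) jk.1 jk.2 - p_ w jk.1 jk.2|) ||
  (dl <= `|score_freq (c1 w) (c2 w) jk.1 jk.2 - e_ w jk.1 jk.2|)].

Lemma Pr_deviation w0 chi : Pr trials_dist (fun t => deviation (w0, (chi, t))) <= 64^-1.
Proof.
apply: le_trans m_large; apply: le_trans (Pr_exists _ _) _.
have -> : (L * Kt.+1)%:R * (2 / (m%:R * dl ^+ 2)) =
    \sum_(jk : 'I_L * 'I_Kt.+1) 2 / (m%:R * dl ^+ 2).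
  by rewrite sumr_const -(mulr_natl (2 / _)) card_prod !card_ord.
apply: ler_sum => -[j k] _; apply: le_trans (Pr_or _ _ _) _ => /=.
have -> : 2 / (m%:R * dl ^+ 2) = (m%:R * dl ^+ 2)^-1 + (m%:R * dl ^+ 2)^-1 by ring.
(* Flows and label scores depend on the tree and the hashing only, so a dummy value can stand for
   the trials. *)
pose t0 : trials := [ffun=> ([ffun=> None], [ffun=> false])].
pose f := flow (w0, (chi, t0)) j.
have qinj : injective (fun s : 'I_m => (j, s)) by move=> s s' [].
have dec01 (y : label -> R) (o : option label) : (forall v, 0 <= y v <= 1) ->
    0 <= (if o is Some v then y v else 0) <= 1.
  by move=> y01; case: o => [v|]; [apply: y01|rewrite lexx ler01].
have fE t : flow (w0, (chi, t)) j = f by [].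
have cheb (X : trial -> R) (F e : trials -> R) :
    (forall t, 0 <= X t <= 1) -> (forall t, e t = Ex (trial_dist j) X) ->
    (forall t, F t = m%:R^-1 * \sum_(s < m) X (t (j, s))) ->
    Pr trials_dist (fun t => dl <= `|F t - e t|) <= (m%:R * dl ^+ 2)^-1.
  move=> X01 Xe FX.
  have h := @chebyshev_mean R _ _ (fun js : 'I_L * 'I_m => trial_dist js.1) m
    (fun s => (j, s)) X (Ex (trial_dist j) X) dl qinj X01 (fun s => erefl) dl_gt0 m_gt0.
  by apply: le_trans h; apply: ler_Pr => t; rewrite FX Xe.
apply: lerD.
- apply: (cheb (fun t => hit f (2 ^+ k : R) t.1)
    (fun t => hit_freq (c1 (w0, (chi, t))) j k) (fun t => p_ (w0, (chi, t)) j k)).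
  + by move=> t; apply: hit01.
  + by move=> t; rewrite Ex_prod /p_ fE; apply: eq_Ex => rho; rewrite /= Ex_cst.
  + move=> t; rewrite /hit_freq; congr (_ * _); apply: eq_bigr => s _.
    by rewrite c1_counter fE.
- apply: (cheb (fun t => hit f (2 ^+ k : R) t.1 *
    (if decode label_bit (counter f t.1) (bit_counter label_bit f t.1) is Some v
    then label_score (w0, (chi, t0)) j v t.2 else 0))
    (fun t => score_freq (c1 (w0, (chi, t))) (c2 (w0, (chi, t))) j k)
    (fun t => e_ (w0, (chi, t)) j k)).
  + move=> t; have [y0 y1] := andP (dec01 _ (decode label_bit (counter f t.1)
      (bit_counter label_bit f t.1)) (fun v => label_score01 (w0, (chi, t0)) j v t.2)).
    have [h0 h1] := andP (hit01 f (2 ^+ k : R) t.1).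
    by rewrite mulr_ge0 // mulr_ile1.
  + move=> t; rewrite Ex_prod /e_ fE; apply: eq_Ex => rho; rewrite /= ExZl /score; congr (_ * _).
    by case: (decode _ _ _) => [v|]; rewrite ?Ex_label_score ?Ex_cst.
  + move=> t; rewrite /score_freq; congr (_ * _); apply: eq_bigr => s _.
    by rewrite c1_counter trial_scoreE fE.
Qed.

(** 96 = 3 * 32 combines the 3 of [estimate] with the 32 of [level_estimateP]. The last term is the
    additive error [6 * tau * eps * r_j <= r_j / L], once for each of the two labels. *)
Definition pair_charge (w : cuts K L) (ab : P * P) : R :=
  \sum_(j < L) (sep phi j.+1 ab.1 ab.2 w)%:R *
    (96 * ((avgd phi wt mult j ab.1 w + avgd phi wt mult j.+1 ab.1 w) +
           (avgd phi wt mult j ab.2 w + avgd phi wt mult j.+1 ab.2 w)) +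
     L%:R^-1 * (2 * radius r0 j)).

Definition matching_charge (w : cuts K L) : R := \sum_(ab <- M) pair_charge w ab.

(** Each endpoint costs 96 times the [24 * ln N + 1] of [tree_cost_pair]; the remaining 4 is [2 / L]
    times the [2 * L] of [sum_radius_sep]. *)
Definition charge_bound : R := (4608 * ln N + 196) * \sum_(ab <- M) D ab.1 ab.2.

Let Mmem ab : ab \in M -> S ab.1 /\ S ab.2.
Proof.
move=> abM; split; rewrite memS.
  by rewrite -(perm_mem MA) (map_f fst abM).
by rewrite -(perm_mem MB) (map_f snd abM) orbT.
Qed.

Lemma Ex_matching_charge :
  Ex (tree_dist wt_ge0 L r0_gt0) matching_charge <= charge_bound.
Proof.
rewrite /matching_charge Ex_sum /charge_bound mulr_sumr big_seq [leRHS]big_seq.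
apply: ler_sum => -[x y] /Mmem[/mult_ge1 /= Sx /mult_ge1 Sy].
have cx := tree_cost_pair wt_ge0 L r0_gt0 y mult_ge0 Sx D_le_r0.
have cy := tree_cost_pair wt_ge0 L r0_gt0 x mult_ge0 Sy D_le_r0.
have cr := sum_radius_sep phi wt_ge0 L r0_gt0 x y.
rewrite sum_mult in cx cy; rewrite (cutdC phi wt y x) in cy.
rewrite (eq_Ex _ (Y := fun w => 96 * (\sum_(j < L) (sep phi j.+1 x y w)%:R *
      (avgd phi wt mult j x w + avgd phi wt mult j.+1 x w)) +
    96 * (\sum_(j < L) (sep phi j.+1 y x w)%:R *
      (avgd phi wt mult j y w + avgd phi wt mult j.+1 y w)) +
    2 * L%:R^-1 * \sum_(j < L) radius r0 j * (sep phi j.+1 x y w)%:R)); last first.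
  move=> w; rewrite /pair_charge !mulr_sumr -!big_split; apply: eq_bigr => j _ /=.
  by rewrite /sep (sbC _ _ y x); ring.
rewrite !ExD !ExZl; have L0 : 0 < L%:R :> R by rewrite ltr0n.
have cr' : 2 * L%:R^-1 * Ex (tree_dist wt_ge0 L r0_gt0)
    (fun w => \sum_(j < L) radius r0 j * (sep phi j.+1 x y w)%:R) <= 4 * D x y.
  apply: le_trans (ler_wpM2l _ cr) _; first by rewrite mulr_ge0 ?invr_ge0.
  by rewrite le_eqVlt; apply/orP; left; apply/eqP; field; rewrite gt_eqF.
lra.
Qed.

Lemma Pr_charge : Pr (tree_dist wt_ge0 L r0_gt0)
  (fun w => 64 * charge_bound < matching_charge w) <= 64^-1.
Proof.
have T0 w : 0 <= matching_charge w.
  rewrite /matching_charge big_seq; apply: sumr_ge0 => ab /Mmem[/mult_ge1 Sx /mult_ge1 Sy].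
  apply: sumr_ge0 => j _; rewrite mulr_ge0 // addr_ge0 //.
    apply: mulr_ge0; first exact: ler0n.
    by apply: addr_ge0; apply: addr_ge0; apply: avgd_ge0.
  by rewrite !mulr_ge0 ?invr_ge0 // ltW // radius_gt0.
have ET := Ex_matching_charge.
have : 0 <= charge_bound by apply: le_trans ET; apply: Ex_ge0.
(* Markov needs a positive bound. If it is 0, the nonnegative charge has mean 0 and vanishes on
   every outcome of positive probability, and the event is a strict inequality. *)
rewrite le_eqVlt => /predU1P[c0|c0].
  apply: le_trans (_ : 0 <= _); last by rewrite invr_ge0.
  rewrite /Pr /Ex big1 // => w _.
  have : \sum_w' tree_dist wt_ge0 L r0_gt0 w' * matching_charge w' == 0.
    rewrite eq_le; apply/andP; split; first by move: ET; rewrite -c0.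
    by apply: sumr_ge0 => w' _; rewrite mulr_ge0 ?fd_ge0.
  rewrite psumr_eq0 => [/allP/(_ w)|w' _]; last by rewrite mulr_ge0 ?fd_ge0.
  rewrite mem_index_enum => /(_ isT); rewrite mulf_eq0 => /orP[/eqP->|/eqP->].
    by rewrite mul0r.
  by rewrite -c0 mulr0 ltxx mulr0.
apply: le_trans (ler_Pr _ (F := fun w => 64 * charge_bound <= matching_charge w) _) _.
  by move=> w /ltW.
apply: le_trans (markov_fin _ T0 _) _; first by rewrite mulr_gt0.
rewrite ler_pdivrMr; last by apply: mulr_gt0.
rewrite mulrA mulVf ?mul1r; first exact: ET.
by rewrite pnatr_eq0.
Qed.

Definition bad (w : coins) : bool :=
  [|| far w.1, collision (w.1, w.2.1), deviation w |
      64 * charge_bound < matching_charge w.1].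

Lemma Pr_bad : Pr coins_dist bad <= 16^-1.
Proof.
have h1 : Pr coins_dist (fun w => far w.1) <= 64^-1.
  rewrite /Pr Ex_prod; apply: le_trans Pr_far.
  by apply: ler_Ex => w; rewrite /= Ex_cst.
have h2 : Pr coins_dist (fun w => collision (w.1, w.2.1)) <= 64^-1.
  rewrite /Pr Ex_prod; apply: Ex_le => w; rewrite Ex_prod.
  apply: le_trans (Pr_collision w); by apply: ler_Ex => chi; rewrite /= Ex_cst.
have h3 : Pr coins_dist deviation <= 64^-1.
  rewrite /Pr Ex_prod; apply: Ex_le => w; rewrite Ex_prod; apply: Ex_le => chi.
  exact: Pr_deviation.
have h4 : Pr coins_dist (fun w => 64 * charge_bound < matching_charge w.1) <= 64^-1.
  rewrite /Pr Ex_prod; apply: le_trans Pr_charge.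
  by apply: ler_Ex => w; rewrite /= Ex_cst.
rewrite /bad.
apply: le_trans (Pr_or _ _ _) _.
apply: le_trans (lerD h1 (Pr_or _ _ _)) _.
apply: le_trans (lerD (lexx _) (lerD h2 (Pr_or _ _ _))) _.
lra.
Qed.

(** * Two-sided bound for good coins *)

Section GoodCoins.
Variable w : coins.
Hypothesis good : ~~ bad w.

Let notfar j x y : (j < L)%N -> S x -> S y -> sb phi j.+1 x y w.1 -> D x y <= tau * radius r0 j.
Proof.
move=> jL Sx Sy xy; rewrite leNgt; apply/negP => fr.
move: good; rewrite /bad !negb_or => /and4P[/negP nf _ _ _]; apply: nf.
by apply/existsP; exists (Ordinal jL, (x, y)); rewrite /= Sx Sy xy fr.
Qed.

Let bucketP i x y : (bucket w.1 i x == bucket w.1 i y) = sb phi i x y w.1.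
Proof.
apply/eqP/idP => [/setP/(_ y)|xy].
  by rewrite !inE sbxx.
apply/setP => z; rewrite !inE; apply/idP/idP => h.
  by apply: sb_trans h; rewrite sbC.
exact: sb_trans xy h.
Qed.

Let nid_sb i x y : (i <= L)%N -> S x -> S y -> (nid w i x == nid w i y) = sb phi i x y w.1.
Proof.
move=> iL Sx Sy; rewrite -bucketP; apply/idP/idP => [e|/eqP e]; last by rewrite /nid e.
apply: contraT => ne; move: good; rewrite /bad !negb_or => /and4P[_ /negP nc _ _].
exfalso; apply: nc; have iL' : (i < L.+1)%N by [].
by apply/existsP; exists (Ordinal iL', (x, y)); rewrite /= Sx Sy ne e.
Qed.

Let near_width (j : 'I_L) v x y : 0 < inw mult (nid w) j v x -> 0 < outw mult (nid w) j v y ->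
  D x y <= width j.
Proof.
rewrite /inw /outw; case: eqP => [xv|]; last by rewrite mulr0 ltxx.
case: eqP => [yv|]; last by rewrite mulr0 ltxx.
case: eqP => [|_]; first by rewrite mulr0 ltxx.
rewrite !mulr1 => Sx Sy; have xy : sb phi j x y w.1.
  by rewrite -nid_sb // ?(ltnW (ltn_ord j)) // yv -xv.
(* A depth-[j] bucket was last cut at level [j - 1], of twice the radius; the root has no such level
   and uses the diameter. *)
case: (posnP j) => [j0|j0].
  rewrite /width j0 /radius expr0 divr1; apply: le_trans (D_le_r0 x y) _.
  by rewrite ler_peMl ?(ltW r0_gt0) //; move: tau_ge1; lra.
have := @notfar j.-1 x y; rewrite prednK // => /(_ (ltnW (ltn_ord j)) Sx Sy xy).
by rewrite /width (radiusS r0 j.-1) prednK // mulrCA mulrA.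
Qed.

Let f (j : 'I_L) := flow w j.
Let G (j : 'I_L) : R := \sum_v `|f j v|%:~R * mean_score w j v.
Let Sj (j : 'I_L) : R := total R (f j).

Let f_imb (j : 'I_L) v : `|f j v|%:~R = `|imbalance R (nid w) j A0 B0 v| :> R.
Proof. by rewrite -flowE intr_norm. Qed.

Let sum_count_label (j : 'I_L) (s : seq P) :
  \sum_v (count (fun x => lab (nid w) j x == v) s)%:R = (size s)%:R :> R.
Proof.
elim: s => [|x s IH] /=; first by rewrite big1.
under eq_bigr do rewrite natrD.
rewrite big_split /= IH (bigD1 (lab (nid w) j x)) //= eqxx big1 ?addr0 -?natrD //.
by move=> v /negPf; rewrite eq_sym => ->.
Qed.

Let Sj_le (j : 'I_L) : Sj j <= N.
Proof.
rewrite /N natrD -!(sum_count_label j) -big_split; apply: ler_sum => v _ /=.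
by rewrite f_imb; apply: le_trans (ler_normB _ _) _; rewrite !normr_nat.
Qed.

Let abs_ge0 (j : 'I_L) v : 0 <= `|f j v|%:~R :> R.
Proof. by rewrite ler0z. Qed.

Let dev1 (j : 'I_L) k : `|hit_freq (c1 w) j k - p_ w j k| <= dl.
Proof.
move: good; rewrite /bad !negb_or => /and4P[_ _ nd _]; move: nd.
by rewrite negb_exists => /forallP/(_ (j, k)); rewrite negb_or -!ltNge => /andP[/ltW].
Qed.

Let dev2 (j : 'I_L) k : `|score_freq (c1 w) (c2 w) j k - e_ w j k| <= dl.
Proof.
move: good; rewrite /bad !negb_or => /and4P[_ _ nd _]; move: nd.
by rewrite negb_exists => /forallP/(_ (j, k)); rewrite negb_or -!ltNge => /andP[_ /ltW].
Qed.

Let level_bound (j : 'I_L) :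
  G j <= level_estimate B (hit_freq (c1 w) j) (score_freq (c1 w) (c2 w) j) dl
    <= 32 * G j + eps * Sj j.
Proof.
have Bpos : (0 < B)%N by apply: leq_trans B_ge; rewrite muln_gt0.
have S0 : 0 <= Sj j by apply: sumr_ge0.
have ms v := mean_score01 w j v.
have G0 : 0 <= G j by apply: sumr_ge0 => v _; rewrite mulr_ge0 //; case/andP: (ms v).
have GS : G j <= Sj j.
  by apply: ler_sum => v _; rewrite ler_piMr //; case/andP: (ms v).
(* The total imbalance is an integer: either it is 0, no threshold passes and the default estimate 0
   is right, or it is at least 1, as [level_estimateP] requires. *)
have [Sz|Sz] := eqVneq (Sj j) 0.
  have f0 v : f j v = 0.
    move/eqP: Sz; rewrite psumr_eq0 // => /allP/(_ v); rewrite mem_index_enum => /(_ isT).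
    by rewrite intr_eq0 normr_eq0 => /eqP.
  have Gz : G j = 0 by apply/eqP; rewrite eq_le G0 -Sz GS.
  rewrite level_estimate0 // => [|k]; first by rewrite Gz Sz !mulr0 addr0 lexx.
  rewrite /hit_freq big1 ?mulr0 // => s _.
  rewrite c1_counter /counter big1 => [|v _]; last by rewrite -/(f j) f0 mulr0.
  by rewrite normr0 mulr0z leNgt exprn_gt0.
have S1 : 1 <= Sj j.
  have SE : Sj j = (\sum_v `|f j v|)%:~R.
    by rewrite (big_morph (fun z : int => z%:~R : R) (intrD R) (mulr0z 1)).
  rewrite SE ler1z -gtz0_ge1 -(ltr0z R) -SE lt_def Sz /=.
  exact: S0.
have SK : Sj j <= 2 ^+ Kt by apply: le_trans (Sj_le j) _; rewrite /N -natrX ler_nat.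
have T0 (k : nat) : 0 < 2 ^+ k :> R by rewrite exprn_gt0.
have T2 (k : 'I_Kt.+1) : 2 * 2 ^+ k <= 2 ^+ H :> R.
  by rewrite -exprS ler_weXn2l ?ler1n // (leq_trans _ KtH) // ltn_ord.
apply: (level_estimateP (p := p_ w j) (e := e_ w j)) => //.
- by rewrite S1.
- by rewrite G0.
(* Scoring every label 1 turns [score_ge] into a lower bound on the hit probability. *)
- move=> k Sk; have one01 (v : label) : 0 <= (fun=> 1 : R) v <= 1 by rewrite ler01 lexx.
  apply: le_trans (_ : (\sum_v `|f j v|%:~R * 1) / (8 * 2 ^+ k * B%:R) <= _).
    by rewrite (eq_bigr _ (fun v _ => mulr1 _)).
  apply: le_trans (score_ge label_bit_inj B_ge (T0 k) one01 Sk (T2 k)) _.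
  apply: ler_Ex => rho; rewrite /score; have /andP[h0 _] := hit01 (f j) (2 ^+ k : R) rho.
  by rewrite ler_piMr //; case: (decode _ _ _) => [v|]; rewrite ?lexx ?ler01.
- by move=> k; apply: Pr_hit_le.
- by move=> k Sk; apply: (score_ge label_bit_inj B_ge (T0 k) ms Sk (T2 k)).
- by move=> k; apply: (score_le label_bit_inj B_ge (f j) (T0 k) ms).
- by rewrite (ltW dl_gt0).
Qed.

Let W := edge_weight D mult (nid w).

Lemma estimate_ge : exists M' : seq (P * P),
  [/\ perm_eq (unzip1 M') A0, perm_eq (unzip2 M') B0 &
   \sum_(xy <- M') D xy.1 xy.2 <= estimate (c1 w) (c2 w)].
Proof.
have cN x : ~~ S x -> mult x = 0 by rewrite /S lt_def mult_ge0 andbT negbK => /eqP.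
have id0 x y : S x -> S y -> nid w 0 x = nid w 0 y.
  by move=> Sx Sy; apply/eqP; rewrite nid_sb // sb0.
have id_nest j x y : (j < L)%N -> S x -> S y -> nid w j.+1 x = nid w j.+1 y -> nid w j x = nid w j y.
  move=> jL Sx Sy /eqP; rewrite nid_sb // => h; apply/eqP.
  by rewrite nid_sb ?(ltnW jL) //; apply: sb_le h.
have idL x y : S x -> S y -> nid w L x = nid w L y -> x = y.
  move=> Sx Sy /eqP; rewrite nid_sb // => h; apply/eqP/contraT => xy.
  have := @notfar L.-1 x y; rewrite prednK // => /(_ (leqnn L) Sx Sy h).
  by have := D_ge1 xy; move: fine; lra.
have SA x : x \in A0 -> S x by rewrite memS => ->.
have SB x : x \in B0 -> S x by rewrite memS => ->; rewrite orbT.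
have [M' [h1 h2 h3]] := tree_cost_ge_matching (cutd_ge0 phi wt_ge0) (cutdxx phi wt) (cutdC phi wt)
  (cutd_triangle phi wt_ge0) mult_ge0 (fun x Sx => Sx) cN id0 id_nest idL szAB SA SB.
exists M'; split => //; apply: le_trans h3 _.
rewrite /tree_cost /estimate; apply: ler_sum => j _.
have /andP[lb _] := level_bound j.
apply: le_trans (ler_wpM2l _ lb); last by rewrite mulr_ge0 // ltW // width_gt0.
rewrite /G mulr_sumr; apply: ler_sum => v _; rewrite f_imb [leRHS]mulrCA.
by rewrite ler_wpM2l // mean_score_ge // => x y; apply: near_width.
Qed.

Lemma estimate_le : estimate (c1 w) (c2 w) <= 64 * charge_bound.
Proof.
apply: le_trans (_ : matching_charge w.1 <= _); last first.
  by rewrite leNgt; move: good; rewrite /bad !negb_or => /and4P[].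
pose g j v := 96 * W j v + L%:R^-1 * radius r0 j.
have W0 j v : 0 <= W j v.
  by apply: edge_weight_ge0 => // x y; apply: cutd_ge0.
have r_ge0 j : 0 <= L%:R^-1 * radius r0 j by rewrite mulr_ge0 // ltW // radius_gt0.
have g0 j v : 0 <= g j v.
  by apply: addr_ge0 => //; apply: mulr_ge0.
apply: le_trans (_ : tree_cost L (nid w) g A0 B0 <= _).
  rewrite /estimate /tree_cost; apply: ler_sum => j _.
  have /andP[_ lb] := level_bound j.
  have w0 : 0 <= 3 * width j by rewrite mulr_ge0 // ltW // width_gt0.
  apply: le_trans (ler_wpM2l w0 lb) _.
  rewrite /G /Sj /total !mulr_sumr -big_split mulr_sumr; apply: ler_sum => v _ /=.
  rewrite f_imb; set F := `|_|; have F0 : 0 <= F by apply: normr_ge0.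
  have -> : 3 * width j * (32 * (F * mean_score w j v) + eps * F) =
    F * (96 * (width j * mean_score w j v) + 6 * tau * eps * radius r0 j).
    by rewrite /width; ring.
  rewrite ler_wpM2l // /g lerD //.
    by rewrite ler_wpM2l // mean_score_le.
  by rewrite ler_wpM2r // ltW // radius_gt0.
apply: le_trans (@tree_cost_le_matching R P _ L (nid w) g A0 B0 M g0 MA MB) _.
rewrite /matching_charge big_seq [leRHS]big_seq; apply: ler_sum => -[x y] /Mmem[/= Sx Sy].
apply: ler_sum => j _; have jL := ltn_ord j.
have lab_sb : (lab (nid w) j x == lab (nid w) j y) = sb phi j.+1 x y w.1.
  rewrite /lab xpair_eqE !nid_sb //; last exact: ltnW.
  by case h : (sb phi j.+1 x y w.1); rewrite //= (sb_le _ h).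
rewrite lab_sb -/(sep phi j.+1 x y w.1).
rewrite ler_wpM2l // /g /W.
have hx := edge_weight_le_avgd wt_ge0 mult_ge0 nid_sb jL (mult_ge1 Sx).
have hy := edge_weight_le_avgd wt_ge0 mult_ge0 nid_sb jL (mult_ge1 Sy).
by apply: le_trans (lerD (lerD (ler_wpM2l _ hx) (lexx _)) (lerD (ler_wpM2l _ hy) (lexx _))) _; rewrite ?ler0n //; lra.
Qed.

End GoodCoins.

Lemma Pr_estimate (lo hi : R) :
  (forall M' : seq (P * P), perm_eq (unzip1 M') A0 -> perm_eq (unzip2 M') B0 ->
     lo <= \sum_(xy <- M') D xy.1 xy.2) ->
  64 * charge_bound <= hi ->
  Pr coins_dist (fun w => ~~ (lo <= estimate (c1 w) (c2 w) <= hi)) <= 16^-1.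
Proof.
move=> lo_le hi_ge; apply: le_trans Pr_bad; apply: ler_Pr => w; apply: contraR => good.
have [M' [h1 h2 h3]] := estimate_ge good.
by rewrite (le_trans (lo_le _ h1 h2) h3) (le_trans (estimate_le good) hi_ge).
Qed.

End FixedInput.

Lemma sketch_bound (A0 B0 : seq P) (C : Type) (weight : C -> bool -> P -> int) (q : C) (z : nat) :
  (forall side x, `|weight q side x| <= z%:Z) ->
  `|sketch weight (fun x => count_mem x A0) (fun x => count_mem x B0) q| <=
    (z * (size A0 + size B0))%:Z.
Proof.
move=> wz; rewrite /sketch; apply: le_trans (ler_norm_sum _ _ _) _.
rewrite PoszM -!(count_predT) !(count_sum_mult predT) -big_split /=.
rewrite (big_morph Posz PoszD (erefl 0%Z)) mulr_sumr; apply: ler_sum => x _.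
rewrite PoszD mulrDr; apply: le_trans (ler_normD _ _) _.
by rewrite lerD // normrM ler_pM.
Qed.

Lemma weight1_bound w q side x : `|weight1 w q side x| <= (2 ^ H)%N%:Z.
Proof.
case: q => -[j s] o; rewrite /weight1 !normrM.
have s1 : `|if side then -1 else 1 : int| = 1 by case: side.
rewrite s1 mulr1; apply: le_trans (_ : (scale_val ((w.2.2 (j, s)).1 (lab (nid w) j x)))%:Z <= _).
  rewrite -[leRHS]mulr1 ler_wpM2l //; case: o => [ob|] //.
  by case: (label_bit _ _).
rewrite lez_nat /scale_val; case: (_ (lab _ _ _)) => [h|//].
by rewrite leq_exp2l // -ltnS.
Qed.

Lemma weight2_bound w c q side x : `|weight2 w c q side x| <= 1.
Proof.
case: q => -[j s] [i b]; rewrite /weight2; case: (decoded _ _ _) => // v.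
by case: (_ && _).
Qed.

End BaseSketch.

(** * Linear sketches as two-pass algorithms *)

Section CenteredLift.
Variable q : nat.
Hypothesis q_gt0 : (0 < q)%N.

(** The residue's representative of least absolute value. Counters may wrap around along an
    arbitrarily long stream; only the final value has to be small. *)
Definition centered (c : 'Z_(2 ^ q)) : int :=
  xget 0 [set z : int | `|z| * 2 < (2 ^ q)%N%:Z /\ z%:~R = c].

Lemma exp2_gt1 : (1 < 2 ^ q)%N.
Proof. by case: q q_gt0 => // k _; rewrite expnS leq_pmulr // expn_gt0. Qed.

Lemma small_Zp_eq0 (z : int) : `|z| < (2 ^ q)%N%:Z -> z%:~R = 0 :> 'Z_(2 ^ q) -> z = 0.
Proof.
have nat0 (k : nat) : k%:R = 0 :> 'Z_(2 ^ q) -> (k < 2 ^ q)%N -> k = 0%N.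
  by move=> /(congr1 val); rewrite /= val_Zp_nat ?exp2_gt1 // => h kq; rewrite modn_small in h.
case: (intP z) => [//|k|k] kq.
  by rewrite -pmulrn => /nat0/(_ kq).
by rewrite mulrNz => /eqP; rewrite oppr_eq0 => /eqP/nat0/(_ _)->.
Qed.

Lemma centeredK (z : int) : `|z| * 2 < (2 ^ q)%N%:Z -> centered z%:~R = z.
Proof.
move=> zq; rewrite /centered; set Z := (X in xget _ X).
case: (xgetP 0 Z) => [y _ [yq yz]|/(_ z) []]; last by [].
apply/eqP; rewrite -subr_eq0; apply/eqP; apply: small_Zp_eq0; last by rewrite intrB yz subrr.
have := ler_normB y z; move: yq zq; clear; lia.
Qed.

End CenteredLift.

Definition unit_change (T : Type) (u : update T) : int := if is_insertion u then 1 else -1.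

Lemma stream_sum (T : finType) (s : seq (update T)) (a b : T -> nat) (f : bool -> T -> int) :
  (forall x, net_count false s x = (a x)%:Z /\ net_count true s x = (b x)%:Z) ->
  \sum_(u <- s) f (to_B u) (upd_point u) * unit_change u =
  \sum_x (f false x * (a x)%:Z + f true x * (b x)%:Z).
Proof.
move=> sab; transitivity (\sum_x \sum_(u <- s | upd_point u == x) f (to_B u) x * unit_change u).
  rewrite (exchange_big_dep predT) //=; apply: eq_bigr => u _.
  by rewrite (big_pred1 (upd_point u)) // => x; rewrite eq_sym.
apply: eq_bigr => x _; have [<- <-] := sab x; rewrite /net_count !mulr_sumr.
rewrite (bigID (fun u => to_B u == false)) /=; congr (_ + _).
- rewrite [LHS]big_mkcond [RHS]big_mkcond; apply: eq_bigr => u _ /=; rewrite /unit_change.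
  by case: (to_B u); case: (_ == x).
- rewrite [LHS]big_mkcond [RHS]big_mkcond; apply: eq_bigr => u _ /=; rewrite /unit_change.
  by case: (to_B u); case: (_ == x).
Qed.

Lemma bit_encoding (T : finType) (m : nat) : #|T| = (2 ^ m)%N ->
  exists (enc : T -> m.-tuple bool) (dec : m.-tuple bool -> T), cancel enc dec.
Proof.
move=> Tm; have e : #|T| = #|{: m.-tuple bool}| by rewrite card_tuple card_bool.
exists (fun t => enum_val (cast_ord e (enum_rank t))).
exists (fun v => enum_val (cast_ord (esym e) (enum_rank v))).
by move=> t; rewrite enum_valK cast_ordK enum_rankK.
Qed.

(** The first-pass counters stay untouched in memory during the second pass, so that its weights can
    depend on them at every update. Smallness is asked of the final sketches only, not of partial
    sums along the stream. *)
Lemma two_pass_sketch (R : realType) (T J1 J2 W : finType) (V : Type) (mu : fdist R W)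
  (eps : R) (q : nat) (weight1 : W -> J1 -> bool -> T -> int)
  (weight2 : W -> (J1 -> int) -> J2 -> bool -> T -> int)
  (out : W -> (J1 -> int) -> (J2 -> int) -> V) :
  0 < eps -> (0 < q)%N ->
  exists alg : two_pass_algorithm (update T) V,
    mem_bits alg = (q * (#|J1| + #|J2|))%N /\
    forall (a b : T -> nat) (s : seq (update T)) (E : pred V),
      (forall x, net_count false s x = (a x)%:Z /\ net_count true s x = (b x)%:Z) ->
      (forall w j, `|sketch (weight1 w) a b j| * 2 < (2 ^ q)%N%:Z) ->
      (forall w j, `|sketch (weight2 w (sketch (weight1 w) a b)) a b j| * 2 < (2 ^ q)%N%:Z) ->
      Pr mu (fun w => E (out w (sketch (weight1 w) a b)
        (sketch (weight2 w (sketch (weight1 w) a b)) a b))) - eps <=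
      coin_prob R (fun w => E (run alg s w)).
Proof.
move=> eps0 q0; have [m [f fE]] := simulate_by_coins mu eps0.
pose state := ({ffun J1 -> 'Z_(2 ^ q)} * {ffun J2 -> 'Z_(2 ^ q)})%type.
have card_state : #|{: state}| = (2 ^ (q * (#|J1| + #|J2|)))%N.
  by rewrite card_prod !card_ffun card_ord Zp_cast ?exp2_gt1 // -!expnM -expnD mulnDr.
have [enc [dec encK]] := bit_encoding card_state.
pose lift1 (c : state) j := centered (c.1 j).
pose lift2 (c : state) j := centered (c.2 j).
pose step1 w (c : state) (u : update T) : state :=
  ([ffun j => c.1 j + (weight1 w j (to_B u) (upd_point u) * unit_change u)%:~R], c.2).
pose step2 w (c : state) (u : update T) : state :=
  (c.1, [ffun j => c.2 j + (weight2 w (lift1 c) j (to_B u) (upd_point u) * unit_change u)%:~R]).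
exists (@TwoPassAlgorithm (update T) V m (q * (#|J1| + #|J2|)) (fun=> enc ([ffun=> 0], [ffun=> 0]))
  (fun w c u => enc (step1 (f w) (dec c) u)) (fun _ c => c)
  (fun w c u => enc (step2 (f w) (dec c) u)) (fun w c => out (f w) (lift1 (dec c)) (lift2 (dec c)))).
split=> // a b s E sab b1 b2.
apply: le_trans (fE _) _; rewrite le_eqVlt; apply/orP; left; apply/eqP.
congr (_%:R / _); apply: eq_card => w; rewrite !inE; congr (E _).
rewrite /run /=.
have encS (g : state -> update T -> state) (c : state) r :
    foldl (fun c u => enc (g (dec c) u)) (enc c) r = enc (foldl g c r).
  by elim: r c => //= u r IH c; rewrite encK IH.
rewrite !encS encK.
have run1 (c : state) r : foldl (step1 (f w)) c r =
    ([ffun j => c.1 j + (\sum_(u <- r) weight1 (f w) j (to_B u) (upd_point u) * unit_change u)%:~R], c.2).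
  elim: r c => [|u r IH] c /=.
    case: c => c1 c2 /=; congr (_, _); apply/ffunP => j.
    by rewrite ffunE big_nil addr0.
  rewrite IH /=; congr (_, _); apply/ffunP => j.
  by rewrite !ffunE big_cons intrD addrA.
have run2 (c : state) r : foldl (step2 (f w)) c r =
    (c.1, [ffun j => c.2 j +
      (\sum_(u <- r) weight2 (f w) (lift1 c) j (to_B u) (upd_point u) * unit_change u)%:~R]).
  elim: r c => [|u r IH] c /=.
    case: c => c1 c2 /=; congr (_, _); apply/ffunP => j.
    by rewrite ffunE big_nil addr0.
  rewrite IH /=; congr (_, _); apply/ffunP => j.
  by rewrite !ffunE big_cons intrD addrA.
rewrite run2 run1 /=.
have e1 c2 : lift1 ([ffun j => ([ffun=> 0] : {ffun J1 -> 'Z_(2 ^ q)}) j +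
    (\sum_(u <- s) weight1 (f w) j (to_B u) (upd_point u) * unit_change u)%:~R], c2) =
    sketch (weight1 (f w)) a b.
  apply/funext => j; rewrite /lift1 /= !ffunE add0r (stream_sum _ sab).
  rewrite -/(sketch (weight1 (f w)) a b j).
  exact: (centeredK q0 (b1 (f w) j)).
rewrite !e1; congr out; apply/funext => j.
rewrite /lift2 /= !ffunE add0r (stream_sum _ sab).
rewrite -/(sketch (weight2 (f w) (sketch (weight1 (f w)) a b)) a b j).
exact: (esym (centeredK q0 (b2 (f w) j))).
Qed.

(** * Amplification and parameters *)

Lemma median_sketch (R : realType) (T J1 J2 W : finType) (mu : fdist R W)
  (eps : R) (q m0 : nat) (weight1 : W -> J1 -> bool -> T -> int)
  (weight2 : W -> (J1 -> int) -> J2 -> bool -> T -> int)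
  (est : (J1 -> int) -> (J2 -> int) -> R) :
  0 < eps -> (0 < q)%N ->
  exists alg : two_pass_algorithm (update T) R,
    mem_bits alg = (q * (m0 * (#|J1| + #|J2|)))%N /\
    forall (a b : T -> nat) (s : seq (update T)) (lo hi : R),
      (forall x, net_count false s x = (a x)%:Z /\ net_count true s x = (b x)%:Z) ->
      (forall w j, `|sketch (weight1 w) a b j| * 2 < (2 ^ q)%N%:Z) ->
      (forall w j, `|sketch (weight2 w (sketch (weight1 w) a b)) a b j| * 2 < (2 ^ q)%N%:Z) ->
      Pr mu (fun w => ~~ (lo <= est (sketch (weight1 w) a b)
        (sketch (weight2 w (sketch (weight1 w) a b)) a b) <= hi)) <= 16^-1 ->
      1 - (2 ^+ m0)^-1 - eps <= coin_prob R (fun w => lo <= run alg s w <= hi).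
Proof.
move=> eps0 q0; have [med medP] := robust_median R 'I_m0.
pose weight1' (w : {ffun 'I_m0 -> W}) (ij : 'I_m0 * J1) := weight1 (w ij.1) ij.2.
pose weight2' (w : {ffun 'I_m0 -> W}) c (ij : 'I_m0 * J2) :=
  weight2 (w ij.1) (fun j => c (ij.1, j)) ij.2.
pose out (_ : {ffun 'I_m0 -> W}) (c1 : 'I_m0 * J1 -> int) (c2 : 'I_m0 * J2 -> int) :=
  med (fun i => est (fun j => c1 (i, j)) (fun j => c2 (i, j))).
have [alg [mem algP]] := two_pass_sketch (fpow (fun _ : 'I_m0 => mu)) weight1' weight2' out eps0 q0.
exists alg; split; first by rewrite mem !card_prod card_ord -mulnDr.
move=> a b s lo hi sab b1 b2 pbad.
have b1' w j : `|sketch (weight1' w) a b j| * 2 < (2 ^ q)%N%:Z by case: j => i j; apply: b1.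
have b2' w j : `|sketch (weight2' w (sketch (weight1' w) a b)) a b j| * 2 < (2 ^ q)%N%:Z.
  by case: j => i j; apply: b2.
apply: le_trans (algP a b s (fun y => lo <= y <= hi) sab b1' b2').
have := majority_bad 'I_m0 pbad; rewrite card_ord => maj.
rewrite lerB // PrC lerB //; apply: le_trans maj; apply: ler_Pr => w.
apply: contraR => /negbTE few; apply: medP; rewrite ltnNge card_ord; apply/negP => h.
move/negP: few; apply.
pose good i := lo <= est (sketch (weight1 (w i)) a b)
  (sketch (weight2 (w i) (sketch (weight1 (w i)) a b)) a b) <= hi.
change (is_true (#|[pred i | good i]| * 2 <= m0)%N) in h.
change (is_true (m0 <= #|[predC [pred i | good i]]| * 2)%N).
have e := cardC [pred i | good i]; rewrite card_ord in e.
have half (X Y Z : nat) : (X + Y = Z -> X * 2 <= Z -> Z <= Y * 2)%N by lia.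
exact: half e h.
Qed.

Section SketchSizes.
Variables (R : realType) (l : nat).
Hypothesis l_gt0 : (0 < l)%N.
Let x : R := l%:R.

Let x_ge1 : 1 <= x. Proof. by rewrite ler1n. Qed.

Let x_le : x <= 2 ^+ l. Proof. by rewrite /x -natrX ler_nat ltnW // ltn_expl. Qed.

Lemma expRN_le2 (k : nat) : expR (- k%:R) <= (2 ^+ k)^-1 :> R.
Proof.
rewrite expRN lef_pV2 ?posrE ?expR_gt0 ?exprn_gt0 // -[k%:R]mulr_natl mulr1.
rewrite -[k%:R]mulr1 expRM_natl lerXn2r ?nnegrE ?expR_ge0 //.
by have := expR_ge1Dx (1 : R); lra.
Qed.

(** Serves far pairs and hash collisions alike: with [tau = beta = 16 * l] both have probability at
    most [2 ^- (16 * l)] per pair and level. *)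
Lemma level_union_small (N z : R) (k : nat) : 0 <= N <= 2 ^+ l.+1 -> 0 <= z <= (2 ^+ (16 * l))^-1 ->
  (k <= 31 * l)%N -> k%:R * (N * N * z) <= 64^-1.
Proof.
move=> /andP[N0 N1] /andP[z0 z1] kl.
have k1 : k%:R <= 2 ^+ (5 + l) :> R.
  rewrite exprD -natrX; apply: le_trans (_ : (2 ^ 5)%:R * x <= _).
    by rewrite /x -natrM ler_nat (leq_trans kl) // leq_mul2r orbT.
  by rewrite ler_wpM2l.
apply: le_trans (_ : 2 ^+ (5 + l) * (2 ^+ l.+1 * 2 ^+ l.+1 * (2 ^+ (16 * l))^-1) <= _).
  by rewrite ler_pM ?mulr_ge0 // ler_pM ?mulr_ge0 // ler_pM.
rewrite !mulrA ler_pdivrMr ?exprn_gt0 // ler_pdivlMl //.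
have -> : 64 = 2 ^+ 6 :> R by rewrite -natrX.
rewrite -!exprD ler_weXn2l ?ler1n //; move: l_gt0; clear; lia.
Qed.

(** The 30 ensures that the halvings bring [r0], even multiplied by [tau = 16 * l], below the least
    distance 1 between distinct points. *)
Lemma fine_scale : (16 * l)%:R * radius (2 ^+ (2 * l + 15)) (30 * l).-1 < 1 :> R.
Proof.
rewrite /radius mulrA ltr_pdivrMr ?exprn_gt0 // mul1r.
apply: le_lt_trans (_ : 2 ^+ (4 + l) * 2 ^+ (2 * l + 15) < _).
  rewrite ler_wpM2r ?exprn_ge0 // exprD natrM.
  have -> : 16 = 2 ^+ 4 :> R by rewrite -natrX.
  by rewrite ler_wpM2l ?exprn_ge0.
rewrite -exprD ltr_eXn2l ?ltr1n //; move: l_gt0; clear; lia.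
Qed.

(** The additive error must be of order [1 / (tau * L)], that is [l ^ -2]. Its term [H ^ 2 / B]
    forces [B] of order [l ^ 4], its term [H * B * dl] then forces [dl] of order [l ^ -7], and
    Chebyshev over [O(l ^ 2)] events needs [m] of order [l ^ 2 / dl ^ 2], that is [l ^ 16]. *)
Lemma sketch_parameters : exists (B m : nat) (dl : R),
  [/\ (4 * l.+3 <= B)%N, 0 < dl, dl <= (64 * B%:R)^-1,
      6 * (16 * l)%:R * (40 * l.+3%:R ^+ 2 / B%:R + 1024 * l.+3%:R * B%:R * dl) <= (30 * l)%:R^-1 &
   [/\ (0 < m)%N, (30 * l * l.+2)%:R * (2 / (m%:R * dl ^+ 2)) <= 64^-1 &
      m%:R = 2 ^+ 112 * x ^+ 16]].
Proof.
have [cB cBE] : exists k : nat, k%:R = 2 ^+ 24 :> R by exists (2 ^ 24)%N; rewrite natrX.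
have [cm cmE] : exists k : nat, k%:R = 2 ^+ 112 :> R by exists (2 ^ 112)%N; rewrite natrX.
have x0 : 0 < x by apply: lt_le_trans ltr01 x_ge1.
have [g g0 [g1 g2]] : exists2 g : R, g = 2 ^+ 24 & 0 < g /\ g = 4096 * 1024 * 4.
  exists (2 ^+ 24) => //; split; first by apply: exprn_gt0.
  have -> : 24%N = (12 + 10 + 2)%N by [].
  by rewrite !exprD -!natrX.
exists (cB * l ^ 4)%N, (cm * l ^ 16)%N, (2 * g * g * x ^+ 7)^-1.
have BE : (cB * l ^ 4)%:R = g * x ^+ 4 :> R by rewrite natrM cBE natrX g0.
have mE : (cm * l ^ 16)%:R = 2 ^+ 112 * x ^+ 16 :> R by rewrite natrM cmE natrX.
have h4 : l.+3%:R <= 4 * x.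
  by rewrite /x -natrM ler_nat; move: l_gt0; clear; lia.
have lR (k : nat) : 1 <= x ^+ k by apply: exprn_ege1.
split.
- rewrite -(ler_nat R) BE natrM; have := lR 3%N; rewrite (exprS x 3) g2 => l3.
  by apply: le_trans (ler_wpM2l _ h4) _; rewrite // mulrCA; nra.
- by rewrite invr_gt0 !mulr_gt0 ?exprn_gt0.
- rewrite BE lef_pV2 ?posrE ?mulr_gt0 ?exprn_gt0 //.
  have -> : 2 * g * g * x ^+ 7 = g * x ^+ 4 * (2 * g * x ^+ 3) by ring.
  have -> : 64 * (g * x ^+ 4) = g * x ^+ 4 * 64 by ring.
  rewrite ler_wpM2l ?mulr_ge0 ?exprn_ge0 ?(ltW g1) ?(ltW x0) //.
  have := lR 3%N; nra.
- rewrite BE natrM [(30 * l)%:R]natrM -/x.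
  apply: le_trans (_ : 6 * (16 * x) * (40 * (4 * x) ^+ 2 / (g * x ^+ 4) +
      1024 * (4 * x) * (g * x ^+ 4) * (2 * g * g * x ^+ 7)^-1) <= _).
    have gx k : 0 <= g * x ^+ k by rewrite mulr_ge0 ?exprn_ge0 ?(ltW g1) ?(ltW x0).
    have ggx : 0 <= (2 * g * g * x ^+ 7)^-1.
      by rewrite invr_ge0 -mulrA mulr_ge0 // mulr_ge0 // ltW.
    rewrite ler_wpM2l ?mulr_ge0 ?(ltW x0) // lerD //.
      rewrite ler_wpM2r ?invr_ge0 // ler_wpM2l // lerXn2r ?nnegrE //; lra.
    by apply: (ler_wpM2r ggx); apply: (ler_wpM2r (gx 4)); apply: (ler_wpM2l _ h4); exact: ler0n.
  have -> : 6 * (16 * x) * (40 * (4 * x) ^+ 2 / (g * x ^+ 4) +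
      1024 * (4 * x) * (g * x ^+ 4) * (2 * g * g * x ^+ 7)^-1) =
      (96 * 2688 * 30) / g * (30 * x)^-1.
    by field; rewrite ?gt_eqF.
  apply: ler_piMl.
    by rewrite invr_ge0; apply: mulr_ge0; [exact: ler0n|exact: ltW].
  rewrite (ler_pdivrMr _ _ g1) mul1r g2; lra.
split=> //.
- rewrite -(ltr_nat R) mE mulr_gt0 // exprn_gt0 //.
- rewrite mE natrM [(30 * l)%:R]natrM -/x.
  have -> : 2 ^+ 112 = 16 * 4096 * g ^+ 4 :> R.
    have -> : 112%N = (4 + 12 + 24 * 4)%N by [].
    by rewrite !exprD exprM -g0 -!natrX.
  have -> : 2 / (16 * 4096 * g ^+ 4 * x ^+ 16 * (2 * g * g * x ^+ 7)^-1 ^+ 2) =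
      (2 * 4096 * x ^+ 2)^-1.
    by field; rewrite ?gt_eqF.
  have p0 : 0 < 2 * 4096 * x ^+ 2 by apply: mulr_gt0; [lra|exact: exprn_gt0].
  rewrite (ler_pdivrMr _ _ p0).
  have h2 : l.+2%:R <= 3 * x by rewrite /x -natrM ler_nat; move: l_gt0; clear; lia.
  apply: le_trans (ler_wpM2l _ h2) _; first by apply: mulr_ge0; [exact: ler0n|exact: ltW].
  have := lR 2%N; rewrite expr2; lra.
Qed.
End SketchSizes.

Section LpGrid.
Variables (R : realType) (p : R) (d Delta : nat).
Hypothesis p_ge1 : 1 <= p.
Implicit Types x y : grid d Delta.

Lemma lp_dist_ge1 x y : x != y -> 1 <= lp_dist p x y.
Proof.
move=> xy; have [i xyi] : exists i, x i != y i.
  by apply/existsP; apply: contraR xy => /existsPn h; apply/eqP/ffunP => i; apply/eqP/negPn/h.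
have p0 : 0 < p by move: p_ge1; lra.
have one_pow r : (1 : R) `^ r = 1 by rewrite powR1.
rewrite /lp_dist -(one_pow p^-1) ge0_ler_powR ?nnegrE ?invr_ge0 ?(ltW p0) //.
  by apply: sumr_ge0 => j _; apply: powR_ge0.
rewrite (bigD1 i) //= -[leLHS]addr0 lerD //; last by apply: sumr_ge0 => j _; apply: powR_ge0.
rewrite -(one_pow p) ge0_ler_powR ?nnegrE ?(ltW p0) // /Defs.coord.
have -> : (x i).+1%:R - (y i).+1%:R = ((x i)%:Z - (y i)%:Z)%:~R :> R.
  by rewrite intrB -!pmulrn -!natr1; ring.
rewrite -intr_norm ler1z; move: xyi; rewrite -val_eqE /=; lia.
Qed.

Lemma lp_dist_le x y : lp_dist p x y <= d%:R * Delta%:R.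
Proof.
have p0 : 0 < p by move: p_ge1; lra.
have [d0|d0] := posnP d.
  rewrite /lp_dist big1 ?powR0 ?invr_eq0 ?gt_eqF ?mulr_ge0 // => i.
  by have := leq_ltn_trans (leq0n i) (ltn_ord i); rewrite [X in (_ < X)%N]d0.
have dD0 : 0 <= d%:R * Delta%:R :> R by rewrite mulr_ge0.
have -> : d%:R * Delta%:R = ((d%:R * Delta%:R) `^ p) `^ p^-1 :> R.
  by rewrite -powRrM divff ?gt_eqF // powRr1.
rewrite /lp_dist ge0_ler_powR ?nnegrE ?powR_ge0 ?invr_ge0 ?(ltW p0) //.
  by apply: sumr_ge0 => j _; apply: powR_ge0.
apply: le_trans (le1r_powRZ _ _ p_ge1); rewrite ?ler1n //.
have -> : d%:R * Delta%:R `^ p = \sum_(i < d) Delta%:R `^ p :> R.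
  by rewrite sumr_const card_ord mulr_natl.
apply: ler_sum => i _; rewrite ge0_ler_powR ?nnegrE ?(ltW p0) // /Defs.coord.
have : (x i).+1%:R <= Delta%:R :> R by rewrite ler_nat.
have : (y i).+1%:R <= Delta%:R :> R by rewrite ler_nat.
have : 0 <= (x i).+1%:R :> R by [].
have : 0 <= (y i).+1%:R :> R by [].
by rewrite ler_norml; lra.
Qed.

End LpGrid.

Section LogScale.
Variable R : realType.

Lemma log1_ge1 n : 1 <= log1 R n.
Proof. by rewrite /log1 lerDl ln_ge0 // ler1n. Qed.

Lemma ln2_le1 : ln 2 <= 1 :> R.
Proof. by have := @le_ln1Dx R 1; rewrite -[1 + 1]/(2 : R); apply; lra. Qed.

Lemma ln2_ge : 2^-1 <= ln 2 :> R.
Proof.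
have e := @le_ln1Dx R (- 2^-1).
have -> : ln 2 = - ln (2^-1) :> R by rewrite lnV ?posrE // opprK.
have {}e : ln (1 + - 2^-1) <= - 2^-1 :> R by apply: e; lra.
have h : 1 + - 2^-1 = 2^-1 :> R by lra.
by rewrite h in e; rewrite lerNr.
Qed.

Lemma trunc_log_le n : (trunc_log 2 n.+1)%:R <= 2 * ln n.+1%:R :> R.
Proof.
have h : 2 ^+ trunc_log 2 n.+1 <= n.+1%:R :> R by rewrite -natrX ler_nat trunc_logP.
have : ln (2 ^+ trunc_log 2 n.+1) <= ln n.+1%:R :> R by rewrite ler_ln ?posrE ?exprn_gt0.
rewrite lnXn // -[ln 2 *+ _]mulr_natl; have := ln2_ge; have : 0 <= (trunc_log 2 n.+1)%:R :> R by [].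
nra.
Qed.

Definition log_scale (n d Delta : nat) : nat :=
  (trunc_log 2 n.+1 + trunc_log 2 d.+1 + trunc_log 2 Delta.+1).+1.

Lemma log_scale_le n d Delta :
  (log_scale n d Delta)%:R <= 2 * (log1 R n + log1 R d + log1 R Delta).
Proof.
rewrite /log_scale -addn1 !natrD /log1.
have := trunc_log_le n; have := trunc_log_le d; have := trunc_log_le Delta; lra.
Qed.

Lemma log_scale_gt n d Delta (l := log_scale n d Delta) :
  [/\ (n < 2 ^ l)%N, (d < 2 ^ l)%N & (Delta < 2 ^ l)%N].
Proof.
have h k m : (trunc_log 2 k.+1 < m)%N -> (k < 2 ^ m)%N.
  move=> km; apply: ltn_trans (leq_trans (@trunc_log_ltn 2 k.+1 _) (_ : _ <= 2 ^ m)%N) => //.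
  by rewrite leq_exp2l.
by split; apply: h; rewrite /l /log_scale; lia.
Qed.

End LogScale.

(** The factors are bits per counter, copies for the median, levels, trials per level and counters
    per trial; their degrees 1 + 1 + 1 + 16 + 1 give the exponent 20. *)
Lemma memory_bound (R : realType) (c1 x Lam : R) : 0 <= c1 -> 0 <= x -> x <= 2 * Lam ->
  7 * x * (c1 * x * (30 * x * (2 ^+ 112 * x ^+ 16) * (37 * x))) <=
  c1 * 2 ^+ 125 * 2 ^+ 20 * Lam ^+ 20.
Proof.
move=> c0 x0 xL; have Lpow : x ^+ 20 <= 2 ^+ 20 * Lam ^+ 20.
  by rewrite -exprMn lerXn2r ?nnegrE // (le_trans _ xL).
have -> : 2 ^+ 125 = 2 ^+ 112 * 2 ^+ 13 :> R by rewrite -exprD.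
have t0 : 7 * 30 * 37 <= 2 ^+ 13 :> R by rewrite -natrX -!natrM ler_nat.
have g0 : 0 <= 2 ^+ 112 :> R by apply: exprn_ge0.
move: Lpow t0 g0; move: (2 ^+ 20) (2 ^+ 13) (2 ^+ 112) (Lam ^+ 20) => a t g y Lpow t0 g0.
have -> : 7 * x * (c1 * x * (30 * x * (g * x ^+ 16) * (37 * x))) =
  c1 * g * (7 * 30 * 37 * x ^+ 20) by ring.
have -> : c1 * (g * t) * a * y = c1 * g * (t * (a * y)) by ring.
apply: ler_wpM2l; first exact: mulr_ge0.
apply: ler_pM => //; last exact: exprn_ge0.
Qed.

Theorem theorem1p2 (R : realType) :
  exists (C : R) (k : nat), forall p : R, 1 <= p <= 2 ->
  forall c : nat, exists (K : R) (l : nat), forall n d Delta : nat,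
  exists alg : two_pass_algorithm (update (grid d Delta)) R,
    (mem_bits alg)%:R <= polylog3 K l n d Delta /\
    forall (A B : {mset grid d Delta}) (s : seq (update (grid d Delta))),
      size A = n -> size B = n -> stream_yields s A B ->
      1 - (n.+1%:R ^+ c)^-1 <=
      coin_prob R (fun w => EMD p A B <= run alg s w <= Otilde_log C k n * EMD p A B).
Proof.
(* Markov loses 64, the charge at most 4804 = 4608 + 196 times [log1 R n], and the embedding 19584.
   No double logarithm arises, so [k] is 0 below. *)
pose C : R := 64 * 4804 * 19584.
exists C, 0%N => p /andP[p1 p2] c.
exists (c.+1%:R * 2 ^+ 125 * 2 ^+ 20), 20%N => n d Delta.
pose l := log_scale n d Delta.
have l0 : (0 < l)%N by [].
have [nl dlt Dl] := log_scale_gt n d Delta; have lLam := log_scale_le R n d Delta.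
rewrite -/l in nl dlt Dl lLam; clearbody l.
have [B [m [dl [B_ge dl0 dlB epsL [m0 m_large mE]]]]] := sketch_parameters R l0.
have [K [phi [wt [wt0 emb]]]] := lp_cut_embedding d Delta p1 p2.
(* [2 ^ 15] exceeds the distortion 19584 and [d * Delta] is at most [2 ^ (2 * l)], so [r0] bounds
   the diameter of the cut metric. *)
pose r0 : R := 2 ^+ (2 * l + 15).
have r0_gt0 : 0 < r0 by rewrite exprn_gt0.
have tau1 : 1 <= (16 * l)%:R :> R by rewrite ler1n muln_gt0.
pose mu := coins_dist (grid d Delta) wt0 (30 * l) r0_gt0 tau1 (16 * l) m B_ge.
pose eps : R := 2^-1 * (n.+1%:R ^+ c)^-1.
have eps0 : 0 < eps by rewrite mulr_gt0 // invr_gt0 exprn_gt0.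
(* Final counters are at most [2 ^ l.+2 * 2 ^ l.+1] in absolute value, and twice that must stay
   below the modulus. *)
have q0 : (0 < 2 * l + 5)%N by rewrite addn_gt0 orbT.
pose W1 := @weight1 _ _ phi (30 * l) (16 * l) l.+2 m.
pose W2 := @weight2 _ _ phi (30 * l) (16 * l) l.+2 m.
pose est := @estimate R (30 * l) r0 (16 * l)%:R (16 * l) B l.+1 m dl.
(* With [c * l + 1] copies the median fails with probability at most half of [(n + 1) ^ - c], since
   [n < 2 ^ l]; the other half is [eps], spent on simulating the distribution by coins. *)
have [alg [mem algP]] := median_sketch mu (c * l).+1 W1 W2 est eps0 q0.
exists alg; split.
  rewrite mem /counter1 /counter2 !card_prod card_option !card_ord card_bool.
  apply: le_trans (_ : (7 * l * (c.+1 * l * (30 * l * m * (37 * l))))%:R <= _).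
    rewrite ler_nat; apply: leq_mul; first by move: l0; clear; lia.
    apply: leq_mul; first by move: l0; clear; nia.
    by rewrite -mulnDr leq_mul2l; apply/orP; right; move: l0; clear; lia.
  rewrite !natrM mE /polylog3.
  exact: memory_bound lLam.
move=> A B' s sA sB sAB.
have szAB : size A = size B' by rewrite sA sB.
have [M /andP[MA MB] EM] := EMD_attained p szAB.
have E0 : 0 <= EMD p A B' by rewrite EM; apply: sumr_ge0 => ab _; apply: powR_ge0.
have szN : (size A + size B' <= 2 ^ l.+1)%N.
  by rewrite sA sB addnn expnS mul2n leq_double ltnW.
have stream x : net_count false s x = (count_mem x A)%:Z /\ net_count true s x = (count_mem x B')%:Z.
  by rewrite !count_mem_mset.
have NR : 0 <= ((size A + size B')%:R : R) <= 2 ^+ l.+1.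
  by rewrite ler0n -natrX ler_nat.
have hi_bound : 64 * charge_bound phi wt A B' M <= Otilde_log C 0 n * EMD p A B'.
  rewrite /charge_bound /Otilde_log expr0 mulr1 sA sB.
  have MD : \sum_(ab <- M) cutd phi wt ab.1 ab.2 <= 19584 * EMD p A B'.
    rewrite EM /matching_cost mulr_sumr; apply: ler_sum => ab _.
    by have /andP[] := emb ab.1 ab.2.
  have S0 : 0 <= \sum_(ab <- M) cutd phi wt ab.1 ab.2.
    by apply: sumr_ge0 => ab _; apply: cutd_ge0.
  have lnN : ln (n + n)%:R <= log1 R n.
    case: (posnP n) => [->|n0]; first by rewrite ln0 // (le_trans ler01) // log1_ge1.
    apply: le_trans (_ : ln (2 * n.+1%:R) <= _).
      by rewrite ler_ln ?posrE ?mulr_gt0 ?ltr0n ?addn_gt0 ?n0 // -natrM ler_nat; clear; lia.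
    by rewrite lnM ?posrE // /log1 lerD2r ln2_le1.
  have g1 := log1_ge1 R n.
  apply: le_trans (_ : 64 * ((4804 * log1 R n) * (19584 * EMD p A B')) <= _); last first.
    by rewrite /C le_eqVlt; apply/orP; left; apply/eqP; ring.
  rewrite ler_wpM2l //.
  apply: le_trans (_ : (4804 * log1 R n) * \sum_(ab <- M) cutd phi wt ab.1 ab.2 <= _).
    by apply: (ler_wpM2r S0); move: lnN g1; clear; lra.
  by apply: (ler_wpM2l _ MD); move: g1; clear; lra.
have lo_bound (M' : seq (grid d Delta * grid d Delta)) :
    perm_eq (unzip1 M') A -> perm_eq (unzip2 M') B' ->
    EMD p A B' <= \sum_(xy <- M') cutd phi wt xy.1 xy.2.
  move=> h1 h2; apply: le_trans (EMD_le p (M := M') _) _; first by apply/andP.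
  by apply: ler_sum => xy _; have /andP[] := emb xy.1 xy.2.
have D_le_r0 x y : cutd phi wt x y <= r0.
  have /andP[_ h] := emb x y; apply: le_trans h _.
  apply: le_trans (_ : 2 ^+ 15 * (2 ^+ l * 2 ^+ l) <= _); last first.
    by rewrite /r0 -!exprD; have -> : (2 * l + 15 = 15 + (l + l))%N by clear; lia.
  apply: ler_pM; [exact: ler0n|exact: powR_ge0| |].
    by rewrite -natrX ler_nat.
  apply: le_trans (lp_dist_le p1 x y) _.
  by rewrite ler_pM // -natrX ler_nat ltnW.
have D_ge1 x y : x != y -> 1 <= cutd phi wt x y.
  by move=> xy; have /andP[h _] := emb x y; apply: le_trans h; apply: lp_dist_ge1.
have Pbad : Pr mu (fun w => ~~ (EMD p A B' <= est
    (sketch (W1 w) (fun x => count_mem x A) (fun x => count_mem x B'))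
    (sketch (W2 w (sketch (W1 w) (fun x => count_mem x A) (fun x => count_mem x B')))
      (fun x => count_mem x A) (fun x => count_mem x B')) <= Otilde_log C 0 n * EMD p A B')) <= 16^-1.
  apply: (Pr_estimate wt0 r0_gt0 tau1 B_ge szAB D_le_r0 D_ge1 _ _ _ _ _ _ _ _ m_large
    _ _ MA MB lo_bound hi_bound) => //.
  - by rewrite muln_gt0 l0.
  - exact: fine_scale.
  - apply: (level_union_small l0 NR); last by move: l0; clear; lia.
    by rewrite expR_ge0 expRN_le2.
  - apply: (level_union_small l0 NR); last by move: l0; clear; lia.
    by rewrite lexx invr_ge0 exprn_ge0.
have small (k : nat) (z : int) : (k <= 2 ^ l.+2)%N -> `|z| <= (k * (size A + size B'))%N%:Z ->
    `|z| * 2 < (2 ^ (2 * l + 5))%N%:Z.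
  move=> kl zk; have kN := leq_mul kl szN; rewrite -expnD in kN.
  have -> : (2 * l + 5 = (l.+2 + l.+1).+2)%N by clear; lia.
  move: kN; move: (l.+2 + l.+1)%N => e kN.
  rewrite 2!expnS; have p0 : (0 < 2 ^ e)%N by rewrite expn_gt0.
  move: zk kN p0; set X := (2 ^ _)%N; set Y := (k * _)%N; clear; lia.
have b1 w j : `|sketch (W1 w) (fun x => count_mem x A) (fun x => count_mem x B') j| * 2 <
    (2 ^ (2 * l + 5))%N%:Z.
  apply: (small (2 ^ l.+2)%N); first by rewrite leq_exp2l.
  by apply: sketch_bound => side x; apply: weight1_bound.
have b2 w j : `|sketch (W2 w (sketch (W1 w) (fun x => count_mem x A)
    (fun x => count_mem x B'))) (fun x => count_mem x A) (fun x => count_mem x B') j| * 2 <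
    (2 ^ (2 * l + 5))%N%:Z.
  apply: (small 1%N); first by rewrite expn_gt0.
  by apply: sketch_bound => side x; apply: weight2_bound.
apply: le_trans (algP _ _ s _ _ stream b1 b2 Pbad).
rewrite -addrA lerD2l -opprD lerN2 /eps.
have copies : (2 ^+ (c * l).+1)^-1 <= 2^-1 * (n.+1%:R ^+ c)^-1 :> R.
  rewrite exprS invfM ler_wpM2l ?invr_ge0 // lef_pV2 ?posrE ?exprn_gt0 //.
  by rewrite mulnC exprM lerXn2r ?nnegrE ?exprn_ge0 // -natrX ler_nat.
apply: le_trans (lerD copies (lexx _)) _.
by move: (n.+1%:R ^+ c)^-1 => y; clear; lra.
Qed.
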